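(* Let $\Gamma\subset\mathbb{R}^2$ be a spiraling curve. The set $\mathcal{W}_\Gamma$ of weak limits of translates of $\Gamma$ is given by $$\mathcal{W}_\Gamma=\mathcal{S}_\Gamma\cup\mathcal{L}_\Gamma\cup\mathcal{E}_\Gamma,$$ where $\mathcal{S}_\Gamma=\{z+\Gamma:z\in\mathbb{R}^2\}$, $\mathcal{E}_\Gamma=\{z+E_\beta:\beta\in\mathcal{I}_\Gamma,\ z\in\mathbb{R}^2\}$, and $$\mathcal{L}_\Gamma=\Big\{\tau\vec{d}_\bot+L_{\vec{d},\lambda\mathbb{Z}}:\ \tau\in\mathbb{R},\ \vec{d}=\lim_{\theta\searrow0}\vec{d}_\beta(\theta)\text{ or }\vec{d}=\lim_{\theta\nearrow0}\vec{d}_\beta(\theta),\ \beta\in\mathbb{T}\Big\},$$ with $\lambda=\eta_\beta(0)\sin\big(\arccos(\vec{\ell}(\beta)\cdot\vec{d}\,)\big)$.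
   Context: General notions. $\mathbb{N}=\{1,2,\dots\}$. $\mathcal{H}^1$ is 1-dimensional Hausdorff measure on $\mathbb{R}^2$, normalized to equal Lebesgue measure on lines. A trajectory is the image of a curve $\gamma:\mathbb{R}\to\mathbb{R}^2$ whose restriction to each finite interval is rectifiable; a trajectory set is a countable collection (union) of trajectories. Trajectory sets $\Gamma_n$ converge weakly to a trajectory set $\Gamma$, written $\Gamma_n\stackrel{w}{\to}\Gamma$, if $\int_{\Gamma_n}\phi\,d\mathcal{H}^1\to\int_\Gamma\phi\,d\mathcal{H}^1$ for every nonnegative $\phi\in C_c(\mathbb{R}^2)$ (continuous, compactly supported). $\Gamma'$ is a weak limit of translates of $\Gamma$ if there is a sequence $\{z_n\}$ in $\mathbb{R}^2$ with $z_n+\Gamma\stackrel{w}{\to}\Gamma'$; $\mathcal{W}_\Gamma$ is the set of all of these. $\mathbb{T}\cong[0,1)$ is the circle $\mathbb{R}/\mathbb{Z}$, $\mathrm{dist}$ its distance (with $\mathrm{dist}(\beta,\emptyset)=\infty$), $\vec{\ell}(\theta)=(\cos2\pi\theta,\sin2\pi\theta)$, $\mathbb{S}^1$ is the unit circle in $\mathbb{R}^2$. For $\vec{d}\in\mathbb{S}^1$, $\vec{d}_\bot$ is $\vec{d}$ rotated by $\pi/2$, and for countable $\Lambda\subset\mathbb{R}$, $L_{\vec{d},\Lambda}:=\{t\vec{d}+\mu\vec{d}_\bot:t\in\mathbb{R},\ \mu\in\Lambda\}$. Spiraling curves. A trajectory set $\Gamma$ is called spiraling (a spiraling curve), with finite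 exceptional set $\mathcal{I}_\Gamma\subset\mathbb{T}$, if the following holds. For $\beta\in\mathbb{T}\setminus\mathcal{I}_\Gamma$: (A.i) (Escape cone) for $\alpha:=\min\{\mathrm{dist}(\beta,\mathcal{I}_\Gamma),1/8\}$ the intersection of $\Gamma$ with the cone $\mathcal{C}_{\alpha,\beta}:=\{(r\cos2\pi\theta,r\sin2\pi\theta):r\geq0,\ \beta-\alpha\leq\theta\leq\beta+\alpha\}$ can be parametrized in polar coordinates as $\gamma_\beta(\theta)=(r_\beta(\theta)\cos2\pi\theta,r_\beta(\theta)\sin2\pi\theta)$ with $\theta\in\bigcup_{k\in\mathbb{N}}[k+\beta-\alpha,k+\beta+\alpha]$ and $r_\beta$ a nonnegative $C^2$-function on each interval whose $C^2$-norm is globally bounded. (A.ii) (Asymptotic radial monotonicity) there is $K\in\mathbb{N}$ such that for every fixed $\theta\in[-\alpha,\alpha]$ the sequence $r_\beta(k+\beta+\theta)$ is strictly increasing for $k\geq K$. (A.iii) (Asymptotic flatness) the curvature $\kappa_\beta$ of $\gamma_\beta$ satisfies $\sup_{\theta\in(-\alpha,\alpha)}|\kappa_\beta(k+\beta+\theta)|\to0$ as $k\to\infty$. (A.iv) (Asymptotic equispacing) there are continuous functions $\eta_\beta:[-\alpha,\alpha]\to\mathbb{R}^+$ and $\rho_\beta:[-\alpha,\alpha]\to\mathbb{R}$ with $\sup_{\theta\in[-\alpha,\alpha]}|r_\beta(k+\beta+\theta)-\eta_\beta(\theta)k-\rho_\beta(\theta)|\to0$ as $k\to\infty$. (A.v)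 (Asymptotic velocity) there is a continuous function $\vec{d}_\beta:[-\alpha,\alpha]\to\mathbb{S}^1$ such that $\vec{d}_\beta(\theta)$ is non-collinear with $\vec{\ell}(\beta+\theta)$ and $\sup_{\theta\in[-\alpha,\alpha]}\left\|\frac{\gamma_\beta'(k+\beta+\theta)}{\|\gamma_\beta'(k+\beta+\theta)\|}-\vec{d}_\beta(\theta)\right\|\to0$ as $k\to\infty$. For $\beta\in\mathcal{I}_\Gamma$ the same conditions hold with these modifications: (B.i) now $\alpha:=\min\{\mathrm{dist}(\beta,\mathcal{I}_\Gamma\setminus\{\beta\}),1/8\}$; on each $[k+\beta-\alpha,k+\beta+\alpha]$ the parametrization $\gamma_\beta$ is continuous, and its restrictions to $(k+\beta,k+\beta+\alpha]$ and $[k+\beta-\alpha,k+\beta)$ are $C^2$-functions with bounded $C^2$-norms. (B.iii) the supremum in (A.iii) is over $(-\alpha,\alpha)\setminus\{0\}$. (B.v) $\vec{d}_\beta$ is continuous on $[-\alpha,\alpha]\setminus\{0\}$, the limits $\lim_{\theta\nearrow0}\vec{d}_\beta(\theta)$ and $\lim_{\theta\searrow0}\vec{d}_\beta(\theta)$ exist, and the supremum in (A.v) is over $[-\alpha,\alpha]\setminus\{0\}$. For $\beta\in\mathcal{I}_\Gamma$ the set of parallel edges $E_\beta$ is $$E_\beta:=\{\eta_\beta(0)k\vec{\ell}(\beta)-t\vec{d}_\beta^{\,-}:k\in\mathbb{Z},\ t\in[0,\infty)\}\cup\{\eta_\beta(0)k\vec{\ell}(\beta)+t\vec{d}_\beta^{\,+}:k\in\mathbb{Z},\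 t\in[0,\infty)\},$$ where $\vec{d}_\beta^{\,-}=\lim_{\theta\nearrow0}\vec{d}_\beta(\theta)$ and $\vec{d}_\beta^{\,+}=\lim_{\theta\searrow0}\vec{d}_\beta(\theta)$.
   Formalization: Weak limits are fixed only up to H^1-null sets (adding a point gives another), so each element of W_Γ is shown equal to one of S∪L∪E up to a null set; S∪L∪E⊂W_Γ is literal. The C^2-norm bound may depend on the interval, as a uniform one contradicts (A.iv). *)

(* Defs.v *)
(* MathComp-Analysis; the real numbers are an arbitrary [R : realType]. *)
From HB Require Import structures.
From mathcomp Require Import all_boot all_order all_algebra.
From mathcomp Require Import all_classical all_reals all_analysis.

Set Implicit Arguments.
Unset Strict Implicit.
Unset Printing Implicit Defensive.

Import Order.TTheory GRing.Theory Num.Theory.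
Import numFieldNormedType.Exports.

Local Open Scope classical_set_scope.
Local Open Scope ring_scope.

(* The canonical norm of [R * R] is the sup norm (same topology); every metric
   notion below uses the Euclidean norm [enorm] instead. *)
Notation plane R := (R * R)%type (only parsing).

Section Plane.
Context {R : realType}.
Implicit Types (u v z : plane R) (A : set (plane R)).

Definition dot u v : R := u.1 * v.1 + u.2 * v.2.
Definition enorm u : R := Num.sqrt (dot u u).
Definition cross u v : R := u.1 * v.2 - u.2 * v.1.
Definition rot90 u : plane R := (- u.2, u.1).

(* Angles are measured in turns. *)
Definition ell (t : R) : plane R := (cos (2 * pi * t), sin (2 * pi * t)).

Definition translate z A : set (plane R) := [set z + x | x in A].

Definition ediam A : \bar R :=
  maxe 0%E (ereal_sup [set (enorm (x - y))%:E | x in A & y in A]).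

End Plane.

Section Hausdorff.
Context {R : realType}.
Implicit Types (A : set (plane R)) (U : nat -> set (plane R)).
Local Open Scope ereal_scope.

Definition small_cover (e : R) A : set (nat -> set (plane R)) :=
  [set U | (forall i, ediam (U i) <= e%:E) /\ A `<=` \bigcup_i U i].

Definition hausdorff1_pre (e : R) A : \bar R :=
  ereal_inf [set \sum_(i <oo) ediam (U i) | U in small_cover e A].

(* No normalizing constant: for sets of dimension 1 the diameter is the length,
   so this is Lebesgue measure on lines. *)
Definition hausdorff1 A : \bar R :=
  ereal_sup [set hausdorff1_pre e A | e in [set e : R | (0 < e)%R]].

Lemma ediam_ge0 A : 0 <= ediam A.
Proof. by rewrite /ediam le_max lexx. Qed.

Lemma ediam0 : ediam (@set0 (plane R)) = 0.
Proof.
rewrite /ediam (_ : [set _ | _ in _ & _ in _] = set0) ?ereal_sup0 ?maxeNy//.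
by apply/seteqP; split => // x [a []].
Qed.

Lemma hausdorff1_pre_ge0 e A : 0 <= hausdorff1_pre e A.
Proof.
apply: le_ereal_inf_tmp => _ [U _ <-]; apply: nneseries_ge0 => i _ _.
exact: ediam_ge0.
Qed.

Lemma hausdorff1_pre0 e : (0 < e)%R -> hausdorff1_pre e set0 = 0.
Proof.
move=> e0; apply/eqP; rewrite eq_le hausdorff1_pre_ge0 andbT.
apply: ereal_inf_lbound; exists (fun=> set0).
  by split=> [i|//]; rewrite ediam0 lee_fin ltW.
by rewrite eseries0// => i _ _; exact: ediam0.
Qed.

Lemma le_hausdorff1_pre e : {homo hausdorff1_pre e : A B / A `<=` B >-> A <= B}.
Proof.
move=> A B AB; apply/ereal_inf_le_tmp => _ [U [Ue BU] <-].
by exists U => //; split => //; exact: subset_trans BU.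
Qed.

Lemma hausdorff1_pre_sigma_subadditive e : sigma_subadditive (hausdorff1_pre e).
Proof.
move=> A; have [[i ioo]|] := pselect (exists i, hausdorff1_pre e (A i) = +oo).
  rewrite (eseries_pinfty _ _ ioo) ?leey// => n _.
  by rewrite -ltNye (lt_le_trans _ (hausdorff1_pre_ge0 _ _)).
rewrite -forallNE => Aoo.
suff add2e (d : {posnum R}) :
    hausdorff1_pre e (\bigcup_n A n) <=
    \sum_(i <oo) hausdorff1_pre e (A i) + d%:num%:E.
  by apply/lee_addgt0Pr => _/posnumP[].
rewrite (le_trans _ (epsilon_trick _ _ _))//; last first.
  by move=> n; exact: hausdorff1_pre_ge0.
pose P n (B : (set (plane R))^nat) := small_cover e (A n) B /\
  \sum_(k <oo) ediam (B k) <=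
    hausdorff1_pre e (A n) + (d%:num / (2 ^ n.+1)%:R)%:E.
have [G PG] : {G : ((set (plane R))^nat)^nat & forall n, P n (G n)}.
  apply: (@choice _ _ P) => n; rewrite /P /hausdorff1_pre.
  set S := (X in ereal_inf X); move infS : (ereal_inf S) => iS.
  case: iS infS => [r Sr|Soo|Soo].
  - have en1 : (0 < d%:num / (2 ^ n.+1)%:R)%R by [].
    have /(lb_ereal_inf_adherent en1) : ereal_inf S \is a fin_num by rewrite Sr.
    move=> [x [B [mB AnB] muBx] xS].
    by exists B; split => //; rewrite muBx -Sr; exact/ltW.
  - by have := Aoo n; rewrite /hausdorff1_pre Soo.
  - suff : lbound S 0 by move/le_ereal_inf_tmp; rewrite Soo.
    move=> /= _ [B [mB AnB] <-]; apply: nneseries_ge0 => ? _ _.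
    exact: ediam_ge0.
have muG_ge0 x : 0 <= (ediam \o uncurry G) x by exact: ediam_ge0.
apply: (@le_trans _ _ (\esum_(i in setT) (ediam \o uncurry G) i)).
  apply: ereal_inf_lbound => /=.
  have /card_esym/ppcard_eqP[f] := card_nat2.
  exists (uncurry G \o f).
    split => [i|]; first by rewrite /= /uncurry; case: (f i) => a b; exact: (PG a).1.1.
    apply: (@subset_trans _  (\bigcup_n \bigcup_k G n k)) => [t [i _]|].
      by move=> /((PG i).1.2) -[j _ ?]; exists i => //; exists j.
    move=> t [i _ [j _ Bijt]]; exists (f^-1%FUN (i, j)) => //=.
    by rewrite invK ?inE.
  rewrite -(esum_pred_image (ediam \o uncurry G) _ xpredT) ?[fun=> _]set_true//.
  by rewrite image_eq.
rewrite (_ : esum _ _ = \sum_(i <oo) \sum_(j <oo ) ediam (G i j)); last first.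
  pose J : nat -> set (nat * nat) := fun i => [set (i, j) | j in setT].
  rewrite (_ : setT = \bigcup_k J k); last first.
    by rewrite predeqE => -[a b]; split => // _; exists a => //; exists b.
  rewrite esum_bigcupT /=; last 2 first.
    - apply/trivIsetP => i j _ _ ij.
      rewrite predeqE => -[n m] /=; split => //= -[] [_] _ [<-{n} _].
      by move=> [m' _] [] /esym/eqP; rewrite (negbTE ij).
    - by move=> /= [n m]; exact: ediam_ge0.
  rewrite -(image_id [set: nat]) -fun_true esum_pred_image//; last first.
    by move=> n _; apply: esum_ge0 => m _; exact: ediam_ge0.
  apply: eq_eseriesr => /= j _.
  rewrite -(esum_pred_image (ediam \o uncurry G) (pair j) predT)/=; first last.
  - by move=> ? ? _ _; exact: (@can_inj _ _ _ snd).
  - by move=> n _; exact: ediam_ge0.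
  by congr esum; rewrite predeqE => -[a b]; split; move=> [i _ <-]; exists i.
apply: lee_lim.
- apply: is_cvg_nneseries => n *.
  by apply: nneseries_ge0 => m *; exact: (muG_ge0 (n, m)).
- by apply: is_cvg_nneseries => n *; apply: adde_ge0 => //; exact: hausdorff1_pre_ge0.
- by near=> n; apply: lee_sum => i _; exact: (PG i).2.
Unshelve. all: by end_near. Qed.

Lemma hausdorff1_ge0 A : 0 <= hausdorff1 A.
Proof.
apply: (le_trans (hausdorff1_pre_ge0 1 A)).
by apply: ereal_sup_ubound; exists 1%R => //=.
Qed.

Lemma hausdorff1_set0 : hausdorff1 set0 = 0.
Proof.
apply/eqP; rewrite eq_le hausdorff1_ge0 andbT.
by apply: ge_ereal_sup => _ [e /= e0 <-]; rewrite hausdorff1_pre0.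
Qed.

Lemma le_hausdorff1 : {homo hausdorff1 : A B / A `<=` B >-> A <= B}.
Proof.
move=> A B AB; apply: ge_ereal_sup => _ [e /= e0 <-].
apply: (le_trans (le_hausdorff1_pre e AB)).
by apply: ereal_sup_ubound; exists e.
Qed.

Lemma hausdorff1_sigma_subadditive : sigma_subadditive hausdorff1.
Proof.
move=> F; apply: ge_ereal_sup => _ [e /= e0 <-].
apply: (le_trans (hausdorff1_pre_sigma_subadditive e F)).
apply: lee_nneseries => [i _ _|i _]; first exact: hausdorff1_pre_ge0.
by apply: ereal_sup_ubound; exists e.
Qed.

HB.instance Definition _ := isOuterMeasure.Build R (plane R) hausdorff1
  hausdorff1_set0 hausdorff1_ge0 le_hausdorff1 hausdorff1_sigma_subadditive.

(* The integral is the library's one for [hausdorff1] seen as a measure on its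
   Caratheodory sigma-algebra. *)
Definition H1_integral A (phi : plane R -> R) : \bar R :=
  \int[hausdorff1 : set (caratheodory_type hausdorff1) -> \bar R]_(x in A)
    (phi x)%:E.

(* Equality up to an H^1-null set, i.e. equality of the restrictions of H^1. *)
Definition H1_equal A B : Prop := hausdorff1 (A `+` B) = 0.

End Hausdorff.

Section Trajectories.
Context {R : realType}.

Definition polygonal_length (a b : R) (g : R -> plane R) (s : seq R) : R :=
  let F := g \o nth b (a :: s) in
  \sum_(0 <= n < size s) enorm (F n.+1 - F n).

Definition rectifiable (a b : R) (g : R -> plane R) : Prop :=
  exists M : R, forall s, itv_partition a b s -> polygonal_length a b g s <= M.

Definition trajectory_curve (g : R -> plane R) : Prop :=
  continuous g /\ forall a b, a < b -> rectifiable a b g.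

Definition trajectory_set (G : set (plane R)) : Prop :=
  exists C : set (R -> plane R),
    [/\ countable C, forall g, C g -> trajectory_curve g &
        G = \bigcup_(g in C) range g].

Definition weakly_converges (Gn : nat -> set (plane R)) (G : set (plane R)) :=
  forall phi : plane R -> R, continuous phi -> (forall x, 0 <= phi x) ->
    compact (closure [set x | phi x != 0]) ->
    H1_integral (Gn n) phi @[n --> \oo] --> H1_integral G phi.

Definition weak_limits (G : set (plane R)) : set (set (plane R)) :=
  [set G' | trajectory_set G' /\
    exists z : nat -> plane R, weakly_converges (fun n => translate (z n) G) G'].

End Trajectories.

Section Calculus.
Context {R : realType} {V : normedModType R}.
Implicit Types (D : set R) (f : R -> V).

(* Derivatives of the restriction of [f] to [D]: one-sided at the end points of
   [D] that belong to [D], and independent of the values of [f] off [D]. *)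
Definition diff_quot_in D f (x : R) : set_system V :=
  (y - x)^-1 *: (f y - f x) @[y --> within D x^'].

Definition derivable_in D f := forall x, D x -> cvg (diff_quot_in D f x).

Definition deriv_in D f (x : R) : V := lim (diff_quot_in D f x).

Definition C2_in D f : Prop :=
  [/\ derivable_in D f, derivable_in D (deriv_in D f) &
      {within D, continuous (deriv_in D (deriv_in D f))}].

Definition C2_bounded_in D f : Prop :=
  C2_in D f /\
  exists M : R, forall x, D x ->
    [/\ `|f x| <= M, `|deriv_in D f x| <= M &
        `|deriv_in D (deriv_in D f) x| <= M].

End Calculus.

Section Spirals.
Context {R : realType}.

Definition curvature_in (D : set R) (g : R -> plane R) (t : R) : R :=
  cross (deriv_in D g t) (deriv_in D (deriv_in D g) t)
  / enorm (deriv_in D g t) ^+ 3.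

Definition unit_velocity_in (D : set R) (g : R -> plane R) (t : R) : plane R :=
  (enorm (deriv_in D g t))^-1 *: deriv_in D g t.

Definition sup_cvg0 (A : set R) (F : nat -> R -> R) : Prop :=
  ereal_sup [set (F k t)%:E | t in A] @[k --> \oo] --> 0%E.

(* The circle R/Z is represented by [0, 1). *)
Definition circle : set R := [set` `[0, 1[%R].

Definition circle_dist (s t : R) : R := Num.min `|s - t| (1 - `|s - t|).

(* [ereal_inf set0 = +oo], so that the distance to the empty set is infinite. *)
Definition half_aperture (E : set R) (b : R) : R :=
  fine (mine (ereal_inf [set (circle_dist b t)%:E | t in E]) (8^-1)%:E).

Definition cone (a b : R) : set (plane R) :=
  [set x | exists r t, [/\ 0 <= r, b - a <= t <= b + a & x = r *: ell t]].

Definition polar (r : R -> R) (t : R) : plane R := r t *: ell t.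

Definition sector (a b : R) (k : nat) : set R :=
  [set` `[k%:R + b - a, k%:R + b + a]%R].

(* [radius b], [spacing b], [offset b] and [heading b] are the functions
   r_b, eta_b, rho_b and d_b attached to the angle [b]. *)
Record spiral_data := SpiralData {
  radius : R -> R -> R;
  spacing : R -> R -> R;
  offset : R -> R -> R;
  heading : R -> R -> plane R }.

(* The target of [lim] is ascribed because its pointed structure on [R * R] is
   only found through the normed module one. *)
Definition heading_left (s : spiral_data) (b : R) : plane R :=
  [lim heading s b t @[t --> 0^'-] in (plane R : normedModType R)].

Definition heading_right (s : spiral_data) (b : R) : plane R :=
  [lim heading s b t @[t --> 0^'+] in (plane R : normedModType R)].

Section Conditions.
Variables (G : set (plane R)) (s : spiral_data) (b a : R).
Let r := radius s b.

Definition escape_cone : Prop :=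
  G `&` cone a b =
    [set polar r t | t in \bigcup_(k in [set k | (1 <= k)%N]) sector a b k]
  /\ forall k t, (1 <= k)%N -> sector a b k t -> 0 <= r t.

(* [Z] is the set of offsets from [b] that are left out: empty for a regular
   angle and {0} for an exceptional one. *)
Variable Z : set R.
Let punctured (k : nat) : set R :=
  [set k%:R + b + t | t in [set` `[- a, a]%R] `\` Z].

Record asymptotics : Prop := {
  radial_monotonicity : exists K : nat, (1 <= K)%N /\
    forall t, - a <= t <= a -> forall k, (K <= k)%N ->
      r (k%:R + b + t) < r (k.+1%:R + b + t);
  flatness : sup_cvg0 ([set` `]- a, a[%R] `\` Z)
    (fun k t => `|curvature_in (punctured k) (polar r) (k%:R + b + t)|);
  spacing_continuous : {within [set` `[- a, a]%R], continuous (spacing s b)};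
  spacing_gt0 : forall t, - a <= t <= a -> 0 < spacing s b t;
  offset_continuous : {within [set` `[- a, a]%R], continuous (offset s b)};
  equispacing : sup_cvg0 [set` `[- a, a]%R]
    (fun k t => `|r (k%:R + b + t) - spacing s b t * k%:R - offset s b t|);
  heading_continuous :
    {within [set` `[- a, a]%R] `\` Z, continuous (heading s b)};
  heading_unit : forall t, ([set` `[- a, a]%R] `\` Z) t ->
    enorm (heading s b t) = 1;
  heading_noncollinear : forall t, ([set` `[- a, a]%R] `\` Z) t ->
    ~ exists c : R, heading s b t = c *: ell (b + t);
  velocity : sup_cvg0 ([set` `[- a, a]%R] `\` Z)
    (fun k t => enorm (unit_velocity_in (punctured k) (polar r) (k%:R + b + t)
                       - heading s b t)) }.

(* The bound on the C^2-norm may depend on [k]: a bound on |r| uniform in [k]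
   would contradict [equispacing], where the spacing is positive. *)
Definition regular_angle : Prop :=
  [/\ escape_cone,
      forall k, (1 <= k)%N -> C2_bounded_in (sector a b k) r &
      asymptotics].

Definition exceptional_angle : Prop :=
  [/\ escape_cone,
      forall k, (1 <= k)%N ->
        [/\ {within sector a b k, continuous (polar r)},
            C2_bounded_in [set` `](k%:R + b), (k%:R + b + a)]%R] (polar r) &
            C2_bounded_in [set` `[(k%:R + b - a), (k%:R + b)[%R] (polar r)],
      asymptotics,
      heading s b t @[t --> 0^'-] --> heading_left s b &
      heading s b t @[t --> 0^'+] --> heading_right s b].

End Conditions.

Record spiraling (G : set (plane R)) (I : set R) (s : spiral_data) : Prop := {
  spiral_trajectory : trajectory_set G;
  exceptional_finite : finite_set I;
  exceptional_circle : I `<=` circle;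
  spiral_regular : forall b, circle b -> ~ I b ->
    regular_angle G s b (half_aperture I b) set0;
  spiral_exceptional : forall b, I b ->
    exceptional_angle G s b (half_aperture (I `\ b) b) [set 0] }.

Definition parallel_lines (d : plane R) (L : set R) : set (plane R) :=
  [set x | exists t m, L m /\ x = t *: d + m *: rot90 d].

Definition multiples (l : R) : set R := [set l * m%:~R | m in [set: int]].

Definition parallel_edges (s : spiral_data) (b : R) : set (plane R) :=
  [set x | exists (k : int) (t : R), 0 <= t /\
     x = (spacing s b 0 * k%:~R) *: ell b - t *: heading_left s b]
  `|`
  [set x | exists (k : int) (t : R), 0 <= t /\
     x = (spacing s b 0 * k%:~R) *: ell b + t *: heading_right s b].

Definition translates (G : set (plane R)) : set (set (plane R)) :=
  [set translate z G | z in [set: plane R]].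

Definition line_limits (s : spiral_data) : set (set (plane R)) :=
  [set G' | exists (b tau : R) (d : plane R),
    [/\ circle b, d = heading_right s b \/ d = heading_left s b &
        G' = translate (tau *: rot90 d) (parallel_lines d
               (multiples (spacing s b 0 * sin (acos (dot (ell b) d)))))]].

Definition edge_limits (I : set R) (s : spiral_data) : set (set (plane R)) :=
  [set G' | exists (b : R) (z : plane R),
    I b /\ G' = translate z (parallel_edges s b)].

End Spirals.

Arguments spiral_data : clear implicits.

(* Main.v *)
(* A point of the spiral far from the origin sees, in a disk of fixed radius,
   finitely many arcs: the velocities converge uniformly, so the arcs are nearly
   straight, and they meet the ray through the point at nearly equidistant points.
   Moving such points to the origin while their angles tend to [b] therefore
   produces in the limit half-lines issued from the points [k eta_b(0) ell(b)],
   with the one-sided limits of the headings as directions; if the points recede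
   from the ray at [b], the corners go to infinity and full lines are left.

   Conversely, along an ultrafilter the translation vectors either converge, and
   the limit is a translate of the spiral, or are unbounded, and then their
   opposites stay at a bounded distance from the spiral with an angle tending to
   some [b], which is the previous situation. The limits are identified up to
   null sets because the spiral, the lines and the edges are closed and have
   finite length in every disk. *)
Require Import Defs.
From mathcomp Require Import all_boot all_order all_algebra.
From mathcomp Require Import all_classical all_reals all_analysis.
From mathcomp Require Import measurable_realfun.
From mathcomp Require Import ring lra zify.

Set Implicit Arguments.
Unset Strict Implicit.
Unset Printing Implicit Defensive.

Import Order.TTheory GRing.Theory Num.Theory.
Import numFieldNormedType.Exports.

Local Open Scope classical_set_scope.
Local Open Scope ring_scope.

(** * Plane geometry *)

(** Weak convergence is reduced to a finite geometric statement. Inside a disk, the approximating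
    sets and the limit are cut into finitely many disjoint pieces, indexed alike, each a Lipschitz
    graph of small slope leaving a prescribed point in a prescribed direction ([near_ray], [fan]).
    The integral of a test function over such a piece is known up to a small error from the point
    and the direction alone, so both sides are compared with the same number. Lines and edges form
    one family [edges v dm dp], the lines being the case [dm = dp]. The obstacle lies at exceptional
    angles: headings are assumed non-collinear with the ray only off the exceptional ray, and
    collinearity could appear in the one-sided limits. It is excluded by comparison with the chart
    of a regular angle half an aperture away, whose closed sector contains the exceptional ray.
    Convergence at an angle is stated for filters over any type: the sequence filter realises the
    limits, an ultrafilter classifies them without extraction of subsequences. *)

Section PlaneGeometry.
Context {R : realType}.
Implicit Types (u v w z e : plane R) (c t : R).

Lemma dotDl u v w : dot (u + v) w = dot u w + dot v w.
Proof. by rewrite /dot /=; ring. Qed.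

Lemma dotNl u w : dot (- u) w = - dot u w.
Proof. by rewrite /dot /=; ring. Qed.

Lemma dotBl u v w : dot (u - v) w = dot u w - dot v w.
Proof. by rewrite dotDl dotNl. Qed.

Lemma dotZl c u w : dot (c *: u) w = c * dot u w.
Proof. by rewrite /dot /= /GRing.scale /=; ring. Qed.

Lemma dotC u v : dot u v = dot v u.
Proof. by rewrite /dot; ring. Qed.

Lemma crossE u v : cross u v = dot (rot90 u) v.
Proof. by rewrite /cross /dot /=; ring. Qed.

Lemma crossEr u v : cross u v = - dot u (rot90 v).
Proof. by rewrite /cross /dot /=; ring. Qed.

Lemma dot_ge0 u : 0 <= dot u u.
Proof. by rewrite /dot -!expr2 addr_ge0 ?sqr_ge0. Qed.

Lemma enorm_ge0 u : 0 <= enorm u.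
Proof. exact: sqrtr_ge0. Qed.

Lemma sqr_enorm u : enorm u ^+ 2 = dot u u.
Proof. by rewrite sqr_sqrtr // dot_ge0. Qed.

Lemma enormN u : enorm (- u) = enorm u.
Proof. by rewrite /enorm /dot /= !mulrNN. Qed.

Lemma enormZ c u : enorm (c *: u) = `|c| * enorm u.
Proof.
rewrite /enorm (_ : dot _ _ = c ^+ 2 * dot u u); last first.
  by rewrite dotZl dotC dotZl mulrA expr2.
by rewrite sqrtrM ?sqr_ge0// sqrtr_sqr.
Qed.

Lemma enorm0 : enorm (0 : plane R) = 0.
Proof. by rewrite -(scale0r (0 : plane R)) enormZ normr0 mul0r. Qed.

(** Lagrange's identity; dropping either square gives the Cauchy-Schwarz bounds [dot_le] and
    [cross_le]. *)
Lemma dot_sqr u v : dot u v ^+ 2 + cross u v ^+ 2 = dot u u * dot v v.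
Proof. by rewrite /dot /cross; ring. Qed.

Lemma dot_le u v : `|dot u v| <= enorm u * enorm v.
Proof.
rewrite -ler_sqr ?nnegrE ?mulr_ge0 ?enorm_ge0 ?normr_ge0//.
by rewrite real_normK ?num_real// exprMn !sqr_enorm -dot_sqr lerDl sqr_ge0.
Qed.

Lemma cross_le u v : `|cross u v| <= enorm u * enorm v.
Proof.
rewrite -ler_sqr ?nnegrE ?mulr_ge0 ?enorm_ge0 ?normr_ge0//.
by rewrite real_normK ?num_real// exprMn !sqr_enorm -dot_sqr lerDr sqr_ge0.
Qed.

Lemma enormD u v : enorm (u + v) <= enorm u + enorm v.
Proof.
rewrite -ler_sqr ?nnegrE ?addr_ge0 ?enorm_ge0//.
have -> : enorm (u + v) ^+ 2 = enorm u ^+ 2 + enorm v ^+ 2 + 2 * dot u v.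
  by rewrite !sqr_enorm /dot /=; ring.
have := dot_le u v; rewrite ler_norml => /andP[_ h]; nra.
Qed.

Lemma enormB u v : enorm (u - v) <= enorm u + enorm v.
Proof. by rewrite -(enormN v) enormD. Qed.

(* Keeping distances opaque to unification spares [lra] the many convertible
   forms of the subtraction of [R * R]. *)
Definition pdist u v : R := enorm (u - v).

Lemma pdist_ge0 u v : 0 <= pdist u v.
Proof. exact: enorm_ge0. Qed.

Lemma pdistC u v : pdist u v = pdist v u.
Proof. by rewrite /pdist -enormN opprB. Qed.

Lemma pdist_triangle v u w : pdist u w <= pdist u v + pdist v w.
Proof.
rewrite /pdist (_ : u - w = (u - v) + (v - w)) ?enormD//.
by rewrite addrA subrK.
Qed.

Lemma pdistxx u : pdist u u = 0.
Proof. by rewrite /pdist subrr enorm0. Qed.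

Lemma pdist0 u : pdist u 0 = enorm u.
Proof. by rewrite /pdist subr0. Qed.

Lemma enorm_sub_dist u v : `|enorm u - enorm v| <= pdist u v.
Proof.
rewrite -!pdist0 ler_norml; apply/andP; split.
  by have := pdist_triangle u v 0; rewrite (pdistC v u); lra.
by have := pdist_triangle v u 0; lra.
Qed.

Lemma enorm_eq0 u : enorm u = 0 -> u = 0.
Proof.
move=> u0; have : dot u u = 0 by rewrite -sqr_enorm u0 expr0n.
rewrite /dot -!expr2 => /eqP; rewrite paddr_eq0 ?sqr_ge0// !sqrf_eq0.
by case: u {u0} => a b /= /andP[/eqP-> /eqP->].
Qed.

Lemma enorm_rot90 u : enorm (rot90 u) = enorm u.
Proof. by rewrite /enorm /dot /=; congr Num.sqrt; ring. Qed.

Lemma dot_unit e : enorm e = 1 -> dot e e = 1.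
Proof. by rewrite -sqr_enorm => ->; rewrite expr1n. Qed.

Lemma dot_rot90 u : dot u (rot90 u) = 0.
Proof. by rewrite /dot /=; ring. Qed.

Lemma dot_unit_le e u : enorm e = 1 -> `|dot u e| <= enorm u.
Proof. by move=> e1; have := dot_le u e; rewrite e1 mulr1. Qed.

Lemma unit_decomp e u : enorm e = 1 ->
  u = dot u e *: e + dot u (rot90 e) *: rot90 e.
Proof.
move=> /dot_unit; case: e u => [a b] [x y]; rewrite /dot /= /GRing.scale /= => e1.
apply/pair_equal_spec; rewrite /= /GRing.scale /=; split.
  (* Multiplying by [dot e e = 1] makes both sides homogeneous, and the identity becomes
     polynomial. *)
  by rewrite -[LHS]mulr1 -e1; ring.
by rewrite -[LHS]mulr1 -e1; ring.
Qed.

Lemma enorm_le_dot e u : enorm e = 1 ->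
  enorm u <= `|dot u e| + `|dot u (rot90 e)|.
Proof.
move=> e1; rewrite {1}(unit_decomp u e1); apply: (le_trans (enormD _ _)).
by rewrite !enormZ enorm_rot90 e1 !mulr1.
Qed.

Lemma enorm_ell t : enorm (ell t : plane R) = 1.
Proof. by rewrite /enorm /dot /ell /= -!expr2 cos2Dsin2 sqrtr1. Qed.

Lemma cross_ell s t : cross (ell s) (ell t) = sin (2 * pi * (t - s)) :> R.
Proof. by rewrite /cross /ell /= mulrBr sinB; ring. Qed.

Lemma dot_ell s t : dot (ell s) (ell t) = cos (2 * pi * (t - s)) :> R.
Proof. by rewrite /dot /ell /= mulrBr cosB; ring. Qed.

Lemma ellD1 t : ell (t + 1) = ell t :> plane R.
Proof.
rewrite /ell mulrDr mulr1 (_ : 2 * pi = pi *+ 2); last by rewrite mulr_natl.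
by rewrite cosD2pi sinD2pi.
Qed.

Lemma ellDn t (k : nat) : ell (k%:R + t) = ell t :> plane R.
Proof.
elim: k => [|k IH]; first by rewrite add0r.
by rewrite -natr1 -addrA (addrC 1) addrA ellD1.
Qed.

Lemma enorm_ge_fst u : `|u.1| <= enorm u.
Proof.
have := @dot_unit_le (1, 0) u; rewrite /dot /= mulr1 mulr0 addr0; apply.
by rewrite /enorm /dot /= !mulr1 mulr0 addr0 sqrtr1.
Qed.

Lemma enorm_ge_snd u : `|u.2| <= enorm u.
Proof.
have := @dot_unit_le (0, 1) u; rewrite /dot /= mulr1 mulr0 add0r; apply.
by rewrite /enorm /dot /= !mulr1 mulr0 add0r sqrtr1.
Qed.

Lemma enorm_le_sum u : enorm u <= `|u.1| + `|u.2|.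
Proof.
have e1 : enorm ((1, 0) : plane R) = 1.
  by rewrite /enorm /dot /= !mulr1 mulr0 addr0 sqrtr1.
have := enorm_le_dot u e1; rewrite /dot /= !mulr1 !mulr0 addr0 oppr0 mulr0 add0r.
by [].
Qed.

Lemma dot_dist_le e u v : enorm e = 1 -> `|dot u e - dot v e| <= pdist u v.
Proof. by move=> e1; rewrite -dotBl dot_unit_le. Qed.

Lemma norm_le_enorm u : `|u| <= enorm u.
Proof. by rewrite prod_normE ge_max enorm_ge_fst enorm_ge_snd. Qed.

Lemma enorm_le_norm u : enorm u <= 2 * `|u|.
Proof.
apply: (le_trans (enorm_le_sum u)); rewrite mulr_natl mulr2n prod_normE.
by rewrite lerD// le_max lexx ?orbT.
Qed.

Lemma norm_le_pdist u v : `|u - v| <= pdist u v.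
Proof. exact: norm_le_enorm. Qed.

Lemma pdist_le_norm u v : pdist u v <= 2 * `|u - v|.
Proof. exact: enorm_le_norm. Qed.

End PlaneGeometry.

(** * Hausdorff measure and weak convergence *)

Section HausdorffMeasure.
Context {R : realType}.
Implicit Types (A B C F : set (plane R)).
Local Open Scope ereal_scope.

Lemma le_pdist_ediam A x y : A x -> A y -> (pdist x y)%:E <= ediam A.
Proof.
move=> Ax Ay; rewrite /ediam le_max; apply/orP; right.
by apply: ereal_sup_ubound; exists x => //; exists y.
Qed.

Lemma ediam_le A (d : R) : (0 <= d)%R ->
  (forall x y, A x -> A y -> (pdist x y <= d)%R) -> ediam A <= d%:E.
Proof.
move=> d0 h; rewrite /ediam ge_max lee_fin d0 /=.
by apply: ge_ereal_sup => _ [x Ax [y Ay <-]]; rewrite lee_fin h.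
Qed.

Lemma le_ediam A B : A `<=` B -> ediam A <= ediam B.
Proof.
move=> AB; rewrite /ediam ge_max le_max lexx /= le_max; apply/orP; right.
apply: ge_ereal_sup => _ [x Ax [y Ay <-]]; apply: ereal_sup_ubound.
by exists x; [exact: AB|exists y => //; exact: AB].
Qed.

Lemma hausdorff1_pre_anti A (e e' : R) : (e <= e')%R ->
  hausdorff1_pre e' A <= hausdorff1_pre e A.
Proof.
move=> ee'; apply: ereal_inf_le_tmp => _ [U [Ue AU] <-].
by exists U => //; split => // i; rewrite (le_trans (Ue i))// lee_fin.
Qed.

Lemma hausdorff1_pre_le A (e : R) : (0 < e)%R ->
  hausdorff1_pre e A <= hausdorff1 A.
Proof. by move=> e0; apply: ereal_sup_ubound; exists e. Qed.

(** A set of diameter at most [e < d] cannot meet both [A] and [B], so a cover of the union splits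
    into covers of each without any set being counted twice. *)
Lemma hausdorff1_pre_separated A B (d e : R) : (e < d)%R ->
  (forall x y, A x -> B y -> (d <= pdist x y)%R) ->
  hausdorff1_pre e A + hausdorff1_pre e B <= hausdorff1_pre e (A `|` B).
Proof.
move=> ed sep; apply: le_ereal_inf_tmp => _ [U [Ue ABU] <-].
pose V C i := if pselect (U i `&` C !=set0) then U i else set0.
have coverV C : C `<=` A `|` B -> hausdorff1_pre e C <= \sum_(i <oo) ediam (V C i).
  move=> CAB; apply: ereal_inf_lbound; exists (V C) => //; split.
    by move=> i; apply: le_trans (Ue i); apply: le_ediam; rewrite /V; case: pselect => _ // z [].
  move=> x Cx; have [i _ Uix] := ABU x (CAB _ Cx); exists i => //.
  by rewrite /V; case: pselect => // -[]; exists x.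
apply: le_trans (leeD (coverV A _) (coverV B _)) _ => //.
rewrite -nneseriesD => [|i _ _|i _ _]; try exact: ediam_ge0.
apply: lee_nneseries => [i _ _|i _]; first by rewrite adde_ge0 ?ediam_ge0.
rewrite /V; case: (pselect (U i `&` A !=set0)) => [[x [Ux Ax]]|?];
  case: (pselect (U i `&` B !=set0)) => [[y [Uy By]]|?];
  rewrite ?ediam0 ?adde0 ?add0e ?ediam_ge0//.
have := le_trans (le_pdist_ediam Ux Uy) (Ue i); rewrite lee_fin => xye.
by have := lt_le_trans ed (sep _ _ Ax By); rewrite ltNge xye.
Qed.

Lemma hausdorff1_separated A B (d : R) : (0 < d)%R ->
  (forall x y, A x -> B y -> (d <= pdist x y)%R) ->
  hausdorff1 A + hausdorff1 B <= hausdorff1 (A `|` B).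
Proof.
move=> d0 sep.
(* Independent mesh sizes allow the two suprema to be taken one after the other; both are compared
   with the mesh [min (e1, e2, d / 2)], which is below the gap. *)
have pre2 (e1 e2 : R) : (0 < e1)%R -> (0 < e2)%R ->
    hausdorff1_pre e1 A + hausdorff1_pre e2 B <= hausdorff1 (A `|` B).
  move=> e10 e20; pose e := (Num.min (Num.min e1 e2) (d / 2))%R.
  have e0 : (0 < e)%R by rewrite !lt_min e10 e20 divr_gt0.
  apply: le_trans (hausdorff1_pre_le _ e0).
  apply: le_trans (hausdorff1_pre_separated _ sep); last first.
    by rewrite gt_min ltr_pdivrMr// ltr_pMr// ltr1n orbT.
  by apply: leeD; apply: hausdorff1_pre_anti; rewrite !ge_min lexx ?orbT.
have [->|ABoo] := eqVneq (hausdorff1 (A `|` B)) +oo; first exact: leey.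
have finAB : hausdorff1 (A `|` B) \is a fin_num.
  by rewrite ge0_fin_numE ?hausdorff1_ge0// ltey.
have finB (e2 : R) : (0 < e2)%R -> hausdorff1_pre e2 B \is a fin_num.
  move=> e20; rewrite ge0_fin_numE ?hausdorff1_pre_ge0//.
  rewrite (le_lt_trans (hausdorff1_pre_le _ e20))//.
  rewrite (le_lt_trans (le_hausdorff1 (@subsetUr _ A B)))// ltey//.
have finA : hausdorff1 A \is a fin_num.
  rewrite ge0_fin_numE ?hausdorff1_ge0//.
  rewrite (le_lt_trans (le_hausdorff1 (@subsetUl _ A B)))// ltey//.
rewrite -leeBrDl//; apply: ge_ereal_sup => _ [e2 e20 <-].
rewrite leeBrDl// -leeBrDr ?finB//; apply: ge_ereal_sup => _ [e1 e10 <-].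
by rewrite leeBrDr ?finB// pre2.
Qed.

Lemma sum_parity (f : nat -> \bar R) n : \sum_(i < n.*2) f i =
  \sum_(i < n) f i.*2 + \sum_(i < n) f i.*2.+1.
Proof.
elim: n => [|n IH]; first by rewrite !big_ord0 adde0.
by rewrite doubleS !big_ord_recr /= IH -!addeA; congr (_ + _);
  rewrite addeCA.
Qed.

(** [A k] contains the earlier layers of the parity of [k.+1], so superadditivity on [A k] and
    [D k.+1] propagates by induction along one parity. *)
Lemma sum_separated_layers (H : set (plane R) -> \bar R)
    (A D : nat -> set (plane R)) (p : nat) :
  (forall X Y, X `<=` Y -> H X <= H Y) ->
  (forall k, D k `<=` A k.+1) -> (forall k, A k `<=` A k.+1) ->
  (forall k, H (A k) + H (D k.+1) <= H (A k `|` D k.+1)) ->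
  forall n, \sum_(i < n.+1) H (D (i.*2 + p)%N) <= H (A (n.*2 + p).+1).
Proof.
move=> Hm DA AA HD; elim => [|n IH].
  by rewrite big_ord_recr big_ord0 /= add0e; apply: Hm; rewrite add0n; exact: DA.
rewrite big_ord_recr /=; apply: le_trans (leeD2r _ IH) _.
rewrite doubleS !addSn; apply: le_trans (HD _) _; apply: Hm.
by rewrite subUset; split; [apply: (subset_trans (AA _)); exact: AA|exact: DA].
Qed.

Lemma closed_far F x : closed F -> ~ F x ->
  exists n : nat, forall y, F y -> (harmonic n <= pdist x y)%R.
Proof.
move=> cF Fx; have : nbhs x (~` F).
  by apply: open_nbhs_nbhs; split => //; exact: closed_openC.
rewrite -nbhs_ballE => -[e /= e0 xeF].
have [n ne] : exists n : nat, (harmonic n < e)%R.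
  exists (Num.trunc e^-1); rewrite /harmonic /= invf_plt ?posrE//.
  by rewrite truncnS_gt.
exists n => y Fy; rewrite leNgt; apply/negP => xyn; apply: (xeF y) => //.
rewrite -ball_normE /=.
by rewrite (le_lt_trans (norm_le_pdist _ _))// (lt_trans xyn).
Qed.

(** Caratheodory's criterion for metric outer measures. [W n] is the part of [A] at distance at
    least [1/(n+1)] from [F], hence separated from the part of [A] inside [F]; what [W n] misses of
    [A] off [F] is a tail of the layers [D k], whose measures form a convergent series. *)
Lemma closed_caratheodory F : closed F -> hausdorff1.-caratheodory F.
Proof.
move=> cF; apply: le_caratheodory_measurable => A.
change (hausdorff1 (A `&` F) + hausdorff1 (A `&` ~` F) <= hausdorff1 A).
have [->|Aoo] := eqVneq (hausdorff1 A) +oo; first exact: leey.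
have Afin : hausdorff1 A \is a fin_num by rewrite ge0_fin_numE ?hausdorff1_ge0// ltey.
pose W n := A `&` [set x : plane R | forall y : plane R, F y -> (harmonic n <= pdist x y)%R].
pose D n := W n.+1 `\` W n.
have WA n : W n `<=` A by move=> x [].
have WS n : W n `<=` W n.+1.
  move=> x [Ax xF]; split => // y Fy; apply: le_trans (xF _ Fy).
  by rewrite /harmonic /= lef_pV2 ?posrE// ler_nat.
have Wmono i j : (i <= j)%N -> W i `<=` W j.
  move=> /subnK <-; elim: (j - i)%N => [|m IH] //.
  by rewrite addSn; apply: subset_trans IH _; exact: WS.
have sepW n C : C `<=` A `\` W n.+1 ->
    hausdorff1 (W n) + hausdorff1 C <= hausdorff1 (W n `|` C).
  move=> CA; apply: (@hausdorff1_separated _ _ (harmonic n - harmonic n.+1)%R).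
    by rewrite subr_gt0 /harmonic /= ltf_pV2 ?posrE// ltr_nat.
  move=> x y [Ax xF] /CA [Ay] /not_andP [//|] /existsNP[z /not_implyP[Fz]].
  move/negP; rewrite -ltNge => yz; have := xF _ Fz.
  have := pdist_triangle y x z; lra.
have DA n : D n `<=` W n.+1 by move=> x [].
have sumD p n : \sum_(i < n.+1) hausdorff1 (D (i.*2 + p)%N) <= hausdorff1 A.
  have sepD k : hausdorff1 (W k) + hausdorff1 (D k.+1) <=
      hausdorff1 (W k `|` D k.+1).
    by apply: sepW => x [[Ax xF] nW]; split.
  apply: le_trans (sum_separated_layers p (@le_hausdorff1 R) DA WS sepD n) _.
  exact: le_hausdorff1.
(* Even and odd layers are each bounded by the measure of [A], so the whole series is at most twice
   that. *)
have sumoo : \sum_(k <oo) hausdorff1 (D k) < +oo.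
  apply: (@le_lt_trans _ _ (hausdorff1 A + hausdorff1 A)); last first.
    by rewrite -ge0_fin_numE ?adde_ge0 ?hausdorff1_ge0// fin_numD Afin.
  apply: lime_le; first by apply: is_cvg_nneseries => *; exact: hausdorff1_ge0.
  near=> n; rewrite big_mkord.
  apply: (@le_trans _ _ (\sum_(i < n.+1.*2) hausdorff1 (D i))).
    rewrite -!(big_mkord xpredT (fun i => hausdorff1 (D i))).
    rewrite [leRHS](@big_cat_nat _ _ _ n)//=; last by rewrite doubleS -addnn; lia.
    by rewrite leeDl// sume_ge0// => *; exact: hausdorff1_ge0.
  rewrite (sum_parity (fun i => hausdorff1 (D i))); apply: leeD.
    by have := sumD 0%N n; under eq_bigr do rewrite addn0.
  by have := sumD 1%N n; under eq_bigr do rewrite addn1.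
(* A point off the closed set [F] enters some [W k]; if [W n] misses it, its first entrance comes
   after [n] and places it in the layer just before. *)
have AFW n : A `&` ~` F `<=` W n `|` \bigcup_(k in ~` `I_n) D k.
  move=> x [Ax /(closed_far cF)[m xm]].
  have Wm : W m x by [].
  have [|nWn] := pselect (W n x); first by left.
  right; have exW : exists k, `[< W k x >] by exists m; exact/asboolP.
  case: (ex_minnP exW) => k /asboolP Wk kmin.
  have nk : (n < k)%N.
    rewrite ltnNge; apply/negP => kn; apply: nWn.
    exact: Wmono kn _ Wk.
  case: k nk Wk kmin => // k nk Wk kmin; exists k => /=; first by apply/negP; rewrite -leqNgt.
  split => // Wk'; have := kmin k; rewrite ltnn => H; apply: notF; apply: H; exact/asboolP.
apply/lee_addgt0Pr => e e0.
have /fine_cvgP[] := @nneseries_tail_cvg _ _ xpredT sumoo (fun k _ => hausdorff1_ge0 _).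
move=> finT /cvgr_lt/(_ _ e0) Te.
have [n [finTn Ten]] := @filter_ex _ _ _ _ (filterI finT Te).
apply: le_trans (leeD2l _ (le_hausdorff1 (AFW n))) _.
apply: le_trans (leeD2l _ (outer_measureU2 _ _ _)) _.
rewrite addeA; apply: leeD.
  rewrite addeC; apply: (@le_trans _ _ (hausdorff1 (W n `|` (A `&` F)))).
    apply: (@hausdorff1_separated _ _ (harmonic n)); first by rewrite harmonic_gt0.
    by move=> x y [_ xF] [_ Fy]; exact: xF.
  by apply: le_hausdorff1; rewrite subUset; split => [|x []]//.
rewrite (le_trans (outer_measure_sigma_subadditive_tail _ _ _))//.
rewrite -(fineK finTn) lee_fin; exact: ltW.
Unshelve. all: by end_near. Qed.

End HausdorffMeasure.

(** * Integration over Caratheodory measurable sets of the plane *)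

Section HausdorffIntegral.
Context {R : realType}.
Implicit Types (A B C F : set (plane R)) (phi psi : plane R -> R).
Local Open Scope ereal_scope.

Definition h1measurable A : Prop := hausdorff1.-caratheodory A.

Lemma h1measurable0 : h1measurable set0.
Proof. exact: caratheodory_measurable_set0. Qed.

Lemma h1measurableC A : h1measurable A -> h1measurable (~` A).
Proof. exact: caratheodory_measurable_setC. Qed.

Lemma h1measurableU A B : h1measurable A -> h1measurable B ->
  h1measurable (A `|` B).
Proof. exact: caratheodory_measurable_setU. Qed.

Lemma h1measurableI A B : h1measurable A -> h1measurable B ->
  h1measurable (A `&` B).
Proof. exact: caratheodory_measurable_setI. Qed.

Lemma h1measurableD A B : h1measurable A -> h1measurable B ->
  h1measurable (A `\` B).
Proof. exact: caratheodory_measurable_setD. Qed.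

Lemma h1measurable_bigcup (A : nat -> set (plane R)) :
  (forall n, h1measurable (A n)) -> h1measurable (\bigcup_n A n).
Proof. exact: caratheodory_measurable_bigcup. Qed.

Lemma h1measurable_closed F : closed F -> h1measurable F.
Proof. exact: closed_caratheodory. Qed.

Lemma h1measurable_open F : open F -> h1measurable F.
Proof.
move=> oF; rewrite -(setCK F); apply: h1measurableC; apply: h1measurable_closed.
exact: open_closedC.
Qed.

Let outer : {outer_measure set (plane R) -> \bar R} := hausdorff1.

(** A bundled copy of the measure underlying [H1_integral]: the two integrals are convertible, and
    general integration lemmas apply to this one. *)
Definition hausdorff1_measure :
    {measure set (caratheodory_type (@hausdorff1 R)) -> \bar R} :=
  (outer : set (caratheodory_type outer) -> \bar R).
Local Notation mu := hausdorff1_measure.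

Lemma H1_integralE A phi : H1_integral A phi = \int[mu]_(x in A) (phi x)%:E.
Proof. by []. Qed.

Lemma continuous_h1measurable_fun phi (D : set (plane R)) : continuous phi ->
  measurable_fun (D : set (caratheodory_type (@hausdorff1 R)))
    (fun x : caratheodory_type hausdorff1 => (phi x)%:E).
Proof.
move=> cphi; apply/measurable_EFinP; apply: (measurable_funS measurableT) => //.
apply: (measurability _ (RGenOpens.measurableE R)).
move=> /= _ [_ [a [b ->]] <-]; rewrite setTI.
apply: h1measurable_open; apply: open_comp => // x _; exact: cphi.
Qed.

Lemma H1_integral_ge0 A phi : (forall x, (0 <= phi x)%R) ->
  0 <= H1_integral A phi.
Proof.
by move=> p0; rewrite H1_integralE; apply: integral_ge0 => x _; rewrite lee_fin.
Qed.

Lemma H1_integralU A B phi : continuous phi -> (forall x, (0 <= phi x)%R) ->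
  h1measurable A -> h1measurable B -> A `&` B = set0 ->
  H1_integral (A `|` B) phi = H1_integral A phi + H1_integral B phi.
Proof.
move=> cphi p0 mA mB AB; rewrite !H1_integralE; apply: (@ge0_integral_setU _ _ _ mu A B mA mB).
- exact: continuous_h1measurable_fun.
- by move=> x _; rewrite lee_fin.
- exact/eqP.
Qed.

Lemma H1_integral_big (I : eqType) (s : seq I) (F : I -> set (plane R)) phi :
  continuous phi -> (forall x, (0 <= phi x)%R) ->
  (forall i, h1measurable (F i)) -> uniq s -> trivIset [set` s] F ->
  H1_integral (\big[setU/set0]_(i <- s) F i) phi =
  \sum_(i <- s) H1_integral (F i) phi.
Proof.
move=> cphi p0 mF us tF; rewrite H1_integralE; apply: (@ge0_integral_bigsetU _ _ _ mu _ F _ _ mF us tF).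
- exact: continuous_h1measurable_fun.
- by move=> x _; rewrite lee_fin.
Qed.

Lemma le_H1_integral A phi psi : continuous phi -> continuous psi ->
  (forall x, (0 <= phi x)%R) -> h1measurable A ->
  (forall x, A x -> (phi x <= psi x)%R) ->
  H1_integral A phi <= H1_integral A psi.
Proof.
move=> cphi cpsi p0 mA h; rewrite !H1_integralE; apply: (@ge0_le_integral _ _ _ mu A mA).
- by move=> x _; rewrite lee_fin.
- exact: continuous_h1measurable_fun.
- exact: continuous_h1measurable_fun.
- by move=> x Ax; rewrite lee_fin h.
Qed.

Lemma H1_integral_cst A (c : R) : h1measurable A ->
  H1_integral A (fun=> c) = c%:E * hausdorff1 A.
Proof. by move=> mA; rewrite H1_integralE; exact: (@integral_cst _ _ _ mu A mA). Qed.

Lemma H1_integral_le_cst A phi (c : R) : continuous phi ->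
  (forall x, (0 <= phi x)%R) -> h1measurable A ->
  (forall x, A x -> (phi x <= c)%R) -> H1_integral A phi <= c%:E * hausdorff1 A.
Proof.
by move=> cphi p0 mA h; rewrite -H1_integral_cst//; apply: le_H1_integral => // x;
  exact: cst_continuous.
Qed.

Lemma H1_integral_ge_cst A phi (c : R) : continuous phi -> (0 <= c)%R ->
  h1measurable A ->
  (forall x, A x -> (c <= phi x)%R) -> c%:E * hausdorff1 A <= H1_integral A phi.
Proof.
by move=> cphi c0 mA h; rewrite -H1_integral_cst//; apply: le_H1_integral => // x;
  exact: cst_continuous.
Qed.

Lemma H1_integral_eq0 A phi : (forall x, A x -> phi x = 0%R) ->
  H1_integral A phi = 0.
Proof. by move=> h; rewrite !H1_integralE integral0_eq// => x /h ->. Qed.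

Lemma H1_integral_restrict A B phi : continuous phi ->
  (forall x, (0 <= phi x)%R) -> h1measurable A -> h1measurable B ->
  (forall x, ~ B x -> phi x = 0%R) ->
  H1_integral A phi = H1_integral (A `&` B) phi.
Proof.
move=> cphi p0 mA mB h; rewrite -[in LHS](setUIDK A B) H1_integralU//.
- by rewrite [X in _ + X]H1_integral_eq0 ?adde0// => x [_ /h].
- exact: h1measurableI.
- exact: h1measurableD.
- by apply/seteqP; split => x // [[_ Bx] [_ /(_ Bx)]].
Qed.

Lemma H1_integralD A phi psi : continuous phi -> continuous psi ->
  (forall x, (0 <= phi x)%R) -> (forall x, (0 <= psi x)%R) -> h1measurable A ->
  H1_integral A (fun x => phi x + psi x)%R = H1_integral A phi + H1_integral A psi.
Proof.
move=> cphi cpsi p0 q0 mA; rewrite !H1_integralE.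
under eq_integral do rewrite EFinD.
apply: (@ge0_integralD _ _ _ mu A mA).
- by move=> x _; rewrite lee_fin.
- exact: continuous_h1measurable_fun.
- by move=> x _; rewrite lee_fin.
- exact: continuous_h1measurable_fun.
Qed.

Lemma H1_integralZl A phi (c : R) : continuous phi ->
  (forall x, (0 <= phi x)%R) -> (0 <= c)%R -> h1measurable A ->
  H1_integral A (fun x => c * phi x)%R = c%:E * H1_integral A phi.
Proof.
move=> cphi p0 c0 mA; rewrite !H1_integralE.
under eq_integral do rewrite EFinM.
apply: (@ge0_integralZl _ _ _ mu A mA).
- exact: continuous_h1measurable_fun.
- by move=> x _; rewrite lee_fin.
- by rewrite lee_fin.
Qed.

(** Chebyshev's inequality makes each level set [phi >= 1/(n+1)] inside [A] null, and these level
    sets exhaust [A]. *)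
Lemma H1_integral_gt0_eq0 A phi : continuous phi -> h1measurable A ->
  (forall x, (0 <= phi x)%R) ->
  (forall x, A x -> (0 < phi x)%R) -> H1_integral A phi = 0 -> hausdorff1 A = 0.
Proof.
move=> cphi mA p0 pA ih.
pose F n : set (plane R) := A `&` phi @^-1` `[harmonic n, +oo[.
have mF n : h1measurable (F n).
  apply: h1measurableI => //; apply: h1measurable_closed.
  apply: closed_comp; first by move=> x _; exact: cphi.
  exact: rray_closed.
have F0 n : hausdorff1 (F n) = 0.
  have : (harmonic n)%:E * hausdorff1 (F n) <= 0.
    rewrite -ih; apply: (@le_trans _ _ (H1_integral (F n) phi)).
      apply: H1_integral_ge_cst => //; first exact/ltW/harmonic_gt0.
      by move=> x [_ /=]; rewrite in_itv /= andbT.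
    rewrite !H1_integralE; apply: (@ge0_subset_integral _ _ _ mu _ _ (mF n) mA).
    - exact: continuous_h1measurable_fun.
    - by move=> x _; rewrite lee_fin.
    - by move=> x [].
  rewrite pmule_rle0 ?lte_fin ?harmonic_gt0// => h.
  by apply/eqP; rewrite eq_le h hausdorff1_ge0.
apply/eqP; rewrite eq_le hausdorff1_ge0 andbT.
apply: (@le_trans _ _ (hausdorff1 (\bigcup_n F n))).
  apply: le_hausdorff1 => x Ax; have px := pA x Ax.
  exists (Num.trunc (phi x)^-1) => //; split => //=.
  rewrite in_itv /= andbT /harmonic /= invf_ple ?posrE//.
  exact/ltW/truncnS_gt.
apply: (le_trans (hausdorff1_sigma_subadditive F)).
by rewrite eseries0// => i _ _; exact: F0.
Qed.

End HausdorffIntegral.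

(** * Length bounds by projection and by Lipschitz parametrisation *)

Section HausdorffBounds.
Context {R : realType}.
Implicit Types (A B C F : set (plane R)).
Local Open Scope ereal_scope.

(** A 1-Lipschitz map does not increase diameters: each covering set is sent into an interval no
    longer than its diameter, and these intervals cover []a, b[], whose Lebesgue measure is
    [b - a]. *)
Lemma hausdorff1_ge_projection A (g : plane R -> R) (a b : R) :
  (forall x y, A x -> A y -> (`|g x - g y| <= pdist x y)%R) ->
  (forall s, (a < s < b)%R -> exists2 x, A x & g x = s) ->
  (b - a)%:E <= hausdorff1 A.
Proof.
move=> g1 gA; have [ba|ab] := leP b a.
  by apply: le_trans (hausdorff1_ge0 _); rewrite lee_fin subr_le0.
apply: le_trans (hausdorff1_pre_le A (@ltr01 R)).
apply: le_ereal_inf_tmp => _ [U [Ue AU] <-].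
pose S i := g @` (U i `&` A).
pose V i := if pselect (U i `&` A !=set0) then `[inf (S i), sup (S i)]%classic
            else set0.
have Sbnd i x : (U i `&` A) x -> forall y, (U i `&` A) y ->
    (`|g x - g y|%:E <= ediam (U i)).
  move=> [Ux Ax] y [Uy Ay]; apply: le_trans (le_pdist_ediam Ux Uy).
  by rewrite lee_fin g1.
have diamfin i : ediam (U i) \is a fin_num.
  by rewrite ge0_fin_numE ?ediam_ge0// (le_lt_trans (Ue i))// ltry.
have Sdiam i x y : (U i `&` A) x -> (U i `&` A) y ->
    (g x <= g y + fine (ediam (U i)))%R.
  move=> Ux Uy; have := Sbnd i _ Ux _ Uy; rewrite -(fineK (diamfin i)) lee_fin.
  by rewrite ler_norml => /andP[_]; lra.
have hsS i : U i `&` A !=set0 -> has_sup (S i).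
  move=> [x Ux]; split; first by exists (g x), x.
  by exists (g x + fine (ediam (U i)))%R => _ [y Uy <-]; exact: Sdiam.
have hiS i : U i `&` A !=set0 -> has_inf (S i).
  move=> [x Ux]; split; first by exists (g x), x.
  exists (g x - fine (ediam (U i)))%R => _ [y Uy <-].
  by have := Sdiam i x y Ux Uy; lra.
have muV i : lebesgue_measure (V i) <= ediam (U i).
  rewrite /V; case: (pselect (U i `&` A !=set0)) => [Ui|nUi]; last first.
    by rewrite measure0 ediam_ge0.
  rewrite lebesgue_measure_itv /= lte_fin; case: ifPn => _; last exact: ediam_ge0.
  rewrite -EFinB -(fineK (diamfin i)) lee_fin lerBlDr.
  apply: ge_sup; first by have [] := hsS i Ui.
  move=> _ [x Ux <-]; rewrite addrC -lerBlDr.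
  apply: lb_le_inf; first by have [] := hsS i Ui.
  by move=> _ [y Uy <-]; rewrite lerBlDr; exact: Sdiam.
have -> : (b - a)%:E = lebesgue_measure (`]a, b[%classic : set R).
  by rewrite lebesgue_measure_itv /= lte_fin ab EFinB.
apply: (@le_trans _ _ (\sum_(i <oo) lebesgue_measure (V i))); last first.
  by apply: lee_nneseries => // i _; exact: muV.
apply: measure_sigma_subadditive => //.
- by move=> i; rewrite /V; case: (pselect (U i `&` A !=set0)) => h; [exact: measurable_itv|exact: measurable0].
- move=> s /=; rewrite in_itv /= => /gA[x Ax <-].
  have [i _ Ui] := AU x Ax; exists i => //.
  have Ui0 : U i `&` A !=set0 by exists x.
  rewrite /V; case: (pselect (U i `&` A !=set0)) => // h; rewrite /= in_itv /=; apply/andP; split.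
    by apply: ge_inf; [have [] := hiS i Ui0|exists x].
  by apply: ub_le_sup; [have [] := hsS i Ui0|exists x].
Qed.

(** The interval is cut into [N] equal parts so fine that their images have diameter at most [e];
    the diameters sum to at most [L (b - a)] whatever the mesh. *)
Lemma hausdorff1_le_image (g : R -> plane R) (S : set R) (a b L : R) :
  (0 <= L)%R -> (a <= b)%R -> S `<=` `[a, b]%classic ->
  (forall s t, S s -> S t -> (pdist (g s) (g t) <= L * `|s - t|)%R) ->
  hausdorff1 (g @` S) <= (L * (b - a))%:E.
Proof.
move=> L0 ab Sab gL; apply: ge_ereal_sup => _ [e /= e0 <-].
have ba0 : (0 <= b - a)%R by rewrite subr_ge0.
have [m LN] : exists m : nat, (L * (b - a) / e < m.+1%:R)%R.
  by exists (Num.trunc (L * (b - a) / e)); exact: truncnS_gt.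
pose N := m.+1.
have N0 : (0 < N%:R :> R)%R by rewrite ltr0n.
pose d : R := ((b - a) / N%:R)%R.
have d0 : (0 <= d)%R by rewrite divr_ge0// ltW.
have Lde : (L * d <= e)%R.
  rewrite /d mulrA ler_pdivrMr// [leRHS]mulrC -ler_pdivrMr//; exact/ltW.
have Nd : (N%:R * d = b - a)%R by rewrite /d mulrC divfK// gt_eqF.
pose U i : set (plane R) := if (i < N)%N then
  g @` (S `&` `[(a + i%:R * d)%R, (a + i.+1%:R * d)%R]%classic) else set0.
have diamU i : ediam (U i) <= if (i < N)%N then (L * d)%:E else 0.
  rewrite /U; case: ifPn => iN; last by rewrite ediam0.
  apply: ediam_le; first exact: mulr_ge0.
  move=> _ _ [s [Ss si] <-] [t [St ti] <-]; apply: (le_trans (gL _ _ Ss St)).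
  apply: ler_wpM2l => //; move: si ti; rewrite /= !in_itv /= -natr1 mulrDl mul1r.
  by move=> /andP[? ?] /andP[? ?]; rewrite ler_norml; lra.
apply: (@le_trans _ _ (\sum_(i <oo) ediam (U i))).
  apply: ereal_inf_lbound; exists U => //; split.
    move=> i; apply: (le_trans (diamU i)); case: ifP => _; rewrite lee_fin//.
    exact: ltW.
  move=> _ [s Ss <-]; have := Sab s Ss; rewrite /= in_itv /= => /andP[as_ sb].
  (* If [a = b] the mesh [d] is zero, and the index of a point cannot be found by division. *)
  have [d0'|dn0] := eqVneq d 0%R.
    have e1 : s = a.
      move: Nd; rewrite d0' mulr0 => /esym/eqP; rewrite subr_eq0 => /eqP eab.
      by apply/eqP; rewrite eq_le as_ andbT -eab.
    exists 0%N => //; rewrite /U /=; exists s => //; split => //=.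
    by rewrite in_itv /= d0' !mulr0 addr0 e1 lexx.
  have dgt0 : (0 < d)%R by rewrite lt_neqAle eq_sym dn0.
  have q0 : (0 <= (s - a) / d)%R by rewrite divr_ge0// subr_ge0.
  have /andP[q1 q2] := truncn_itv q0.
  rewrite ler_pdivlMr// in q1; rewrite ltr_pdivrMr// in q2.
  have [iN|Ni] := ltnP (Num.trunc ((s - a) / d)) N.
    exists (Num.trunc ((s - a) / d)) => //; rewrite /U iN; exists s => //.
    by split => //=; rewrite in_itv /=; lra.
  (* Only the right end point [s = b] gets the index [N]; it belongs to the closed last interval, of
     index [m]. *)
  exists m => //; rewrite /U /N ltnSn; exists s => //.
  split => //=; rewrite in_itv /= -/N.
  have : (N%:R * d <= (Num.trunc ((s - a) / d))%:R * d)%R.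
    by rewrite ler_wpM2r// ler_nat.
  have mN : (m%:R * d = N%:R * d - d)%R by rewrite /N -natr1; ring.
  by rewrite mN; lra.
apply: (@le_trans _ _ (\sum_(i <oo) if (i < N)%N then (L * d)%:E else 0)).
  by apply: lee_nneseries => [i _ _|i _]; [exact: ediam_ge0|exact: diamU].
rewrite (nneseries_split 0%N N); last first.
  by move=> k _; case: ifP => //; rewrite lee_fin mulr_ge0.
rewrite add0n (eq_big_nat _ _ (F2 := fun=> (L * d)%:E)); last first.
  by move=> i /andP[_ ->].
rewrite eseries0 ?adde0; last by move=> i Ni _; rewrite ltnNge Ni.
rewrite big_mkord sumEFin lee_fin sumr_const card_ord -mulr_natl mulrCA Nd.
by [].
Qed.

(** On [C] the function [g] is injective with an [L]-Lipschitz inverse, so [C] is a Lipschitz image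
    of a subset of [[a, b]]. *)
Lemma hausdorff1_le_graph C (g : plane R -> R) (a b L : R) :
  (0 <= L)%R -> (a <= b)%R -> (forall x, C x -> (a <= g x <= b)%R) ->
  (forall x y, C x -> C y -> (pdist x y <= L * `|g x - g y|)%R) ->
  hausdorff1 C <= (L * (b - a))%:E.
Proof.
move=> L0 ab gC CL.
pose h (s : R) : plane R := xget 0%R [set x | C x /\ g x = s].
have hK x : C x -> h (g x) = x.
  move=> Cx; rewrite /h; case: xgetP => [y _ [Cy gxy]|/(_ x)[]//].
  apply/eqP; rewrite -subr_eq0; apply/eqP/enorm_eq0/eqP.
  rewrite eq_le enorm_ge0 andbT -/(pdist y x).
  by apply: (le_trans (CL _ _ Cy Cx)); rewrite gxy subrr normr0 mulr0.
have -> : C = h @` (g @` C).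
  apply/seteqP; split => [x Cx|_ [_ [x Cx <-] <-]]; last by rewrite hK.
  by exists (g x); [exists x|exact: hK].
apply: hausdorff1_le_image => //; first by move=> _ [x Cx <-] /=; rewrite in_itv /= gC.
by move=> _ _ [x Cx <-] [y Cy <-]; rewrite !hK//; exact: CL.
Qed.

End HausdorffBounds.

(** * Disks, test functions and cutoffs *)

Section PlaneTopology.
Context {R : realType}.
Implicit Types (A B F : set (plane R)) (phi : plane R -> R).

Lemma lipschitz_continuous (f : plane R -> R) (L : R) :
  (forall x y, `|f x - f y| <= L * pdist x y) -> continuous f.
Proof.
move=> fL x; apply/cvgrPdist_lt => e e0.
have L0 : 0 < 2 * `|L| + 1 by rewrite ltr_wpDl// mulr_ge0.
near=> y.
have : `|x - y| < e / (2 * `|L| + 1).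
  near: y; apply: (@cvgr_dist_lt _ _ _ (nbhs x) _ id x) => //.
  exact: divr_gt0.
rewrite ltr_pdivlMr//; have := fL x y; have := pdist_le_norm x y.
move: `|x - y| (normr_ge0 (x - y)) => d d0 dd fd; apply: le_lt_trans.
apply: (le_trans fd); apply: (le_trans (ler_wpM2r (pdist_ge0 _ _) (ler_norm L))).
have : `|L| * pdist x y <= `|L| * (2 * d) by rewrite ler_wpM2l.
lra.
Unshelve. all: by end_near. Qed.

Lemma continuous_enorm : continuous (@enorm R).
Proof.
by apply: (@lipschitz_continuous _ 1) => x y; rewrite mul1r enorm_sub_dist.
Qed.

Lemma continuous_pdist z : continuous (fun x : plane R => pdist x z).
Proof.
apply: (@lipschitz_continuous _ 1) => x y; rewrite mul1r ler_norml.
by have := pdist_triangle y x z; have := pdist_triangle x y z;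
  rewrite (pdistC y x) => h1 h2; apply/andP; split; lra.
Qed.

Definition cdisk (M : R) : set (plane R) := [set x | enorm x <= M].

Lemma closed_cdisk M : closed (cdisk M).
Proof.
rewrite (_ : cdisk M = @enorm R @^-1` `]-oo, M]); last first.
  by apply/seteqP; split => x /=; rewrite in_itv.
by apply: closed_comp; [move=> x _; exact: continuous_enorm|exact: lray_closed].
Qed.

Lemma closed_bounded_compact A (M : R) : closed A -> A `<=` cdisk M -> compact A.
Proof.
move=> cA AM; apply: (subclosed_compact cA (B := `[- M, M] `*` `[- M, M])).
  by apply: compact_setX; exact: segment_compact.
move=> x Ax; have xM : enorm x <= M := AM x Ax; have := enorm_ge_fst x; have := enorm_ge_snd x.
rewrite !ler_norml => /andP[h1 h2] /andP[h3 h4].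
by split; rewrite /= in_itv /=; apply/andP; split; lra.
Qed.

Lemma compact_cdisk M : compact (cdisk M).
Proof. by apply: (@closed_bounded_compact _ M) => //; exact: closed_cdisk. Qed.

Lemma compact_sub_cdisk A : compact A -> exists2 M, 0 < M & A `<=` cdisk M.
Proof.
move=> /compact_bounded[M [Mr AM]].
exists (2 * (`|M| + 1)); first by rewrite mulr_gt0// ltr_wpDl.
move=> x Ax; apply: (le_trans (enorm_le_norm x)); rewrite ler_pM2l//.
by apply: AM => //; rewrite (le_lt_trans (ler_norm M))// ltrDl.
Qed.

Definition test_function (phi : plane R -> R) : Prop :=
  [/\ continuous phi, (forall x, 0 <= phi x) &
      compact (closure [set x | phi x != 0])].

Lemma test_functionP phi (M : R) : continuous phi -> (forall x, 0 <= phi x) ->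
  (forall x, ~ cdisk M x -> phi x = 0) -> test_function phi.
Proof.
move=> cphi p0 pM; split => //; apply: (@closed_bounded_compact _ M).
  exact: closed_closure.
rewrite [cdisk M](closure_id _).1; last exact: closed_cdisk.
apply: closureS.
by move=> x /= px; apply: contrapT => /pM; move/eqP: px.
Qed.

Lemma test_function_support phi : test_function phi ->
  exists2 M, 0 < M & forall x, M < enorm x -> phi x = 0.
Proof.
move=> [_ _ /compact_sub_cdisk[M M0 sM]]; exists M => // x Mx.
apply/eqP; apply: contraPT Mx => px; apply/negP; rewrite -leNgt.
by apply: sM; apply: subset_closure.
Qed.

Lemma test_function_bounded phi : test_function phi ->
  exists2 K, 0 < K & forall x, phi x <= K.
Proof.
move=> tphi; have [M M0 pM] := test_function_support tphi.
case: tphi => cphi p0 _.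
have : compact (phi @` cdisk M).
  apply: continuous_compact; last exact: compact_cdisk.
  exact: continuous_subspaceT.
move=> /compact_bounded[K [_ KP]].
exists (`|K| + 1) => [|x]; first by rewrite ltr_wpDl.
have [xM|/pM ->] := leP (enorm x) M; last by rewrite addr_ge0.
rewrite -(ger0_norm (p0 x)); apply: KP; last by exists x.
by rewrite (le_lt_trans (ler_norm K))// ltrDl.
Qed.

(** Uniform continuity on the compact disk of radius [M + 1]; for a point outside it, everything
    within distance 1 is off the support, so both values vanish. *)
Lemma test_function_unif_continuous phi : test_function phi ->
  forall e, 0 < e -> exists2 d, 0 < d &
    forall x y, pdist x y < d -> `|phi x - phi y| < e.
Proof.
move=> tphi e e0; have [M M0 pM] := test_function_support tphi.
case: tphi => cphi p0 _.
have /compact_near_coveringP := @compact_cdisk (M + 1).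
(* The index [n] of the near-covering property stands for the modulus [1/(n+1)], made uniform over
   the disk. *)
move=> /(_ _ \oo (fun (n : nat) (x : plane R) => forall y, pdist x y < harmonic n ->
   `|phi x - phi y| < e) _) [].
  move=> x _; have e2 : 0 < e / 2 by rewrite divr_gt0.
  have /cvgrPdist_lt/(_ _ e2) := cphi x.
  rewrite -nbhs_ballE => -[r /= r0 xr].
  have r2 : 0 < r / 2 by rewrite divr_gt0.
  exists (ball x (r / 2), [set n | harmonic n < r / 2]).
    split; first exact: nbhsx_ballx.
    by have /cvgrPdist_lt/(_ _ r2) := @cvg_harmonic R; apply: filterS => n /=;
       rewrite sub0r normrN ger0_norm// ltW// harmonic_gt0.
  move=> [x' n] [/= xx' nr] y xy.
  have h1 : `|phi x - phi x'| < e / 2.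
    by apply: xr => /=; apply: le_ball xx'; lra.
  have h2 : `|phi x - phi y| < e / 2.
    apply: xr => /=; rewrite [r]splitr; apply: ball_triangle xx' _.
    by rewrite -ball_normE /=; rewrite (le_lt_trans (norm_le_pdist _ _))// (lt_trans xy).
  by rewrite (splitr e) (le_lt_trans (ler_distD (phi x) _ _))// ltrD// distrC.
move=> n _ nP; exists (harmonic n); first exact: harmonic_gt0.
move=> x y xy; have [xM|xM] := leP (enorm x) (M + 1).
  by apply: (nP n) => //=.
have n1 : harmonic n <= 1 :> R by rewrite /harmonic /= invf_le1// ler1n.
have yM : M < enorm y.
  by have := enorm_sub_dist x y; rewrite ler_norml => /andP[_]; lra.
by rewrite !pM ?subrr ?normr0// (lt_trans _ xM)// ltrDl.
Qed.

(** A cutoff: it turns lengths inside a disk into integrals of a test function, which pass through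
    weak limits. *)
Definition tent (M : R) (x : plane R) : R := Num.max 0 (M + 1 - enorm x).

Lemma tent_ge0 M x : 0 <= tent M x.
Proof. by rewrite le_max lexx. Qed.

Lemma continuous_tent M : continuous (tent M).
Proof.
apply: (@lipschitz_continuous _ 1) => x y; rewrite mul1r.
have := enorm_sub_dist x y; rewrite !ler_norml /tent => /andP[h1 h2].
have h0 := pdist_ge0 x y.
by case: (leP 0 (M + 1 - enorm x)) => h3;
  case: (leP 0 (M + 1 - enorm y)) => h4; apply/andP; split; lra.
Qed.

Lemma tent_eq0 M x : M + 1 <= enorm x -> tent M x = 0.
Proof. by move=> h; apply/max_idPl; rewrite subr_le0. Qed.

Lemma tent_ge1 M x : enorm x <= M -> 1 <= tent M x.
Proof. by move=> h; rewrite le_max; apply/orP; right; lra. Qed.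

Lemma test_function_tent M : test_function (tent M).
Proof.
apply: (@test_functionP _ (M + 1)); [exact: continuous_tent|exact: tent_ge0|].
by move=> x /= /negP; rewrite -ltNge => /ltW; exact: tent_eq0.
Qed.

End PlaneTopology.

Section Translation.
Context {R : realType}.
Implicit Types (A B C F : set (plane R)) (phi psi : plane R -> R) (z : plane R).

Lemma translateE z A x : translate z A x <-> A (x - z).
Proof.
split => [[y Ay <-]|Axz]; first by rewrite addrC addKr.
by exists (x - z) => //; rewrite addrC subrK.
Qed.

Lemma translateD z w A : translate z (translate w A) = translate (z + w) A.
Proof.
by apply/seteqP; split => x; rewrite !translateE opprD addrA.
Qed.

Lemma translate0 A : translate 0 A = A.
Proof. by apply/seteqP; split => x; rewrite translateE subr0. Qed.

Lemma pdistD2l z u v : pdist (z + u) (z + v) = pdist u v.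
Proof. by rewrite /pdist opprD addrACA subrr add0r. Qed.

Local Open Scope ereal_scope.

Lemma le_hausdorff1_translate z A : hausdorff1 (translate z A) <= hausdorff1 A.
Proof.
apply: ge_ereal_sup => _ [e /= e0 <-]; apply: le_trans (hausdorff1_pre_le A e0).
apply: le_ereal_inf_tmp => _ [U [Ue AU] <-].
have dU i : ediam (translate z (U i)) <= ediam (U i).
  rewrite {1}/ediam ge_max ediam_ge0 /=; apply: ge_ereal_sup.
  move=> _ [_ [x Ux <-] [_ [y Uy <-] <-]].
  rewrite -[enorm _]/(pdist (z + x)%R (z + y)%R) pdistD2l; exact: le_pdist_ediam.
apply: (@le_trans _ _ (\sum_(i <oo) ediam (translate z (U i)))).
  apply: ereal_inf_lbound; exists (fun i => translate z (U i)) => //; split.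
    by move=> i; apply: le_trans (dU i) (Ue i).
  by move=> _ [x /AU[i _ Uix] <-]; exists i => //; exists x.
by apply: lee_nneseries => [i _ _|i _]; [exact: ediam_ge0|exact: dU].
Qed.

Lemma hausdorff1_translate z A : hausdorff1 (translate z A) = hausdorff1 A.
Proof.
apply/eqP; rewrite eq_le le_hausdorff1_translate /=.
rewrite -[in leLHS](translate0 A) -(addNr z) -translateD.
exact: le_hausdorff1_translate.
Qed.

Lemma translate_setI z A B : translate z (A `&` B) = translate z A `&` translate z B.
Proof. by apply/seteqP; split => x; rewrite /setI /= !translateE. Qed.

Lemma h1measurable_translate z A : h1measurable A -> h1measurable (translate z A).
Proof.
move=> mA X.
have := mA (translate (- z)%R X).
change (hausdorff1 (translate (- z)%R X) = hausdorff1 (translate (- z)%R X `&` A) +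
  hausdorff1 (translate (- z)%R X `&` ~` A) ->
  hausdorff1 X = hausdorff1 (X `&` translate z A) + hausdorff1 (X `&` ~` translate z A)).
have e : forall B, hausdorff1 (translate (- z)%R X `&` B) = hausdorff1 (X `&` translate z B).
  move=> B; rewrite -(hausdorff1_translate z) translate_setI translateD subrr.
  by rewrite translate0.
rewrite hausdorff1_translate !e => ->; congr (_ + hausdorff1 (_ `&` _)).
by apply/seteqP; split => x; rewrite /setC /= !translateE.
Qed.

(** Translations preserve the measure, which is therefore its own push-forward. *)
Lemma H1_integral_translate z A phi : continuous phi -> (forall x, (0 <= phi x)%R) ->
  h1measurable A ->
  H1_integral (translate z A) phi = H1_integral A (fun x => phi (z + x)%R).
Proof.
move=> cphi p0 mA.
pose T := caratheodory_type (@hausdorff1 R).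
pose t : T -> T := fun x => (z + x)%R.
have tz B : t @^-1` B = translate (- z)%R B.
  by apply/seteqP; split => x; rewrite /t /= translateE opprK addrC.
have mt : measurable_fun [set: T] t.
  move=> _ B mB; rewrite setTI tz; exact: (@h1measurable_translate (- z)%R B mB).
have tA : t @^-1` (translate z A) = A by rewrite tz translateD addNr translate0.
have mzA := h1measurable_translate z mA.
rewrite !H1_integralE.
rewrite (@eq_measure_integral _ _ _ _ (pushforward (@hausdorff1_measure R) t)); last first.
  move=> B mB _; change (hausdorff1 B = hausdorff1 (t @^-1` B)).
  by rewrite tz hausdorff1_translate.
rewrite (@ge0_integral_pushforward _ _ _ _ _ _ mt hausdorff1_measure _ _ mzA).
- by rewrite tA.
- exact: continuous_h1measurable_fun.
- by move=> x _; rewrite lee_fin.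
Qed.

End Translation.

(** * Weak convergence along a filter and uniqueness of limits up to null sets *)

Section WeakConvergence.
Context {R : realType} {T : Type}.
Implicit Types (A B C : set (plane R)) (phi psi : plane R -> R) (z : plane R).
Implicit Types (An : T -> set (plane R)).

Definition weak_cvg (F : set_system T) An A : Prop :=
  forall phi, test_function phi ->
    H1_integral (An n) phi @[n --> F] --> H1_integral A phi.

Definition locally_finite A : Prop :=
  forall M, (hausdorff1 (A `&` cdisk M) < +oo)%E.

Lemma cvg_EFinP (F : set_system T) (FF : Filter F) (u : T -> \bar R) (l : R) :
  (u n @[n --> F] --> l%:E) <->
  (forall e : R, 0 < e ->
    \forall n \near F, ((l - e)%:E <= u n <= (l + e)%:E)%E).
Proof.
split=> [/fine_cvgP[finu ul] e e0|h].
  move/cvgrPdist_le: ul => /(_ _ e0).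
  apply: filterS2 finu => n un /=; rewrite -(fineK un) !lee_fin.
  by rewrite ler_distlC => /andP[h1 h2]; apply/andP; split; lra.
apply/fine_cvgP; split.
  have := h 1 ltr01; apply: filterS => n /andP[h1 h2].
  rewrite fin_numE -ltNye -ltey (le_lt_trans h2 (ltry _)) andbT.
  by rewrite (lt_le_trans _ h1) ?ltNyr.
apply/cvgrPdist_le => e e0; have := h e e0; apply: filterS => n /= /andP[h1 h2].
have un : u n \is a fin_num.
  rewrite fin_numE -ltNye -ltey (le_lt_trans h2 (ltry _)) andbT.
  by rewrite (lt_le_trans _ h1) ?ltNyr.
by move: h1 h2; rewrite -(fineK un) !lee_fin ler_distlC => h1 h2; apply/andP; split; lra.
Qed.

Lemma H1_integral_subset A B phi : continuous phi -> (forall x, 0 <= phi x) ->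
  h1measurable A -> h1measurable B -> A `<=` B ->
  (H1_integral A phi <= H1_integral B phi)%E.
Proof.
move=> cphi p0 mA mB AB; rewrite -(setDUK AB) H1_integralU//.
- by rewrite leeDl// H1_integral_ge0.
- exact: h1measurableD.
- by rewrite setDIK.
Qed.

Lemma H1_integral_lty A phi : test_function phi -> h1measurable A ->
  locally_finite A -> (H1_integral A phi < +oo)%E.
Proof.
move=> tphi mA fA; have [M M0 pM] := test_function_support tphi.
have [K K0 pK] := test_function_bounded tphi; case: tphi => cphi p0 _.
have mD := h1measurable_closed (@closed_cdisk _ M).
rewrite (H1_integral_restrict cphi p0 mA mD); last first.
  by move=> x /negP; rewrite -ltNge; exact: pM.
apply: le_lt_trans (H1_integral_le_cst (c := K) cphi p0 (h1measurableI mA mD) _) _.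
  by move=> x _; exact: pK.
have fd : hausdorff1 (A `&` cdisk M) \is a fin_num.
  by rewrite ge0_fin_numE ?hausdorff1_ge0.
by rewrite -(fineK fd) -EFinM ltry.
Qed.

(* A continuous stand-in for the distance to a closed set, which is [+oo] on
   the whole plane when the set is empty. *)
Lemma closed_separating_function C : closed C -> exists g : plane R -> R,
  [/\ continuous g, forall x, 0 <= g x, forall x, C x -> g x = 0 &
      forall x, ~ C x -> 0 < g x].
Proof.
move=> cC; have [[c Cc]|C0] := pselect (C !=set0); last first.
  exists (fun=> 1); split => [x|x|x Cx|x _] //; first exact: cst_continuous.
  by exfalso; apply: C0; exists x.
pose D x := [set pdist x y | y in C].
have Dlb x : lbound (D x) 0 by move=> _ [y Cy <-]; exact: pdist_ge0.
have Dn0 x : D x !=set0 by exists (pdist x c), c.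
have Dinf x : has_inf (D x) by split => //; exists 0.
have gx x y : inf (D x) - inf (D y) <= pdist x y.
  rewrite lerBlDr -lerBlDl; apply: lb_le_inf => // _ [w Cw <-].
  rewrite lerBlDl; apply: (@le_trans _ _ (pdist x w)).
    by apply: ge_inf; [exact: (Dinf x).2|exists w].
  exact: pdist_triangle.
exists (fun x => inf (D x)); split.
- apply: (@lipschitz_continuous _ _ 1) => x y; rewrite mul1r ler_norml gx andbT.
  by have := gx y x; rewrite pdistC; lra.
- by move=> x; apply: lb_le_inf.
- move=> x Cx; apply/eqP; rewrite eq_le lb_le_inf// andbT.
  by apply: ge_inf; [exact: (Dinf x).2|exists x => //; exact: pdistxx].
- move=> x /(closed_far cC)[n xn]; apply: (@lt_le_trans _ _ (harmonic n)).
    exact: harmonic_gt0.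
  by apply: lb_le_inf => // _ [y Cy <-]; exact: xn.
Qed.

Lemma hausdorff1_exhaust A : (forall n : nat, hausdorff1 (A `&` cdisk n%:R) = 0%E) ->
  hausdorff1 A = 0%E.
Proof.
move=> h; apply/eqP; rewrite eq_le hausdorff1_ge0 andbT.
apply: (@le_trans _ _ (hausdorff1 (\bigcup_n (A `&` cdisk n%:R)))).
  apply: le_hausdorff1 => x Ax; exists (Num.trunc (enorm x)).+1 => //; split => //.
  exact/ltW/truncnS_gt.
apply: le_trans (hausdorff1_sigma_subadditive _) _.
by rewrite eseries0.
Qed.

(** Testing with a function that vanishes exactly on the closed set [B] shows that [A] has no length
    off [B]. The integrals of a cutoff over [B] and over its intersection with [A] then agree, and
    local finiteness of [B] permits subtraction. The hypotheses are uneven because [A] is to be an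
    arbitrary weak limit, known only as a trajectory set. *)
Lemma weak_cvg_unique (F : set_system T) (FF : ProperFilter F) An A B :
  h1measurable A -> closed B -> locally_finite B ->
  weak_cvg F An A -> weak_cvg F An B -> H1_equal A B.
Proof.
move=> mA cB fB cvA cvB; have mB := h1measurable_closed cB.
have AB phi : test_function phi -> H1_integral A phi = H1_integral B phi.
  by move=> tphi; exact: cvg_unique (cvA _ tphi) (cvB _ tphi).
have AdB : hausdorff1 (A `\` B) = 0%E.
  have [g [cg g0 gB gnB]] := closed_separating_function cB.
  apply: hausdorff1_exhaust => n.
  pose phi x := g x * tent n%:R x.
  have p0 x : 0 <= phi x by rewrite mulr_ge0// tent_ge0.
  have cphi : continuous phi.
    by move=> x; apply: cvgM; [exact: cg|exact: continuous_tent].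
  have tphi : test_function phi.
    apply: (@test_functionP _ _ (n%:R + 1)) => // x /negP; rewrite -ltNge => /ltW h.
    by rewrite /phi tent_eq0// mulr0.
  have mS : h1measurable ((A `\` B) `&` cdisk n%:R).
    by apply: h1measurableI; [exact: h1measurableD|exact/h1measurable_closed/closed_cdisk].
  apply: (H1_integral_gt0_eq0 cphi mS p0).
    move=> x [[_ Bx] xn]; rewrite mulr_gt0//; first exact: gnB.
    by rewrite (lt_le_trans ltr01)// tent_ge1.
  apply/eqP; rewrite eq_le H1_integral_ge0// andbT.
  apply: (@le_trans _ _ (H1_integral A phi)).
    by apply: H1_integral_subset => // x [[]].
  by rewrite AB// H1_integral_eq0// => x Bx; rewrite /phi gB// mul0r.
have BdA : hausdorff1 (B `\` A) = 0%E.
  apply: hausdorff1_exhaust => n.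
  have tphi := test_function_tent n%:R : test_function (tent n%:R : plane R -> R).
  have [cphi p0 _] := tphi; set phi := tent _ in tphi cphi p0.
  have mS : h1measurable ((B `\` A) `&` cdisk n%:R).
    by apply: h1measurableI; [exact: h1measurableD|exact/h1measurable_closed/closed_cdisk].
  apply: (H1_integral_gt0_eq0 cphi mS p0).
    by move=> x [_ xn]; rewrite (lt_le_trans ltr01)// tent_ge1.
  apply/eqP; rewrite eq_le H1_integral_ge0// andbT.
  apply: (@le_trans _ _ (H1_integral (B `\` A) phi)).
    by apply: H1_integral_subset => //; exact: h1measurableD.
  have AdB0 : H1_integral (A `\` B) phi = 0%E.
    have [K K0 pK] := test_function_bounded tphi.
    apply/eqP; rewrite eq_le H1_integral_ge0// andbT.
    have := H1_integral_le_cst (c := K) cphi p0 (h1measurableD mA mB) (fun x _ => pK x).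
    by rewrite AdB mule0.
  have eA : H1_integral A phi = H1_integral (A `&` B) phi.
    rewrite -[in LHS](setUIDK A B) H1_integralU//.
    - by rewrite AdB0 adde0.
    - exact: h1measurableI.
    - exact: h1measurableD.
    - by apply/seteqP; split => x // [[_ Bx] [_ /(_ Bx)]].
  have eB : H1_integral B phi = (H1_integral (A `&` B) phi + H1_integral (B `\` A) phi)%E.
    rewrite -[in LHS](setUIDK B A) H1_integralU//.
    - by rewrite setIC.
    - exact: h1measurableI.
    - exact: h1measurableD.
    - by apply/seteqP; split => x // [[_ Bx] [_ /(_ Bx)]].
  have finB : H1_integral B phi \is a fin_num.
    by rewrite ge0_fin_numE ?H1_integral_ge0// H1_integral_lty.
  have eAB := AB phi tphi; rewrite eA in eAB; rewrite eAB in eB.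
  suff -> : H1_integral (B `\` A) phi = 0%E by [].
  by rewrite -(addeK (H1_integral (B `\` A) phi) finB) [X in (X - _)%E]addeC -eB subee.
rewrite /H1_equal; apply/eqP; rewrite eq_le hausdorff1_ge0 andbT.
apply: le_trans (outer_measureU2 _ _ _) _.
by rewrite [X in (X + _)%E](AdB : _ = _) [X in (_ + X)%E](BdA : _ = _) adde0.
Qed.

End WeakConvergence.

Section WeakConvergenceTranslation.
Context {R : realType}.
Implicit Types (A B C : set (plane R)) (phi psi : plane R -> R) (z : plane R).

Lemma test_function_translate phi z : test_function phi ->
  test_function (fun x => phi (z + x)).
Proof.
move=> tphi; have [M M0 pM] := test_function_support tphi; case: tphi => cphi p0 _.
apply: (@test_functionP _ _ (M + enorm z)) => [x|x|x /negP]; last 2 first.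
- exact: p0.
- rewrite -ltNge => xM; apply: pM.
  by have := enormB (z + x) z; rewrite addrC addKr; lra.
- by apply: (@cvg_comp _ _ _ (+%R z) phi); [exact: cvgD (cvg_cst _) cvg_id|exact: cphi].
Qed.

(** Replacing [y n] by [z] changes the integrand by at most a small multiple of a cutoff, whose
    integrals over [An n] are eventually bounded because they converge as well. *)
Lemma weak_cvg_translate {T : Type} (F : set_system T) (FF : ProperFilter F)
    (An : T -> set (plane R)) A (y : T -> plane R) z :
  (forall n, h1measurable (An n)) -> h1measurable A -> locally_finite A ->
  pdist (y n) z @[n --> F] --> 0 ->
  weak_cvg F An A -> weak_cvg F (fun n => translate (y n) (An n)) (translate z A).
Proof.
move=> mAn mA fA yz cvA phi tphi.
have [M M0 pM] := test_function_support tphi.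
have unif := test_function_unif_continuous tphi.
have tpsi := test_function_translate z tphi.
have [cphi p0 _] := tphi; have [cpsi q0 _] := tpsi.
have fin f : test_function f -> H1_integral A f \is a fin_num.
  move=> tf; rewrite ge0_fin_numE ?H1_integral_lty// H1_integral_ge0//.
  by case: tf.
rewrite H1_integral_translate// -(fineK (fin _ tpsi)).
(* The extra 1 leaves room for [pdist (y n) z < 1], so that the cutoff dominates both translated
   supports. *)
pose N := M + enorm z + 1.
have [ct t0 _] := test_function_tent N.
have := cvA _ (test_function_tent N); rewrite -(fineK (fin _ (test_function_tent N))).
set L := fine (H1_integral A (tent N)) => /cvg_EFinP cvL.
have := cvA _ tpsi; rewrite -(fineK (fin _ tpsi)); set l := fine _ => /cvg_EFinP cvl.
have L0 : 0 <= L by rewrite fine_ge0// H1_integral_ge0.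
apply/cvg_EFinP => e e0.
have e2 : 0 < e / 2 by rewrite divr_gt0.
have w0 : 0 < e / 2 / (L + 1) by rewrite divr_gt0// ltr_wpDl.
have [d d0 dphi] := unif _ w0.
near=> n.
have yn1 : pdist (y n) z < 1.
  by near: n; move/cvgr_lt: yz; apply.
have ynd : pdist (y n) z < d.
  by near: n; move/cvgr_lt: yz; apply.
have cphin : continuous (fun x => phi (y n + x)).
  by case: (test_function_translate (y n) tphi).
have wt0 x : 0 <= e / 2 / (L + 1) * tent N x.
  by rewrite mulr_ge0// ltW.
have cwt : continuous (fun x : plane R => e / 2 / (L + 1) * tent N x).
  by move=> x; apply: cvgM; [exact: cvg_cst|exact: ct].
have close x : `|phi (y n + x) - phi (z + x)| <= e / 2 / (L + 1) * tent N x.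
  have [xN|Nx] := leP (enorm x) N.
    apply: (@le_trans _ _ (e / 2 / (L + 1))).
      by apply/ltW/dphi; rewrite addrC (addrC z) pdistD2l.
    by rewrite ler_peMr ?tent_ge1// ltW.
  rewrite !pM ?subrr ?normr0//.
    by have := enormB (z + x) z; rewrite addrC addKr /N in Nx *; lra.
  have := enormB (y n + x) (y n); rewrite addrC addKr => h.
  by have := enorm_sub_dist (y n) z; rewrite ler_norml => /andP[_]; rewrite /N in Nx; lra.
have wint : (H1_integral (An n) (fun x => (e / 2 / (L + 1) * tent N x)%R) <= (e / 2)%:E)%E.
  rewrite H1_integralZl//; last exact: ltW.
  apply: (@le_trans _ _ ((e / 2 / (L + 1))%:E * (L + 1)%:E)%E).
    apply: lee_wpmul2l; first by rewrite lee_fin ltW.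
    have /andP[] : ((L - 1)%:E <= H1_integral (An n) (tent N) <= (L + 1)%:E)%E.
      by near: n; exact: cvL.
    by [].
  by rewrite -EFinM divfK// gt_eqF// ltr_wpDl.
have /andP[l1 l2] : ((l - e / 2)%:E <= H1_integral (An n) (fun x => phi (z + x)%R) <=
    (l + e / 2)%:E)%E by near: n; exact: cvl.
rewrite H1_integral_translate//; apply/andP; split.
  rewrite (_ : l - e = l - e / 2 - e / 2) ?EFinB; last by lra.
  rewrite leeBlDr//; apply: (le_trans l1).
  apply: le_trans (leeD2l _ wint); rewrite -H1_integralD//.
  apply: le_H1_integral => //.
    by move=> x; apply: cvgD; [exact: cphin|exact: cwt].
  by move=> x _; have := close x; rewrite ler_norml => /andP[h _]; lra.
rewrite (_ : l + e = l + e / 2 + e / 2) ?EFinD; last by lra.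
apply: le_trans (leeD l2 wint); rewrite -H1_integralD//.
apply: le_H1_integral => //.
  by move=> x; apply: cvgD; [exact: cpsi|exact: cwt].
by move=> x _; have := close x; rewrite ler_norml => /andP[_ h]; lra.
Unshelve. all: by end_near. Qed.

(** A trajectory set is a countable union of compact arcs, the images of the intervals [[-m, m]]. *)
Lemma h1measurable_trajectory A : trajectory_set A -> h1measurable A.
Proof.
move=> [C [cC tC ->]]; have /countable_injP[f finj] := cC.
have -> : \bigcup_(g in C) range g =
    \bigcup_n \bigcup_(g in [set g | C g /\ f g = n]) range g.
  apply/seteqP; split => [x [g Cg gx]|x [n _ [g [Cg _] gx]]]; last by exists g.
  by exists (f g) => //; exists g.
apply: h1measurable_bigcup => n.
have [[g [Cg gn]]|ng] := pselect (exists g, C g /\ f g = n); last first.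
  rewrite (_ : bigcup _ _ = set0); first exact: h1measurable0.
  by apply/seteqP; split => // x [g Cg _]; apply: ng; exists g.
have -> : [set g | C g /\ f g = n] = [set g].
  apply/seteqP; split => [h [Ch hn]|_ -> //].
  by apply: finj; rewrite ?inE// hn gn.
rewrite bigcup_set1 (_ : range g = \bigcup_m (g @` `[- m%:R, m%:R])); last first.
  apply/seteqP; split => [x [t _ <-]|x [m _ [t _ <-]]]; last by exists t.
  exists (Num.trunc `|t|).+1 => //; exists t => //=; rewrite in_itv /= -ler_norml.
  exact/ltW/truncnS_gt.
apply: h1measurable_bigcup => m; apply: h1measurable_closed.
apply: compact_closed; first exact: norm_hausdorff.
apply: continuous_compact; last exact: segment_compact.
by apply: continuous_subspaceT; case: (tC g Cg).
Qed.

End WeakConvergenceTranslation.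

(** * Weak limits of bundles of arcs *)

Section NearRays.
Context {R : realType}.
Implicit Types (A B C : set (plane R)) (phi psi : plane R -> R) (q e x y : plane R).

Lemma continuous_dot e : enorm e = 1 -> continuous (fun x : plane R => dot x e).
Proof.
move=> e1; apply: (@lipschitz_continuous _ _ 1) => x y; rewrite mul1r.
exact: dot_dist_le.
Qed.

(* Up to the slope [eps], [C] runs from [q] in the direction [e] over a length
   of at least [S]; whether [q] belongs to [C] is left open. *)
Record near_ray q e (eps S : R) C : Prop := {
  near_ray_measurable : h1measurable C;
  near_ray_ge0 : forall x, C x -> dot q e <= dot x e;
  near_ray_slope : forall x y, C x -> C y ->
    `|dot x (rot90 e) - dot y (rot90 e)| <= eps * `|dot x e - dot y e|;
  near_ray_base : forall x, C x ->
    `|dot x (rot90 e) - dot q (rot90 e)| <= eps * (dot x e - dot q e);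
  near_ray_length : forall t, 0 < t < S -> exists2 x, C x & dot x e = dot q e + t }.

Lemma pdist_le_dot e x y : enorm e = 1 ->
  pdist x y <= `|dot x e - dot y e| + `|dot x (rot90 e) - dot y (rot90 e)|.
Proof. by move=> e1; rewrite -!dotBl; exact: enorm_le_dot. Qed.

(** The lower bound comes from projecting onto [e], the upper one from [C] being the graph of an
    [eps]-Lipschitz function over that projection. *)
Lemma near_ray_strip q e (eps S : R) C (a b : R) : enorm e = 1 -> 0 <= eps ->
  near_ray q e eps S C -> 0 <= a -> a <= b -> b <= S ->
  let D := C `&` [set x | dot q e + a <= dot x e < dot q e + b] in
  [/\ h1measurable D, ((b - a)%:E <= hausdorff1 D)%E &
      (hausdorff1 D <= ((1 + eps) * (b - a))%:E)%E].
Proof.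
move=> e1 eps0 [mC C0 Cs Cb Cl] a0 ab bS D; split.
- rewrite /D (_ : [set x | _] = ~` ((fun x => dot x e) @^-1` `]-oo, (dot q e + a)[) `&`
      ((fun x => dot x e) @^-1` `]-oo, (dot q e + b)[)).
    apply: h1measurableI => //; apply: h1measurableI.
      apply: h1measurableC; apply: h1measurable_open; apply: open_comp.
        by move=> x _; exact: continuous_dot.
      exact: lray_open.
    apply: h1measurable_open; apply: open_comp.
      by move=> x _; exact: continuous_dot.
    exact: lray_open.
  apply/seteqP; split => x /=; rewrite !in_itv /=.
    by move=> /andP[h1 ->]; split => //; apply/negP; rewrite -leNgt.
  by move=> [/negP]; rewrite -leNgt => -> ->.
- have -> : b - a = dot q e + b - (dot q e + a) by ring.
  apply: (@hausdorff1_ge_projection _ _ (fun x => dot x e)).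
    by move=> x y _ _; exact: dot_dist_le.
  move=> s /andP[s1 s2].
  have [|x Cx xs] := Cl (s - dot q e); first by apply/andP; split; lra.
  have xs' : dot x e = s by rewrite xs addrC subrK.
  by exists x => //; split => //=; rewrite xs' s2 ltW.
- have -> : b - a = dot q e + b - (dot q e + a) by ring.
  apply: (@hausdorff1_le_graph _ _ (fun x => dot x e)); first by rewrite addr_ge0.
  + by rewrite lerD2l.
  + by move=> x [_ /andP[-> /ltW ->]].
  + move=> x y [Cx _] [Cy _]; apply: (le_trans (pdist_le_dot x y e1)).
    by rewrite mulrDl mul1r lerD2l; exact: Cs.
Qed.

(** [J q0 e] is a Riemann sum of [phi] along the exact ray. It is fixed before [C], [q] and [eps],
    so all sets close to one ray have nearly the same integral. *)
Lemma near_ray_integral phi (Q eta : R) : test_function phi -> 0 < Q -> 0 < eta ->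
  exists (eps0 S0 : R) (J : plane R -> plane R -> R), 0 < eps0 /\
    forall q0 e q eps C, enorm q0 <= Q -> enorm e = 1 -> 0 <= eps <= eps0 ->
      pdist q q0 <= eps -> near_ray q e eps S0 C ->
      ((J q0 e - eta)%:E <= H1_integral C phi <= (J q0 e + eta)%:E)%E.
Proof.
move=> tphi Q0 eta0.
have [M M0 pM] := test_function_support tphi.
have [K K0 pK] := test_function_bounded tphi.
(* Since [q] has norm at most [Q + 1], a point of the piece farther than [S] along [e] is outside
   the support of [phi]. *)
pose S := M + Q + 2; have S0 : 0 < S by rewrite /S; lra.
pose w := eta / (4 * S); have w0 : 0 < w by rewrite divr_gt0// mulr_gt0.
have [d d0 dphi] := test_function_unif_continuous tphi w0.
have [cphi p0 _] := tphi.
(* The three bounds keep [eps] below 1, the lateral deviation over the length [S + 1] below [d / 3],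
   and the excess length [eps S] small against the bound [K] of [phi]. *)
pose eps0 := Num.min 1 (Num.min (d / (3 * (S + 1))) (eta / (2 * S * K))).
have eps00 : 0 < eps0.
  by rewrite !lt_min ltr01 !divr_gt0// !mulr_gt0//; lra.
have [m mS] : exists m : nat, S / (d / 3) < m.+1%:R.
  by exists (Num.trunc (S / (d / 3))); exact: truncnS_gt.
pose delta := S / m.+1%:R.
have N0 : 0 < m.+1%:R :> R by rewrite ltr0n.
have delta0 : 0 < delta by rewrite divr_gt0.
have deltad : delta < d / 3.
  by rewrite /delta ltr_pdivrMr// mulrC -ltr_pdivrMr// divr_gt0.
have Ndelta : m.+1%:R * delta = S by rewrite /delta mulrC divfK// gt_eqF.
pose ph q0 e (i : nat) := phi (q0 + (i%:R * delta) *: e).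
exists eps0, S, (fun q0 e => \sum_(i < m.+1) delta * ph q0 e i); split => //.
move=> q0 e q eps C q0Q e1 /andP[eps_ge0 epsle] qq0 rC.
have mC := near_ray_measurable rC.
move: epsle; rewrite !le_min => /and3P[eps1 epsd epsK].
have epsS : eps * (S + 1) <= d / 3.
  move: epsd; rewrite invfM mulrA ler_pdivlMr//; lra.
have epsSK : S * (eps * K) <= eta / 2.
  have h2 : 0 < 2 * S * K by rewrite !mulr_gt0.
  by move: epsK; rewrite ler_pdivlMr// => h; rewrite ler_pdivlMr//; lra.
pose D k := C `&` [set x | dot q e + k%:R * delta <= dot x e < dot q e + k.+1%:R * delta].
pose P k := C `&` [set x | dot q e + 0 <= dot x e < dot q e + k%:R * delta].
have phD k x : (k < m.+1)%N -> D k x -> `|phi x - ph q0 e k| <= w.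
  move=> km [Cx /andP[x1 x2]]; apply/ltW/dphi.
  set y := q0 + _; apply: (le_lt_trans (pdist_le_dot x y e1)).
  have kS : k.+1%:R * delta <= S by rewrite -Ndelta ler_pM2r// ler_nat.
  have k0 : 0 <= k%:R * delta by rewrite mulr_ge0// ltW.
  have ye : dot y e = dot q0 e + k%:R * delta by rewrite /y dotDl dotZl dot_unit// mulr1.
  have yf : dot y (rot90 e) = dot q0 (rot90 e) by rewrite /y dotDl dotZl dot_rot90 mulr0 addr0.
  have e1' : enorm (rot90 e) = 1 by rewrite enorm_rot90.
  have := dot_dist_le q q0 e1; have := dot_dist_le q q0 e1'.
  have := near_ray_base rC Cx; rewrite ye yf.
  have : eps * (dot x e - dot q e) <= eps * S by rewrite ler_wpM2l//; lra.
  have kk : k.+1%:R * delta = k%:R * delta + delta by rewrite -natr1 mulrDl mul1r.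
  rewrite kk in x2.
  rewrite !ler_norml => h0 /andP[h1 h2] /andP[h3 h4] /andP[h5 h6].
  have h7 : `|dot x e - (dot q0 e + k%:R * delta)| <= eps + delta.
    by rewrite ler_norml; apply/andP; split; lra.
  have h8 : `|dot x (rot90 e) - dot q0 (rot90 e)| <= eps * S + eps.
    by rewrite ler_norml; apply/andP; split; lra.
  lra.
have PS k : P k.+1 = P k `|` D k.
  have kk : k%:R * delta <= k.+1%:R * delta by rewrite ler_pM2r// ler_nat.
  have k0 : 0 <= k%:R * delta by rewrite mulr_ge0// ltW.
  apply/seteqP; split => [x [Cx /andP[h1 h2]]|x [] [Cx /andP[h1 h2]]].
  - have [h|h] := ltP (dot x e) (dot q e + k%:R * delta).
      by left; split => //=; apply/andP.
    by right; split => //=; apply/andP.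
  - by split => //=; apply/andP; split => //; lra.
  - by split => //=; apply/andP; split => //; lra.
have mP k : (k <= m.+1)%N -> h1measurable (P k).
  move=> km; have kS : k%:R * delta <= S by rewrite -Ndelta ler_pM2r// ler_nat.
  have k0 : 0 <= k%:R * delta by rewrite mulr_ge0// ltW.
  by have [] := near_ray_strip e1 eps_ge0 rC (lexx 0) k0 kS.
have step k : (k <= m.+1)%N ->
   ((\sum_(i < k) delta * (ph q0 e i - w))%:E <= H1_integral (P k) phi <=
    (\sum_(i < k) (1 + eps) * delta * (ph q0 e i + w))%:E)%E.
  elim: k => [_|k IH km].
    rewrite !big_ord0 (_ : P 0%N = set0) ?H1_integral_eq0 ?lexx//.
    by apply/seteqP; split => // x [_ /andP[h1 h2]]; move: h1 h2; rewrite mul0r; lra.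
  have kS : k.+1%:R * delta <= S by rewrite -Ndelta ler_pM2r// ler_nat.
  have k0 : 0 <= k%:R * delta by rewrite mulr_ge0// ltW.
  have kk : k%:R * delta <= k.+1%:R * delta by rewrite ler_pM2r// ler_nat.
  have [mD D1 D2] := near_ray_strip e1 eps_ge0 rC k0 kk kS.
  have kd : k.+1%:R * delta - k%:R * delta = delta by rewrite -natr1; ring.
  rewrite kd -/(D k) in mD D1 D2.
  rewrite !big_ord_recr /= PS H1_integralU//; last 2 first.
  - exact/mP/ltnW.
  - apply/seteqP; split => // x [[_ /andP[_ h1]] [_ /andP[h2 _]]].
    by move: h1; rewrite ltNge h2.
  have /andP[IH1 IH2] := IH (ltnW km).
  rewrite !EFinD; apply/andP; split.
    (* The value [ph q0 e k - w] may be negative, whereas the lower bound by a constant asks for a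
       nonnegative one. *)
    apply: leeD => //; apply: (@le_trans _ _ ((Num.max 0 (ph q0 e k - w))%:E * hausdorff1 (D k))%E).
      apply: (@le_trans _ _ ((Num.max 0 (ph q0 e k - w))%:E * delta%:E)%E).
        by rewrite -EFinM lee_fin mulrC ler_pM2r// le_max lexx orbT.
      by apply: lee_wpmul2l => //; rewrite lee_fin le_max lexx.
    apply: H1_integral_ge_cst => //; first by rewrite le_max lexx.
    move=> x Dx; rewrite ge_max p0 /=; have := phD k x km Dx.
    by rewrite ler_norml => /andP[h1 h2]; lra.
  apply: leeD => //.
  apply: (@le_trans _ _ ((ph q0 e k + w)%:E * hausdorff1 (D k))%E).
    apply: H1_integral_le_cst => // x Dx; have := phD k x km Dx.
    by rewrite ler_norml => /andP[h1 h2]; lra.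
  rewrite mulrC EFinM; apply: lee_wpmul2l => //.
  by rewrite lee_fin addr_ge0 ?p0// ltW.
have -> : H1_integral C phi = H1_integral (P m.+1) phi.
  rewrite (_ : P _ = C `&` P m.+1); last first.
    by apply/seteqP; split => [x [? ?]|x []].
  have CP : C = P m.+1 `|` (C `\` P m.+1) by rewrite setDUK// => x [].
  rewrite {1}CP H1_integralU//.
  - rewrite [X in (_ + X)%E]H1_integral_eq0 ?adde0.
      by congr H1_integral; apply/seteqP; split => [x [? ?]|x []].
    move=> x [Cx Px]; apply: pM; rewrite ltNge; apply/negP => xM; apply: Px.
    split => //=; rewrite addr0 (near_ray_ge0 rC)//= Ndelta.
    have := dot_dist_le x q e1; rewrite /pdist; have := enormB x q.
    have := enorm_sub_dist q q0; rewrite !ler_norml => /andP[_ h1] h2 /andP[_ h3].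
    by rewrite /S; lra.
  - exact: mP.
  - by apply: h1measurableD => //; exact: mP.
  - by rewrite setDIK.
have /andP[h1 h2] := step m.+1 (leqnn _).
have SN : \sum_(i < m.+1) delta = S.
  by rewrite sumr_const card_ord -mulr_natl.
have Sw : S * w = eta / 4.
  by rewrite /w; field; rewrite gt_eqF.
apply/andP; split.
  apply: le_trans h1; rewrite lee_fin.
  under [leRHS]eq_bigr do rewrite mulrBr.
  rewrite sumrB -mulr_suml SN Sw; lra.
apply: (le_trans h2); rewrite lee_fin.
apply: (@le_trans _ _ (\sum_(i < m.+1) (delta * ph q0 e i + delta * (2 * w + eps * K)))).
  apply: ler_sum => i _.
  have hK : ph q0 e i <= K by exact: pK.
  have hp : 0 <= ph q0 e i by exact: p0.
  rewrite -mulrDr (mulrC (1 + eps)) -mulrA ler_pM2l//.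
  nra.
by rewrite big_split /= -mulr_suml SN mulrDr mulrCA Sw; lra.
Qed.

End NearRays.

Section Fans.
Context {R : realType} {I : choiceType}.
Implicit Types (A B : set (plane R)) (s : seq I) (p e : I -> plane R).

(** The points [p] and directions [e] are ideal data shared by a whole convergent family, while the
    true bases [q] depend on the set. Measurability is asked at every index because integrals over
    finite unions are computed from a total family of measurable sets. *)
Record fan_pieces s p e (M eps S : R) A (C : I -> set (plane R))
    (q : I -> plane R) : Prop := {
  fan_measurable : forall i, h1measurable (C i);
  fan_trivIset : trivIset [set` s] C;
  fan_sub : forall i, i \in s -> C i `<=` A;
  fan_cover : A `&` cdisk M `<=` \bigcup_(i in [set` s]) C i;
  fan_near_ray : forall i, i \in s -> near_ray (q i) (e i) eps S (C i);
  fan_base : forall i, i \in s -> pdist (q i) (p i) <= eps }.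

Definition fan s p e (M eps S : R) A : Prop :=
  h1measurable A /\ exists C q, fan_pieces s p e M eps S A C q.

Lemma fan_integral s p e (M eps S : R) A C q phi : uniq s ->
  h1measurable A -> fan_pieces s p e M eps S A C q -> test_function phi ->
  (forall x, M < enorm x -> phi x = 0) ->
  H1_integral A phi = (\sum_(i <- s) H1_integral (C i) phi)%E.
Proof.
move=> us mA [mC tC CA AC _ _] [cphi p0 _] pM.
rewrite -H1_integral_big// -bigcup_seq.
have mU : h1measurable (\bigcup_(i in [set` s]) C i).
  rewrite bigcup_seq; elim/big_ind : _ => //; first exact: h1measurable0.
  exact: h1measurableU.
have UA : \bigcup_(i in [set` s]) C i `<=` A by move=> x [i /= si]; exact: CA.
rewrite -[in LHS](setDUK UA) H1_integralU//.
- rewrite [X in (_ + X)%E]H1_integral_eq0 ?adde0//.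
  move=> x [Ax nx]; apply: pM; rewrite ltNge; apply/negP => xM.
  by apply: nx; apply: AC.
- exact: h1measurableD.
- by rewrite setDIK.
Qed.

(** The integrals over the approximating sets and over the limit are all within [eta] of the same
    sum of values [J]. For this, the indices, points and directions have to be chosen before [eps]
    and [S]. *)
Lemma weak_cvg_fan {T : Type} (F : set_system T) (FF : Filter F)
    (An : T -> set (plane R)) A :
  (forall M : R, 0 < M -> exists s p e,
    [/\ uniq s, forall i, i \in s -> enorm (e i) = 1 &
     forall eps S : R, 0 < eps -> (\forall n \near F, fan s p e M eps S (An n)) /\
       fan s p e M eps S A]) ->
  weak_cvg F An A.
Proof.
move=> H phi tphi; have [M M0 pM] := test_function_support tphi.
have [s [p [e [us e1 fanA]]]] := H M M0.
pose Q := \sum_(i <- s) enorm (p i) + 1.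
have Q0 : 0 < Q by rewrite ltr_wpDl// sumr_ge0// => i _; exact: enorm_ge0.
have qQ i : i \in s -> enorm (p i) <= Q.
  move=> si; rewrite /Q (big_rem i)//= -addrA lerDl addr_ge0//.
  by apply: sumr_ge0 => j _; exact: enorm_ge0.
have key eta : 0 < eta -> exists J : R, exists2 eps, 0 < eps & exists S,
    forall B, fan s p e M eps S B -> ((J - eta)%:E <= H1_integral B phi <= (J + eta)%:E)%E.
  move=> eta0; have n0 : 0 < (size s).+1%:R :> R by rewrite ltr0n.
  have [eps0 [S0 [J [eps00 HJ]]]] := near_ray_integral tphi Q0 (divr_gt0 eta0 n0).
  exists (\sum_(i <- s) J (p i) (e i)), eps0 => //; exists S0 => B [mB [C [q fB]]].
  rewrite (fan_integral us mB fB tphi pM).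
  have bnd i : i \in s -> ((J (p i) (e i) - eta / (size s).+1%:R)%:E <=
      H1_integral (C i) phi <= (J (p i) (e i) + eta / (size s).+1%:R)%:E)%E.
    move=> si; apply: (HJ _ _ (q i) eps0); [exact: qQ|exact: e1| |exact: (fan_base fB)|
      exact: (fan_near_ray fB)].
    by rewrite (ltW eps00) lexx.
  have se : \sum_(i <- s) (eta / (size s).+1%:R) <= eta.
    rewrite big_const_seq count_predT iter_addr_0 -[leLHS]mulr_natl mulrCA.
    by rewrite ger_pMr// ler_pdivrMr// mul1r ler_nat.
  apply/andP; split.
    apply: (@le_trans _ _ (\sum_(i <- s) (J (p i) (e i) - eta / (size s).+1%:R)%:E)%E).
      by rewrite sumEFin lee_fin sumrB lerD2l lerN2.
    by rewrite big_seq [leRHS]big_seq; apply: lee_sum => i /bnd /andP[].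
  apply: (@le_trans _ _ (\sum_(i <- s) (J (p i) (e i) + eta / (size s).+1%:R)%:E)%E).
    by rewrite big_seq [leRHS]big_seq; apply: lee_sum => i /bnd /andP[].
  by rewrite sumEFin lee_fin big_split lerD2l.
(* Finiteness of the integral over the limit is itself read off from its fan. *)
have finA : H1_integral A phi \is a fin_num.
  have [J [eps eps0 [S HS]]] := key 1 ltr01.
  have /andP[h1 h2] := HS A (fanA eps S eps0).2.
  rewrite fin_numE -ltNye -ltey (le_lt_trans h2 (ltry _)) andbT.
  by rewrite (lt_le_trans _ h1) ?ltNyr.
rewrite -(fineK finA); apply/cvg_EFinP => eta eta0.
have [J [eps eps0 [S HS]]] := key (eta / 2) (divr_gt0 eta0 (ltr0Sn R 1)).
have := HS A (fanA eps S eps0).2; rewrite -{1 2}(fineK finA) !lee_fin.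
move=> /andP[h1 h2]; have := (fanA eps S eps0).1; apply: filterS => n /HS /andP[h3 h4].
apply/andP; split; first by apply: le_trans h3; rewrite lee_fin; lra.
by apply: (le_trans h4); rewrite lee_fin; lra.
Qed.

End Fans.

Section TrajectoryFacts.
Context {R : realType}.
Implicit Types (A : set (plane R)) (g : R -> plane R) (z : plane R).

Lemma polygonal_length_lipschitz g (L a b : R) (s : seq R) :
  (forall t u, pdist (g t) (g u) <= L * `|t - u|) -> path <%R a s ->
  polygonal_length a b g s <= L * (last a s - a).
Proof.
move=> gL; rewrite /polygonal_length; elim: s a => [|x s IH] a /=.
  by rewrite big_geq// subrr mulr0.
move=> /andP[ax xs]; rewrite big_nat_recl//=.
have -> : L * (last x s - a) = L * (x - a) + L * (last x s - x) by ring.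
apply: lerD; last exact: IH.
by have := gL x a; rewrite /pdist gtr0_norm// subr_gt0.
Qed.

Lemma lipschitz_trajectory_curve g (L : R) :
  (forall t u, pdist (g t) (g u) <= L * `|t - u|) -> trajectory_curve g.
Proof.
move=> gL; split; last first.
  move=> a b ab; exists (L * (b - a)) => s [ps /eqP sb].
  by rewrite -[X in X - a]sb; exact: polygonal_length_lipschitz.
move=> x; apply/cvgrPdist_lt => e e0.
have L0 : 0 < `|L| + 1 by rewrite ltr_wpDl.
near=> y; apply: (le_lt_trans (norm_le_pdist _ _)); apply: (le_lt_trans (gL x y)).
have : `|x - y| < e / (`|L| + 1).
  by near: y; apply: (@cvgr_dist_lt _ _ _ (nbhs x) _ id x) => //; exact: divr_gt0.
rewrite ltr_pdivlMr// => h; apply: le_lt_trans h; rewrite mulrC ler_wpM2l//.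
by rewrite (le_trans (ler_norm L))// lerDl.
Unshelve. all: by end_near. Qed.

Lemma trajectory_set_translate z A : trajectory_set A -> trajectory_set (translate z A).
Proof.
move=> [C [cC tC ->]].
exists [set (fun t => z + g t) | g in C]; split.
- exact: sub_countable (card_image_le _ _) cC.
- move=> _ [g Cg <-]; have [cg rg] := tC g Cg; split.
    by move=> x; apply: cvgD; [exact: cvg_cst|exact: cg].
  move=> a b ab; have [M HM] := rg a b ab; exists M => s /HM; apply: le_trans.
  rewrite /polygonal_length /=; apply: ler_sum => i _.
  by rewrite -[leLHS]/(pdist (z + _) (z + _)) pdistD2l.
- apply/seteqP; split => [x [y [g Cg [t _ <-]] <-]|x [_ [g Cg <-] [t _ <-]]].
    by exists (fun t => z + g t); [exists g|exists t].
  by exists (g t) => //; exists g => //; exists t.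
Qed.

End TrajectoryFacts.

(** * Edges and lines as unions of half-lines *)

Section Edges.
Context {R : realType}.
Implicit Types (v dm dp x : plane R).

(** With [v] the spacing vector on the ray at an exceptional angle these are the parallel edges;
    with [dm = dp] the half-lines join to equidistant parallel lines. One convergence proof serves
    both. *)
Definition edges v dm dp : set (plane R) :=
  [set x | exists (k : int) (t : R), 0 <= t /\ x = k%:~R *: v - t *: dm] `|`
  [set x | exists (k : int) (t : R), 0 <= t /\ x = k%:~R *: v + t *: dp].

(** A broken line with corner at [k v]: [Num.max] acts for positive [t] and [Num.min] for negative
    [t], so for unit directions the parameter is arc length. *)
Definition edge_curve v dm dp (k : int) (t : R) : plane R :=
  k%:~R *: v + Num.max t 0 *: dp + Num.min t 0 *: dm.

Lemma edge_curve_lipschitz v dm dp k (t u : R) : enorm dm = 1 -> enorm dp = 1 ->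
  pdist (edge_curve v dm dp k t) (edge_curve v dm dp k u) <= 2 * `|t - u|.
Proof.
move=> dm1 dp1; rewrite /edge_curve -!addrA pdistD2l.
apply: (le_trans (pdist_triangle (Num.max u 0 *: dp + Num.min t 0 *: dm) _ _)).
rewrite mulr_natl mulr2n; apply: lerD.
  rewrite addrC [X in pdist _ X]addrC pdistD2l /pdist -scalerBl enormZ dp1 mulr1.
  by case: (leP t 0) => ?; case: (leP u 0) => ?; rewrite ler_norml ?subrr ?normr0//;
    case: (ler0P (t - u)) => ?; apply/andP; split; lra.
rewrite pdistD2l /pdist -scalerBl enormZ dm1 mulr1.
by case: (leP t 0) => ?; case: (leP u 0) => ?; rewrite ler_norml ?subrr ?normr0//;
  case: (ler0P (t - u)) => ?; apply/andP; split; lra.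
Qed.

Lemma trajectory_set_edges v dm dp : enorm dm = 1 -> enorm dp = 1 ->
  trajectory_set (edges v dm dp).
Proof.
move=> dm1 dp1; exists (range (edge_curve v dm dp)); split.
- exact: sub_countable (card_image_le _ _) (countableP _).
- move=> _ [k _ <-]; apply: (@lipschitz_trajectory_curve _ _ 2) => t u.
  exact: edge_curve_lipschitz.
apply/seteqP; split => [x [] [k [t [t0 ->]]]|x [_ [k _ <-] [t _ <-]]].
- exists (edge_curve v dm dp k); first by exists k.
  exists (- t) => //; rewrite /edge_curve.
  have -> : Num.max (- t) 0 = 0 by apply/max_idPr; lra.
  have -> : Num.min (- t) 0 = - t by apply/min_idPl; lra.
  by rewrite scale0r addr0 scaleNr.
- exists (edge_curve v dm dp k); first by exists k.
  exists t => //; rewrite /edge_curve.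
  have -> : Num.max t 0 = t by apply/max_idPl; lra.
  have -> : Num.min t 0 = 0 by apply/min_idPr; lra.
  by rewrite scale0r addr0.
- have [t0|t0] := leP 0 t.
    right; exists k, t; split => //; rewrite /edge_curve (max_idPl t0) (min_idPr t0).
    by rewrite scale0r addr0.
  left; exists k, (- t); split; first lra.
  rewrite /edge_curve (max_idPr (ltW t0)) (min_idPl (ltW t0)).
  by rewrite scale0r addr0 scaleNr opprK.
Qed.

Lemma crossDl u v (w : plane R) : cross (u + v) w = cross u w + cross v w.
Proof. by rewrite /cross /=; ring. Qed.

Lemma crossZl (c : R) u (w : plane R) : cross (c *: u) w = c * cross u w.
Proof. by rewrite /cross /= /GRing.scale /=; ring. Qed.

Lemma crossC u v : cross u v = - cross v u :> R.
Proof. by rewrite /cross /=; ring. Qed.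

Lemma crossNl u v : cross (- u) v = - cross u v :> R.
Proof. by rewrite /cross /=; ring. Qed.

Lemma cross_self u : cross u u = 0 :> R.
Proof. by rewrite /cross mulrC subrr. Qed.

Lemma continuous_crossl e : continuous (fun x : plane R => cross x e).
Proof.
apply: (@lipschitz_continuous _ _ (enorm e)) => x y.
have -> : cross x e - cross y e = cross (x - y) e.
  by rewrite crossDl crossNl.
by rewrite mulrC; exact: cross_le.
Qed.

Lemma closed_int : closed [set x : R | exists k : int, x = k%:~R].
Proof.
rewrite -openC openE => y /= yZ.
have fy := floor_itv y.
have yf : (Num.floor y)%:~R < y.
  rewrite lt_neqAle; have /andP[-> _] := fy; rewrite andbT.
  by apply/eqP => yE; apply: yZ; exists (Num.floor y).
have yc : y < (Num.floor y + 1)%:~R by have /andP[] := fy.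
have : nbhs y `](Num.floor y)%:~R, (Num.floor y + 1)%:~R[%classic.
  by apply: open_nbhs_nbhs; split; [exact: interval_open|rewrite /= in_itv /= yf yc].
apply: filterS => t /=; rewrite in_itv /= => /andP[t1 t2] [k tk].
by move: t1 t2; rewrite tk !ltr_int; lia.
Qed.

(** In the basis formed by [v] and a direction, cross products give the coordinates [k] and [t]; the
    half-lines are the preimage of the integers times a closed ray. The factor [c], 1 or -1, treats
    both families at once. *)
Lemma closed_edges v dm dp : 0 < cross v dm -> 0 < cross v dp ->
  closed (edges v dm dp).
Proof.
move=> cm cp.
have half d (c : R) : cross v d != 0 -> c != 0 ->
    closed [set x | exists (k : int) (t : R), 0 <= t /\ x = k%:~R *: v + t *: (c *: d)].
  move=> cd c0.
  rewrite (_ : [set x | _] =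
      (fun x => cross x d / cross v d) @^-1` [set y | exists k : int, y = k%:~R] `&`
      (fun x => - cross x v / (c * cross v d)) @^-1` `[0, +oo[).
    apply: closedI; apply: closed_comp.
    - by move=> x _; apply: cvgM; [exact: continuous_crossl|exact: cvg_cst].
    - exact: closed_int.
    - move=> x _; apply: cvgM; last exact: cvg_cst.
      by apply: cvgN; exact: continuous_crossl.
    - exact: rray_closed.
  apply/seteqP; split => [_ [k [t [t0 ->]]]|x []] /=.
    rewrite !(crossDl, crossZl) !cross_self !(mulr0, addr0, add0r) in_itv /= andbT; split.
      by exists k; rewrite mulfK.
    rewrite (crossC d v) [X in _ <= X](_ : _ = t)//.
    by field; rewrite cd c0.
  move=> [k xk]; rewrite in_itv /= andbT => t0.
  exists k, (- cross x v / (c * cross v d)); split => //.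
  have xd : cross x d = k%:~R * cross v d by rewrite -xk divfK.
  rewrite scalerA; have cE : - cross x v / (c * cross v d) * c = - cross x v / cross v d.
    by field; rewrite cd c0.
  rewrite cE -xk; move: cd; rewrite /cross; case: x {xk t0 xd cE} => x1 x2.
  case: v {cm cp} => v1 v2; case: d => d1 d2 /= cd.
  by apply/pair_equal_spec; split; rewrite /= /GRing.scale /=; field.
have -> : edges v dm dp =
    [set x | exists (k : int) (t : R), 0 <= t /\ x = k%:~R *: v + t *: (-1 *: dm)] `|`
    [set x | exists (k : int) (t : R), 0 <= t /\ x = k%:~R *: v + t *: (1 *: dp)].
  rewrite /edges; congr (_ `|` _); apply/seteqP; split => x [k [t [t0 ->]]];
    exists k, t; split => //; rewrite ?scaleN1r ?scale1r ?scalerN//.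
by apply: closedU; apply: half; rewrite ?oppr_eq0 ?oner_eq0 ?gt_eqF.
Qed.

End Edges.

Section EdgeFans.
Context {R : realType}.
Implicit Types (v dm dp q e x : plane R).

(** [b] tells whether the base point is included. At a corner only the outgoing half-line owns it,
    which makes the pieces of a fan disjoint. *)
Definition half_line q e (b : bool) : set (plane R) :=
  [set x | dot x (rot90 e) = dot q (rot90 e) /\
           (if b then dot q e <= dot x e else dot q e < dot x e)].

Lemma half_lineP q e b x : enorm e = 1 ->
  half_line q e b x <-> exists t, (if b then 0 <= t else 0 < t) /\ x = q + t *: e.
Proof.
move=> e1; split=> [[h1 h2]|[t [t0 ->]]].
  exists (dot x e - dot q e); split; first by case: b h2; rewrite ?subr_ge0 ?subr_gt0.
  rewrite [LHS](unit_decomp x e1) h1 scalerBl.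
  have -> : dot q (rot90 e) *: rot90 e = q - dot q e *: e.
    by rewrite [X in _ = X - _](unit_decomp q e1) addrAC subrr add0r.
  by rewrite addrCA.
have e1' : enorm (rot90 e) = 1 by rewrite enorm_rot90.
split; first by rewrite dotDl dotZl dot_rot90 mulr0 addr0.
by rewrite dotDl dotZl dot_unit// mulr1; case: b t0; rewrite ?lerDl ?ltrDl.
Qed.

Lemma closed_dot_eq e (c : R) : enorm e = 1 -> closed [set x | dot x e = c].
Proof.
move=> e1; rewrite (_ : [set x | _] = (fun x => dot x e) @^-1` [set c])//.
by apply: closed_comp; [move=> x _; exact: continuous_dot|exact: closed_eq].
Qed.

Lemma closed_dot_le e (c : R) : enorm e = 1 -> closed [set x | dot x e <= c].
Proof.
move=> e1; rewrite (_ : [set x | _] = (fun x => dot x e) @^-1` `]-oo, c]).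
  by apply: closed_comp; [move=> x _; exact: continuous_dot|exact: lray_closed].
by apply/seteqP; split => x /=; rewrite in_itv.
Qed.

Lemma near_ray_half_line q e b (eps S : R) : enorm e = 1 -> 0 <= eps ->
  near_ray q e eps S (half_line q e b).
Proof.
move=> e1 eps0; have e1' : enorm (rot90 e) = 1 by rewrite enorm_rot90.
have ge0 x : half_line q e b x -> dot q e <= dot x e.
  by move=> [_]; case: b => // /ltW.
split.
- have mle c : h1measurable [set x : plane R | dot x e <= c].
    exact/h1measurable_closed/closed_dot_le.
  have meq c : h1measurable [set x : plane R | dot x (rot90 e) = c].
    exact/h1measurable_closed/closed_dot_eq.
  have mlt : h1measurable (~` [set x : plane R | dot x e <= dot q e]).
    exact: h1measurableC.
  case: b ge0 => ge0.
    rewrite (_ : half_line _ _ _ = [set x | dot x (rot90 e) = dot q (rot90 e)] `&`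
        [set x | dot x (- e) <= dot q (- e)]).
      apply: h1measurableI => //; apply/h1measurable_closed/closed_dot_le.
      by rewrite enormN.
    by apply/seteqP; split => x [h1 h2]; split => //=; move: h2;
      rewrite /= !(dotC _ (- e)) !dotNl lerN2 !(dotC e).
  rewrite (_ : half_line _ _ _ = [set x | dot x (rot90 e) = dot q (rot90 e)] `&`
      ~` [set x | dot x e <= dot q e]); first exact: h1measurableI.
  apply/seteqP; split => x [h1 h2]; split => //=.
    by apply/negP; rewrite -ltNge.
  by rewrite ltNge; apply/negP.
- exact: ge0.
- by move=> x y [-> _] [-> _]; rewrite subrr normr0 mulr_ge0.
- by move=> x Cx; have [-> _] := Cx; rewrite subrr normr0 mulr_ge0// subr_ge0 ge0.
- move=> t /andP[t0 _]; exists (q + t *: e).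
    by apply/(half_lineP _ _ _ e1); exists t; split => //; case: b {ge0} => //; exact: ltW.
  by rewrite dotDl dotZl dot_unit// mulr1.
Qed.

(** Corners [-J] to [J], with [true] for the outgoing half-line along [dp] and [false] for the
    incoming one, read backwards from the corner along [- dm]. *)
Definition fan_index (J : nat) : seq (int * bool) :=
  [seq (i%:Z - J%:Z, b) | i <- iota 0 J.*2.+1, b <- [:: true; false]].

Lemma fan_index_uniq J : uniq (fan_index J).
Proof.
apply: allpairs_uniq => //; first exact: iota_uniq.
move=> [i b] [i' b'] _ _ /= [] h ->; congr (_, _).
by move: h; lia.
Qed.

Lemma mem_fan_index J (i : int * bool) : (i \in fan_index J) = (`|i.1| <= J)%N.
Proof.
case: i => k b; apply/allpairsP/idP => [[[i b'] [+ _ [-> _]]]|kJ].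
  by rewrite mem_iota /=; lia.
rewrite /= in kJ; exists (absz (k + J%:Z), b); split.
- by rewrite mem_iota /=; lia.
- by case: b.
- by congr (_, _) => /=; lia.
Qed.

Definition fan_base_point v (i : int * bool) : plane R := i.1%:~R *: v.

Definition fan_direction dm dp (i : int * bool) : plane R :=
  if i.2 then dp else - dm.

(** [cross v x] is nonnegative on outgoing and negative on incoming pieces, and the cross product
    with the direction recovers the corner, whence disjointness. The half-line at corner [k] is at
    distance at least [|k| cross v d] from the origin, so [J] corners on each side suffice for the
    disk. *)
Lemma fan_edges v dm dp (M eps S : R) (J : nat) :
  enorm dm = 1 -> enorm dp = 1 -> 0 < cross v dm -> 0 < cross v dp ->
  M <= J%:R * cross v dm -> M <= J%:R * cross v dp -> 0 < eps ->
  fan (fan_index J) (fan_base_point v) (fan_direction dm dp) M eps S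
    (edges v dm dp).
Proof.
move=> dm1 dp1 cm cp Mm Mp eps0; split.
  exact/h1measurable_closed/closed_edges.
have e1 i : enorm (fan_direction dm dp i) = 1.
  by rewrite /fan_direction; case: ifP; rewrite ?enormN.
pose C i := half_line (fan_base_point v i) (fan_direction dm dp i) i.2.
exists C, (fan_base_point v).
have Ccross i x : C i x -> exists t, [/\ (if i.2 then 0 <= t else 0 < t),
    cross v x = t * cross v (fan_direction dm dp i),
    cross x (fan_direction dm dp i) = i.1%:~R * cross v (fan_direction dm dp i) &
    x = fan_base_point v i + t *: fan_direction dm dp i].
  move=> /(half_lineP _ _ _ (e1 i))[t [t0 ->]]; exists t; split => //.
    by rewrite crossC crossDl !crossZl cross_self mulr0 add0r (crossC _ v) mulrN opprK.
  by rewrite crossDl !crossZl cross_self mulr0 addr0.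
have kJ (k : int) (c : R) x d : enorm d = 1 -> enorm x <= M -> 0 < c ->
    M <= J%:R * c -> `|cross x d| = `|k|%:~R * c -> (`|k| <= J)%N.
  move=> d1 xM c0 Mc xd; have := cross_le x d; rewrite d1 mulr1 xd => h.
  have : `|k|%:~R * c <= J%:R * c by apply: le_trans Mc; exact: le_trans xM.
  by rewrite ler_pM2r// -[J%:R]/(J%:Z%:~R) ler_int; lia.
split.
- by move=> i; exact: near_ray_measurable (near_ray_half_line _ _ 1 (e1 i) ler01).
- apply/trivIsetP => i j _ _ ij; apply/seteqP; split => // x [Ci Cj].
  exfalso; move/eqP: ij; apply.
  have [t [t0 vt xk _]] := Ccross i x Ci; have [u [u0 vu xl _]] := Ccross j x Cj.
  have cm' : cross v (- dm) = - cross v dm by rewrite crossC crossNl (crossC dm) opprK.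
  case: i j {Ci Cj} t0 vt xk u0 vu xl => [k []] [l []] /= t0 vt xk u0 vu xl;
    rewrite /fan_direction/= ?cm' in vt xk vu xl.
  + congr (_, _); apply/eqP; rewrite -(eqr_int R); apply/eqP.
    by apply: (mulIf (lt0r_neq0 cp)); rewrite -xk -xl.
  + have := mulr_ge0 t0 (ltW cp).
    by rewrite -vt vu mulrN oppr_ge0 leNgt mulr_gt0.
  + have := mulr_ge0 u0 (ltW cp).
    by rewrite -vu vt mulrN oppr_ge0 leNgt mulr_gt0.
  + congr (_, _); apply/eqP; rewrite -(eqr_int R); apply/eqP.
    have cn : - cross v dm != 0 by rewrite oppr_eq0 gt_eqF.
    by apply: (mulIf cn); rewrite -xk -xl.
- move=> i _ x /Ccross[t [t0 _ _ ->]]; case: i t0 => k []/= t0; [right|left];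
    exists k, t; split => //; first exact: ltW.
  by rewrite /fan_direction/= scalerN.
- move=> x [[] [k [t [t0 xE]]] xM].
  (* The corner of an incoming half-line is assigned to the outgoing piece. *)
  + have [t00|t0'] := eqVneq t 0.
      exists (k, true); last first.
        apply/(half_lineP _ _ _ (e1 _)); exists 0; split; first exact: lexx.
        by rewrite xE t00 !scale0r subr0 addr0.
      rewrite /= mem_fan_index/=; apply: (kJ _ _ x dp dp1 xM cp Mp).
      by rewrite xE t00 scale0r subr0 crossZl normrM (gtr0_norm cp) -intr_norm.
    exists (k, false); last first.
      apply/(half_lineP _ _ _ (e1 _)); exists t; split => /=.
        by rewrite lt_neqAle eq_sym t0'.
      by rewrite xE /fan_direction/= scalerN.
    rewrite /= mem_fan_index/=; apply: (kJ _ _ x dm dm1 xM cm Mm).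
    by rewrite xE crossDl crossNl !crossZl cross_self mulr0 subr0 normrM (gtr0_norm cm) -intr_norm.
  + exists (k, true); last first.
      by apply/(half_lineP _ _ _ (e1 _)); exists t.
    rewrite /= mem_fan_index/=; apply: (kJ _ _ x dp dp1 xM cp Mp).
    by rewrite xE crossDl !crossZl cross_self mulr0 addr0 normrM (gtr0_norm cp) -intr_norm.
- by move=> i _; apply: near_ray_half_line => //; exact: ltW.
- by move=> i _; rewrite pdistxx ltW.
Qed.

(** In the disk each piece is a Lipschitz graph over an interval of length [2 M]. *)
Lemma fan_locally_finite (I : choiceType) (s : seq I) p (e : I -> plane R) (M eps S : R) A :
  0 < M -> 0 <= eps -> (forall i, i \in s -> enorm (e i) = 1) ->
  fan s p e M eps S A -> (hausdorff1 (A `&` cdisk M) < +oo)%E.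
Proof.
move=> M0 eps0 e1 [_ [C [q [mC _ _ AC rC _]]]].
apply: (@le_lt_trans _ _ (\sum_(i <- s) hausdorff1 (C i `&` cdisk M))%E).
  apply: (@le_trans _ _ (hausdorff1 (\big[setU/set0]_(i <- s) (C i `&` cdisk M)))).
    apply: le_hausdorff1 => x [Ax xM].
    have [i si Cx] := AC x (conj Ax xM).
    by rewrite -bigcup_seq; exists i.
  elim/big_ind2 : _ => //; first by rewrite hausdorff1_set0.
  move=> X a Y b h1 h2; apply: le_trans (leeD h1 h2).
  exact: (outer_measureU2 hausdorff1).
rewrite big_seq; elim/big_ind : _ => //; first by move=> a b; exact: lte_add_pinfty.
move=> i si; apply: (@le_lt_trans _ _ ((1 + eps) * (M - (- M)))%:E); last exact: ltry.
apply: (@hausdorff1_le_graph _ _ (fun x => dot x (e i))); first by rewrite addr_ge0.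
- lra.
- move=> x [_ xM]; have := dot_unit_le x (e1 i si); rewrite ler_norml => /andP[h1 h2].
  by move: xM; rewrite /cdisk /= => xM; apply/andP; split; lra.
- move=> x y [Cx _] [Cy _]; apply: (le_trans (pdist_le_dot x y (e1 i si))).
  by rewrite mulrDl mul1r lerD2l; exact: (near_ray_slope (rC i si)).
Qed.

Lemma locally_finite_le A : (forall M, 0 < M -> (hausdorff1 (A `&` cdisk M) < +oo)%E) ->
  locally_finite (A : set (plane R)).
Proof.
move=> h M; apply: le_lt_trans (h (`|M| + 1) _); last by rewrite ltr_wpDl.
apply: le_hausdorff1 => x [Ax xM]; split => //; rewrite /cdisk /=.
by rewrite (le_trans xM)// (le_trans (ler_norm M))// lerDl.
Qed.

Lemma edges_index v dm dp (M : R) : 0 < cross v dm -> 0 < cross v dp ->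
  exists J : nat, M <= J%:R * cross v dm /\ M <= J%:R * cross v dp.
Proof.
move=> cm cp; pose c := Num.min (cross v dm) (cross v dp).
have c0 : 0 < c by rewrite lt_min cm.
exists (Num.trunc (M / c)).+1.
have h : M <= (Num.trunc (M / c)).+1%:R * c.
  by rewrite -ler_pdivrMr// ltW// truncnS_gt.
by split; apply: (le_trans h); rewrite ler_pM2l ?ltr0n// /c ge_min lexx ?orbT.
Qed.

Lemma edges_locally_finite v dm dp : enorm dm = 1 -> enorm dp = 1 ->
  0 < cross v dm -> 0 < cross v dp -> locally_finite (edges v dm dp).
Proof.
move=> dm1 dp1 cm cp; apply: locally_finite_le => M M0.
have [J [Jm Jp]] := edges_index M cm cp.
apply: (fan_locally_finite M0 (@ler01 R) _ (fan_edges 1 dm1 dp1 cm cp Jm Jp ltr01)).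
by move=> i _; rewrite /fan_direction; case: ifP; rewrite ?enormN.
Qed.

End EdgeFans.

(** * Charts of a spiral *)

Section Derivatives.
Context {R : realType}.
Implicit Types (f : R -> R) (g : R -> plane R) (D : set R) (x t : R) (u : plane R).

Lemma within_dnbhs D x : nbhs x D -> within D x^' = x^'.
Proof.
move=> /nbhs_dnbhs Dx; apply/seteqP; split => A; last exact: cvg_within.
by rewrite /within /= => WA; apply: filterS2 Dx WA => y Dy; exact.
Qed.

Lemma diff_quot_in_interior (V : normedModType R) (f : R -> V) D x (l : V) :
  nbhs x D ->
  diff_quot_in D f x --> l <-> (y - x)^-1 *: (f y - f x) @[y --> x^'] --> l.
Proof.
by move=> Dx; rewrite /diff_quot_in (within_dnbhs Dx).
Qed.

Lemma is_derive_diff_quot f x (l : R) :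
  is_derive x 1 f l <-> (y - x)^-1 *: (f y - f x) @[y --> x^'] --> l.
Proof.
have shift1 : (h + x) @[h --> (0 : R)^'] --> x^'.
  move=> A /= [e /= e0 eA]; exists e => //= h /= h0e h0; apply: eA => /=.
    by move: h0e; rewrite sub0r normrN opprD addrCA subrr addr0 normrN.
  by apply: contra_neq h0 => hx; rewrite -[h](addrK x) hx subrr.
have shift2 : (y - x) @[y --> x^'] --> (0 : R)^'.
  move=> A /= [e /= e0 eA]; exists e => //= y /= y0e y0; apply: eA => /=.
    by rewrite sub0r normrN distrC.
  by rewrite subr_eq0.
split=> [[df <-]|h].
  have := cvg_comp _ _ shift2 df; apply: cvg_trans.
  apply: near_eq_cvg; near=> y => /=.
  by rewrite /GRing.scale /= mulr1 subrK.
have h' : (h^-1 *: ((f \o shift x) (h *: 1) - f x)) @[h --> (0 : R)^'] --> l.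
  have := cvg_comp _ _ shift1 h; apply: cvg_trans.
  apply: near_eq_cvg; near=> y => /=.
  by rewrite addrK /shift /GRing.scale /= mulr1.
by split; [apply/cvg_ex; exists l|exact: cvg_lim h'].
Unshelve. all: by end_near. Qed.

(** Componentwise, so that one-variable calculus applies to each coordinate; [pderive_diff_quot]
    identifies it with the vectorial difference quotient. *)
Definition pderive g x u : Prop :=
  is_derive x 1 (fun t => (g t).1) u.1 /\ is_derive x 1 (fun t => (g t).2) u.2.

Lemma pderive_diff_quot g x u :
  pderive g x u <-> (y - x)^-1 *: (g y - g x) @[y --> x^'] --> u.
Proof.
rewrite /pderive !is_derive_diff_quot; split=> [[h1 h2]|h].
  rewrite [u]surjective_pairing; exact: cvg_pair h1 h2.
split.
  apply/cvgrPdist_lt => e e0; move/cvgrPdist_lt: h => /(_ e e0); apply: filterS => y.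
  by apply: le_lt_trans; rewrite [leRHS]prod_normE le_max lexx.
apply/cvgrPdist_lt => e e0; move/cvgrPdist_lt: h => /(_ e e0); apply: filterS => y.
by apply: le_lt_trans; rewrite [leRHS]prod_normE le_max lexx orbT.
Qed.

Lemma pderive_deriv_in g D x u : nbhs x D -> pderive g x u -> deriv_in D g x = u.
Proof.
move=> Dx /pderive_diff_quot /(diff_quot_in_interior _ _ Dx).2.
rewrite /deriv_in /diff_quot_in (within_dnbhs Dx) => h.
exact: (@cvg_lim (plane R : normedModType R) (@norm_hausdorff _ _) _ _ _ _ _ h).
Qed.

Lemma derivable_in_pderive g D x : nbhs x D -> derivable_in D g ->
  pderive g x (deriv_in D g x).
Proof.
move=> Dx Dg; apply/pderive_diff_quot/(diff_quot_in_interior _ _ Dx).1.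
exact: (Dg x (nbhs_singleton Dx)).
Qed.

Lemma derivable_in_is_derive f D x : nbhs x D -> derivable_in D f ->
  is_derive x 1 f (deriv_in D f x).
Proof.
move=> Dx Df; apply/is_derive_diff_quot/(diff_quot_in_interior _ _ Dx).1.
exact: (Df x (nbhs_singleton Dx)).
Qed.

Lemma derivable_in_continuous (V : normedModType R) (f : R -> V) D :
  derivable_in D f -> {within D, continuous f}.
Proof.
move=> Df; apply/subspace_continuousP => x Dx.
apply/cvgrPdist_lt => e e0.
have /cvg_ex[l /cvgrPdist_lt/(_ 1 ltr01) dl] := Df x Dx.
have L0 : 0 < `|l| + 1 by rewrite ltr_wpDl.
suff : \forall y \near x, D y -> `|f x - f y| < e by exact.
have : \forall y \near x, y != x -> D y -> `|l - (y - x)^-1 *: (f y - f x)| < 1.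
  exact: dl.
have : \forall y \near x, `|x - y| < e / (`|l| + 1).
  by apply: (@cvgr_dist_lt _ _ _ (nbhs x) _ id x) => //; exact: divr_gt0.
apply: filterS2 => y xy yl Dy.
have [->|yx] := eqVneq y x; first by rewrite subrr normr0.
have yx0 : y - x != 0 by rewrite subr_eq0.
have := yl yx Dy; set w := _ *: _ => lw.
have -> : f x - f y = (x - y) *: w.
  by rewrite -opprB -[x - y]opprB scaleNr scalerA divff// scale1r.
rewrite normrZ; have wl : `|w| <= `|l| + 1.
  have := ler_normB l (l - w); rewrite opprB addrC subrK => h; apply: (le_trans h).
  by rewrite lerD2l ltW.
rewrite ltr_pdivlMr// in xy; apply: le_lt_trans xy.
by rewrite ler_wpM2l.
Qed.

(** Derivatives are taken only inside the interval, so that chords may start or end at an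
    exceptional angle, where the curve can have a corner. *)
Lemma ge0_derive_le f (a b : R) : a <= b ->
  {within `[a, b], continuous f} ->
  (forall x, a < x < b -> exists2 l, is_derive x 1 f l & 0 <= l) -> f a <= f b.
Proof.
move=> ab cf df.
have df' x : x \in `]a, b[%R -> is_derive x 1 f ('D_1 f x).
  by rewrite in_itv /= => /df[l [dl _] _]; exact: derivableP.
have [<-//|neq] := eqVneq a b.
have [|c cab fE] := MVT _ df' cf; first by rewrite lt_neqAle neq.
rewrite -subr_ge0 fE mulr_ge0 ?subr_ge0//.
move: cab; rewrite in_itv /= => /df[l [_ <-] l0]; exact: l0.
Qed.

End Derivatives.

Section Charts.
Context {R : realType}.
Implicit Types (d u x : plane R) (k : nat) (t : R).

Lemma pderive_dot (g : R -> plane R) t u d :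
  pderive g t u -> is_derive t 1 (fun s => dot (g s) d) (dot u d).
Proof.
move=> [g1 g2].
have h1 : is_derive t 1 (fun s => (g s).1 * d.1) (u.1 * d.1).
  apply: (is_derive_eq (is_deriveM g1 (is_derive_cst d.1 t 1))).
  by rewrite scaler0 add0r /GRing.scale /= mulrC.
have h2 : is_derive t 1 (fun s => (g s).2 * d.2) (u.2 * d.2).
  apply: (is_derive_eq (is_deriveM g2 (is_derive_cst d.2 t 1))).
  by rewrite scaler0 add0r /GRing.scale /= mulrC.
exact: is_deriveD h1 h2.
Qed.

(* The part of the definition of a spiral at the angle [b] that matters for weak
   limits: the curvature plays no role, since straightness of the limits already
   follows from the uniform convergence of the velocities. *)
Record chart (G : set (plane R)) (b a : R) (r eta rho : R -> R)
    (h : R -> plane R) (Z : set R) : Prop := {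
  chart_aperture : 0 < a <= 8^-1;
  chart_sub0 : Z `<=` [set 0];
  chart_cone : G `&` cone a b =
    [set polar r t | t in \bigcup_(k in [set k | (1 <= k)%N]) sector a b k];
  chart_ge0 : forall k t, (1 <= k)%N -> - a <= t <= a -> 0 <= r (k%:R + b + t);
  chart_continuous : forall k, (1 <= k)%N ->
    {within sector a b k, continuous (polar r)};
  chart_bounded : forall k, (1 <= k)%N -> exists M : R, forall t, - a < t < a -> t != 0 ->
    exists2 u, pderive (polar r) (k%:R + b + t) u & enorm u <= M;
  chart_velocity : forall e : R, 0 < e -> exists2 K, (1 <= K)%N &
    forall k t, (K <= k)%N -> - a < t < a -> ~ Z t ->
    exists2 u, pderive (polar r) (k%:R + b + t) u &
      pdist ((enorm u)^-1 *: u) (h t) <= e;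
  chart_increasing : exists2 K, (1 <= K)%N & forall t, - a <= t <= a ->
    forall k, (K <= k)%N -> r (k%:R + b + t) < r (k.+1%:R + b + t);
  chart_spacing_cont : {within `[- a, a], continuous eta};
  chart_spacing_gt0 : forall t, - a <= t <= a -> 0 < eta t;
  chart_offset_cont : {within `[- a, a], continuous rho};
  chart_equispacing : forall e : R, 0 < e -> exists2 K, (1 <= K)%N &
    forall k t, (K <= k)%N -> - a <= t <= a ->
    `|r (k%:R + b + t) - eta t * k%:R - rho t| <= e;
  chart_heading_cont : {within `[- a, a] `\` Z, continuous h};
  chart_heading_unit : forall t, - a <= t <= a -> ~ Z t -> enorm (h t) = 1 }.

(* The [k]-th turn of the spiral, [t] being the angle measured from [b]. *)
Definition coil (r : R -> R) (b : R) k t : plane R := polar r (k%:R + b + t).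

Lemma coilE (r : R -> R) (b : R) k t : coil r b k t = r (k%:R + b + t) *: ell (b + t).
Proof. by rewrite /coil /polar -addrA ellDn. Qed.

Section ChartTheory.
Variables (G : set (plane R)) (b a : R) (r eta rho : R -> R) (h : R -> plane R).
Variable Z : set R.
Hypothesis HC : chart G b a r eta rho h Z.

Local Notation gam := (coil r b).

Lemma chart_gt0 : 0 < a. Proof. by have /andP[] := chart_aperture HC. Qed.

Lemma chart_le : a <= 8^-1. Proof. by have /andP[] := chart_aperture HC. Qed.

Lemma sectorE k t : sector a b k (k%:R + b + t) <-> - a <= t <= a.
Proof.
rewrite /sector /= in_itv /=; split => /andP[h1 h2]; apply/andP; split; lra.
Qed.

Lemma chart_in k t : (1 <= k)%N -> - a <= t <= a -> G (gam k t).
Proof.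
move=> k1 ta; have : (G `&` cone a b) (gam k t).
  rewrite (chart_cone HC); exists (k%:R + b + t) => //; exists k => //.
  exact/sectorE.
by case.
Qed.

(** The angle [v] is not claimed to be [t], which may fail at the origin; [ray_coil_inj] identifies
    them where the radius is positive. *)
Lemma chart_out x (rx t : R) : G x -> 0 <= rx -> - a <= t <= a -> x = rx *: ell (b + t) ->
  exists k (v : R), [/\ (1 <= k)%N, - a <= v <= a & x = gam k v].
Proof.
move=> Gx rx0 ta xE; have : (G `&` cone a b) x.
  split=> //; exists rx, (b + t); split => //.
  by move: ta => /andP[h1 h2]; apply/andP; split; lra.
rewrite (chart_cone HC) => -[s [k k1 ks] <-].
exists k, (s - (k%:R + b)); split => //.
  by apply/(sectorE k); rewrite addrC subrK.
by rewrite /coil addrC subrK.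
Qed.

Lemma chart_continuous_dot k d (s t : R) : (1 <= k)%N -> - a <= s -> t <= a ->
  {within `[k%:R + b + s, k%:R + b + t], continuous (fun y => dot (polar r y) d)}.
Proof.
move=> k1 sa ta; apply: (@continuous_subspaceW _ _ _ (sector a b k)).
  move=> y /=; rewrite /sector /= !in_itv /= => /andP[h1 h2].
  by apply/andP; split; lra.
move=> y; apply: (@continuous_comp (subspace (sector a b k)) _ _ (polar r) (fun x => dot x d)).
  exact: (chart_continuous HC k1 (x := y)).
by apply: (@lipschitz_continuous _ _ (enorm d)) => x z; rewrite -dotBl mulrC dot_le.
Qed.

Lemma chart_chord_dot k d (s t : R) : (1 <= k)%N -> - a <= s -> s <= t -> t <= a ->
  (forall y, s < y < t -> exists2 u, pderive (polar r) (k%:R + b + y) u & 0 <= dot u d) ->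
  dot (gam k s) d <= dot (gam k t) d.
Proof.
move=> k1 sa st ta hu.
apply: (@ge0_derive_le _ (fun y => dot (polar r y) d)); first by rewrite lerD2l.
  exact: chart_continuous_dot.
move=> y /andP[y1 y2]; have [|u du u0] := hu (y - (k%:R + b)).
  by apply/andP; split; lra.
rewrite addrC subrK in du; exists (dot u d) => //; exact: pderive_dot.
Qed.

(** Headings close to [d] put the velocity into a narrow cone around [d], and the cone condition
    integrates to chords. *)
Lemma chart_chord (e : R) : 0 < e -> e <= 4^-1 -> exists2 K, (1 <= K)%N &
  forall k d (s t : R), (K <= k)%N -> enorm d = 1 -> - a <= s -> s <= t -> t <= a ->
    (forall y, s < y < t -> ~ Z y /\ pdist (h y) d <= e) ->
    dot (gam k s) d <= dot (gam k t) d /\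
    `|dot (gam k t) (rot90 d) - dot (gam k s) (rot90 d)| <=
      4 * e * (dot (gam k t) d - dot (gam k s) d).
Proof.
move=> e0 e4; have [K K1 HK] := chart_velocity HC e0; exists K => // k d s t Kk d1 sa st ta hd.
have k1 : (1 <= k)%N := leq_trans K1 Kk.
have d1' : enorm (rot90 d) = 1 by rewrite enorm_rot90.
have key y : s < y < t -> exists2 u, pderive (polar r) (k%:R + b + y) u &
    0 <= dot u d /\ `|dot u (rot90 d)| <= 4 * e * dot u d.
  move=> /[dup] yst /hd[Zy hyd]; have ya : - a < y < a.
    by move: yst => /andP[h1 h2]; apply/andP; split; lra.
  have [u du ue] := HK k y Kk ya Zy; exists u => //.
  have [w wE] : exists w, w = (enorm u)^-1 *: u by exists ((enorm u)^-1 *: u).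
  rewrite -wE in ue.
  (* With [e <= 1/4] this gives [dot w d >= 1/2] and [|dot w (rot90 d)| <= 2 e], the origin of the
     slope [4 e]. *)
  have wd : pdist w d <= 2 * e by have := pdist_triangle (h y) w d; lra.
  have := dot_dist_le w d d1; have := dot_dist_le w d d1'.
  rewrite dot_unit// dot_rot90 subr0 => w1.
  rewrite ler_norml => /andP[w2 w3].
  have [u0|u0] := eqVneq (enorm u) 0.
    by rewrite (enorm_eq0 u0) /dot /= !mul0r !addr0 normr0 mulr0.
  have uE : u = enorm u *: w by rewrite wE scalerA divff// scale1r.
  have un0 := enorm_ge0 u; rewrite uE !dotZl; split.
    by rewrite mulr_ge0//; lra.
  rewrite normrM (ger0_norm un0) mulrCA ler_wpM2l//.
  have : 4 * e * 2^-1 <= 4 * e * dot w d by rewrite ler_pM2l//; lra.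
  lra.
(* A linear functional that is nonnegative on the cone increases along the arc; the two extreme
   choices [c = 1] and [c = -1] bound the slope of the chord. *)
have mono (c : R) : `|c| <= 1 ->
    4 * e * dot (gam k s) d + c * dot (gam k s) (rot90 d) <=
    4 * e * dot (gam k t) d + c * dot (gam k t) (rot90 d).
  move=> c1; have dE u : 4 * e * dot u d + c * dot u (rot90 d) =
      dot u (4 * e *: d + c *: rot90 d).
    by rewrite dotC (dotC u (rot90 d)) -!dotZl -dotDl dotC.
  rewrite !dE; apply: chart_chord_dot => // y /key[u du [u1 u2]]; exists u => //.
  rewrite -dE; have : `|c * dot u (rot90 d)| <= 4 * e * dot u d.
    by rewrite normrM; apply: le_trans u2; rewrite ler_piMl.
  by rewrite ler_norml => /andP[h1 _]; lra.
split.
  by apply: chart_chord_dot => // y /key[u du [u1 u2]]; exists u.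
have := mono 1; have := mono (-1); rewrite normrN normr1 lexx => /(_ isT) h1 /(_ isT) h2.
by rewrite ler_norml; apply/andP; split; lra.
Qed.

Lemma chart_spacing (e : R) : 0 < e -> exists2 K, (1 <= K)%N &
  forall k k' t, (K <= k)%N -> (K <= k')%N -> - a <= t <= a ->
  `|r (k'%:R + b + t) - r (k%:R + b + t) - eta t * (k'%:R - k%:R)| <= e.
Proof.
move=> e0; have [K K1 HK] := chart_equispacing HC (divr_gt0 e0 (ltr0Sn R 1)).
exists K => // k k' t Kk Kk' ta; have := HK k t Kk ta; have := HK k' t Kk' ta.
rewrite !ler_norml => /andP[h1 h2] /andP[h3 h4]; apply/andP; split; lra.
Qed.

(** Finitely many turns, each compact. A point of larger radius can then lie only on a turn of index
    at least [K]. *)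
Lemma chart_radius_bounded K : exists B : R, forall k t, (1 <= k)%N -> (k < K)%N ->
  - a <= t <= a -> r (k%:R + b + t) <= B.
Proof.
elim: K => [|K [B HB]]; first by exists 0.
have [K1|K1] := leqP 1 K; last first.
  by exists B => k t k1 kK ta; apply: HB => //; lia.
have [M M0 HM] : exists2 M : R, 0 < M & polar r @` sector a b K `<=` cdisk M.
  apply: compact_sub_cdisk; apply: continuous_compact; first exact: (chart_continuous HC).
  exact: segment_compact.
exists (Num.max B M) => k t k1; rewrite ltnS leq_eqVlt => /orP[/eqP -> ta|kK ta].
  have /HM : (polar r @` sector a b K) (gam K t) by exists (K%:R + b + t) => //; exact/sectorE.
  rewrite /cdisk /= coilE enormZ enorm_ell mulr1 ger0_norm ?(chart_ge0 HC)// => hh.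
  by rewrite le_max hh orbT.
by rewrite le_max HB.
Qed.

End ChartTheory.
End Charts.

Section Arcs.
Context {R : realType}.
Variables (G : set (plane R)) (b a : R) (r eta rho : R -> R) (h : R -> plane R).
Variable Z : set R.
Hypothesis HC : chart G b a r eta rho h Z.
Local Notation gam := (coil r b).

Lemma coil_image k (s t : R) :
  gam k @` `[s, t] = polar r @` `[k%:R + b + s, k%:R + b + t].
Proof.
apply/seteqP; split => [_ [y /= yst <-]|_ [y /= yst <-]].
  by exists (k%:R + b + y) => //=; move: yst; rewrite !in_itv /= !lerD2l.
exists (y - (k%:R + b)); last by rewrite /coil addrC subrK.
by move: yst; rewrite /= !in_itv /= => /andP[h1 h2]; apply/andP; split; lra.
Qed.

Lemma arc_closed k (s t : R) : (1 <= k)%N -> - a <= s -> t <= a ->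
  closed (gam k @` `[s, t]).
Proof.
move=> k1 sa ta; rewrite coil_image; apply: compact_closed; first exact: norm_hausdorff.
apply: continuous_compact; last exact: segment_compact.
apply: continuous_subspaceW (chart_continuous HC k1) => y.
rewrite /sector /= !in_itv /= => /andP[h1 h2]; apply/andP; split; lra.
Qed.

Lemma arc_co_measurable k (s t : R) : (1 <= k)%N -> - a <= s -> t <= a ->
  h1measurable (gam k @` `[s, t[).
Proof.
move=> k1 sa ta.
have -> : gam k @` `[s, t[ = \bigcup_m (gam k @` `[s, t - harmonic m]).
  apply/seteqP; split => [_ [y /= + <-]|_ [m _ [y /= + <-]]].
    rewrite in_itv /= => /andP[y1 y2].
    exists (Num.trunc (t - y)^-1) => //; exists y => //=.
    rewrite in_itv /= y1 lerBrDr -lerBrDl /harmonic /= invf_ple ?posrE ?subr_gt0//.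
    exact/ltW/truncnS_gt.
  rewrite in_itv /= => /andP[y1 y2]; exists y => //=; rewrite in_itv /= y1 /=.
  by rewrite (le_lt_trans y2)// ltrBlDr ltrDl harmonic_gt0.
apply: h1measurable_bigcup => m; apply: h1measurable_closed; apply: arc_closed => //.
by apply: le_trans ta; rewrite lerBlDr lerDl ltW// harmonic_gt0.
Qed.

Lemma near_ray_translate (p q e : plane R) (eps S : R) C :
  near_ray q e eps S C -> near_ray (q - p) e eps S (translate (- p) C).
Proof.
move=> [mC C0 Cs Cb Cl]; split.
- exact: h1measurable_translate.
- move=> _ [x Cx <-]; rewrite !(dotBl, dotDl, dotNl); have := C0 x Cx; lra.
- move=> _ _ [x Cx <-] [y Cy <-]; rewrite !(dotDl, dotNl).
  have := Cs x y Cx Cy.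
  have e1 (u v w : R) : - w + u - (- w + v) = u - v by ring.
  by rewrite !e1.
- move=> _ [x Cx <-]; rewrite !(dotBl, dotDl, dotNl); have := Cb x Cx.
  have e1 (u v w : R) : - w + u - (v - w) = u - v by ring.
  by rewrite !e1.
- move=> t t0; have [x Cx xt] := Cl t t0; exists (- p + x); first by exists x.
  by rewrite !(dotBl, dotDl, dotNl) xt; ring.
Qed.

Lemma chart_cross k (s : R) d : cross (gam k s) d = r (k%:R + b + s) * cross (ell (b + s)) d.
Proof. by rewrite coilE crossZl. Qed.

(** The left side is the distance of [gam k s] from the line through the origin at the angle
    [b + t], which contains [gam k t]. *)
Lemma coil_dist_ray k (s t : R) :
  `|r (k%:R + b + s) * sin (2 * pi * (t - s))| <= pdist (gam k t) (gam k s).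
Proof.
have := cross_le (gam k s - gam k t) (ell (b + t)); rewrite enorm_ell mulr1 -/(pdist _ _) pdistC.
apply: le_trans; rewrite crossDl crossNl !chart_cross cross_self mulr0 subr0 cross_ell.
by rewrite opprD addrACA subrr add0r.
Qed.

Section NearStraight.
Variables (e : R) (K : nat).
Hypotheses (e0 : 0 < e) (e4 : e <= 4^-1).
Hypothesis K1 : (1 <= K)%N.
Hypothesis HK : forall k d (s t : R), (K <= k)%N -> enorm d = 1 -> - a <= s -> s <= t -> t <= a ->
    (forall y, s < y < t -> ~ Z y /\ pdist (h y) d <= e) ->
    dot (gam k s) d <= dot (gam k t) d /\
    `|dot (gam k t) (rot90 d) - dot (gam k s) (rot90 d)| <=
      4 * e * (dot (gam k t) d - dot (gam k s) d).
Variables (k : nat) (d : plane R).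
Hypotheses (Kk : (K <= k)%N) (d1 : enorm d = 1).

Let k1 : (1 <= k)%N := leq_trans K1 Kk.

(** The slope is at most 1 since [4 e <= 1], so a chord is at most twice its projection. *)
Lemma arc_length (s t : R) : - a <= s -> s <= t -> t <= a ->
  (forall y, s < y < t -> ~ Z y /\ pdist (h y) d <= e) ->
  pdist (gam k t) (gam k s) <= 2 * (dot (gam k t) d - dot (gam k s) d).
Proof.
move=> sa st ta hd; have [g1 g2] := HK Kk d1 sa st ta hd.
apply: (le_trans (pdist_le_dot _ _ d1)); rewrite ger0_norm ?subr_ge0//.
have : 4 * e * (dot (gam k t) d - dot (gam k s) d) <= 1 * (dot (gam k t) d - dot (gam k s) d).
  by rewrite ler_wpM2r ?subr_ge0//; move: e4; lra.
lra.
Qed.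

Lemma arc_ivt (s t c : R) : - a <= s -> s <= t -> t <= a ->
  dot (gam k s) d <= c <= dot (gam k t) d ->
  exists2 y, s <= y <= t & dot (gam k y) d = c.
Proof.
move=> sa st ta /andP[c1 c2].
have := @IVT _ (fun y => dot (polar r y) d) (k%:R + b + s) (k%:R + b + t) c.
rewrite lerD2l => /(_ st (chart_continuous_dot HC k1 sa ta)) [].
  by rewrite ge_min le_max; apply/andP; split; apply/orP; [left|right].
move=> y; rewrite in_itv /= => /andP[y1 y2] yc; exists (y - (k%:R + b)).
  by apply/andP; split; lra.
by rewrite /coil addrC subrK.
Qed.

Lemma near_ray_right (s t S : R) : - a <= s -> s <= t -> t <= a ->
  (forall y, s < y < t -> ~ Z y /\ pdist (h y) d <= e) ->
  2 * S <= pdist (gam k t) (gam k s) ->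
  near_ray (gam k s) d (4 * e) S (gam k @` `[s, t]).
Proof.
move=> sa st ta hd lS.
have chord u v : s <= u -> u <= v -> v <= t -> dot (gam k u) d <= dot (gam k v) d /\
    `|dot (gam k v) (rot90 d) - dot (gam k u) (rot90 d)| <=
      4 * e * (dot (gam k v) d - dot (gam k u) d).
  move=> su uv vt; apply: HK => //; [lra|lra|].
  by move=> y /andP[y1 y2]; apply: hd; apply/andP; split; lra.
have aS := arc_length sa st ta hd.
split.
- by apply/h1measurable_closed/arc_closed.
- move=> _ [u /= + <-]; rewrite in_itv /= => /andP[u1 u2].
  by have [] := chord s u (lexx _) u1 u2.
- move=> _ _ [u /= + <-] [v /= + <-]; rewrite !in_itv /= => /andP[u1 u2] /andP[v1 v2].
  have [uv|/ltW vu] := leP u v.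
    have [h1 h2] := chord u v u1 uv v2.
    by rewrite distrC [X in _ <= _ * X]distrC [X in _ <= _ * X]ger0_norm ?subr_ge0.
  have [h1 h2] := chord v u v1 vu u2.
  by rewrite [X in _ <= _ * X]ger0_norm ?subr_ge0.
- move=> _ [u /= + <-]; rewrite in_itv /= => /andP[u1 u2].
  by have [] := chord s u (lexx _) u1 u2.
- move=> c /andP[c0 cS].
  have [|y y1 yc] := @arc_ivt s t (dot (gam k s) d + c) sa st ta.
  + by apply/andP; split; lra.
  + by exists (gam k y) => //; exists y => //=; rewrite in_itv.
Qed.

(** The arc is run backwards from its right end, which is left out because it is the base of the arc
    on the other side. *)
Lemma near_ray_left (s t S : R) : - a <= s -> s <= t -> t <= a ->
  (forall y, s < y < t -> ~ Z y /\ pdist (h y) d <= e) ->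
  2 * S <= pdist (gam k t) (gam k s) ->
  near_ray (gam k t) (- d) (4 * e) S (gam k @` `[s, t[).
Proof.
move=> sa st ta hd lS.
have chord u v : s <= u -> u <= v -> v <= t -> dot (gam k u) d <= dot (gam k v) d /\
    `|dot (gam k v) (rot90 d) - dot (gam k u) (rot90 d)| <=
      4 * e * (dot (gam k v) d - dot (gam k u) d).
  move=> su uv vt; apply: HK => //; [lra|lra|].
  by move=> y /andP[y1 y2]; apply: hd; apply/andP; split; lra.
have aS := arc_length sa st ta hd.
have dN u : dot u (- d) = - dot u d by rewrite dotC dotNl dotC.
have dN' u : dot u (rot90 (- d)) = - dot u (rot90 d) by rewrite /dot /=; ring.
split.
- exact: arc_co_measurable.
- move=> _ [u /= + <-]; rewrite in_itv /= => /andP[u1 u2]; rewrite !dN lerN2.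
  by have [] := chord u t u1 (ltW u2) (lexx _).
- move=> _ _ [u /= + <-] [v /= + <-]; rewrite !in_itv /= => /andP[u1 u2] /andP[v1 v2].
  rewrite !dN !dN' -!opprD !normrN.
  have [uv|/ltW vu] := leP u v.
    have [h1 h2] := chord u v u1 uv (ltW v2).
    by rewrite distrC [X in _ <= _ * X]distrC [X in _ <= _ * X]ger0_norm ?subr_ge0.
  have [h1 h2] := chord v u v1 vu (ltW u2).
  by rewrite [X in _ <= _ * X]ger0_norm ?subr_ge0.
- move=> _ [u /= + <-]; rewrite in_itv /= => /andP[u1 u2].
  have [_] := chord u t u1 (ltW u2) (lexx _).
  by rewrite !dN !dN' !opprK addrC (addrC _ (dot (gam k t) d)).
- move=> c /andP[c0 cS].
  have [|y /andP[y1 y2] yc] := @arc_ivt s t (dot (gam k t) d - c) sa st ta.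
  + by apply/andP; split; lra.
  + exists (gam k y); last by rewrite !dN yc; ring.
    exists y => //=; rewrite in_itv /= y1 /= lt_neqAle y2 andbT.
    by apply/eqP => yt; move: yc; rewrite yt; lra.
Qed.

End NearStraight.
End Arcs.

Section Turns.
Context {R : realType}.
Implicit Types (x y t : R).

Lemma sin_turn_gt0 x : 0 < x <= 4^-1 -> 0 < sin (2 * pi * x).
Proof.
move=> /andP[x0 x4]; have p0 := pi_gt0 R; apply: sin_gt0_pi.
have : pi * x <= pi * 4^-1 by rewrite ler_pM2l.
have : 0 < pi * x by rewrite mulr_gt0.
move=> h1 h2; rewrite -mulrA; apply/andP; split; lra.
Qed.

Lemma sin_turn_ge0 x : 0 <= x <= 4^-1 -> 0 <= sin (2 * pi * x).
Proof.
move=> /andP[]; rewrite le_eqVlt => /orP[/eqP <- _|x0 x4]; first by rewrite mulr0 sin0.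
by apply/ltW/sin_turn_gt0; rewrite x0.
Qed.

Lemma sin_turn_le0 x : - 4^-1 <= x <= 0 -> sin (2 * pi * x) <= 0.
Proof.
move=> /andP[x1 x2]; rewrite -oppr_ge0 -sinN -mulrN; apply: sin_turn_ge0.
by apply/andP; split; lra.
Qed.

Lemma sin_turn_eq0 x : - 4^-1 <= x <= 4^-1 -> sin (2 * pi * x) = 0 -> x = 0.
Proof.
move=> /andP[x1 x2] sx; apply/eqP; apply: contra_eqT sx => /lt_total/orP[x0|x0].
  have : 0 < sin (2 * pi * - x) by apply: sin_turn_gt0; apply/andP; split; lra.
  by rewrite mulrN sinN oppr_gt0 lt_neqAle => /andP[].
have : 0 < sin (2 * pi * x) by apply: sin_turn_gt0; rewrite x0.
by rewrite lt_neqAle eq_sym => /andP[].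
Qed.

Lemma continuous_ell : continuous (ell : R -> plane R).
Proof.
move=> t; have c1 : continuous (fun t : R => 2 * pi * t).
  by move=> y; apply: cvgM; [exact: cvg_cst|exact: cvg_id].
apply: (@cvg_pair _ _ _ _ (nbhs (cos (2 * pi * t))) (nbhs (sin (2 * pi * t)))).
  by apply: (@continuous_comp _ _ _ (fun t : R => 2 * pi * t) cos); [exact: c1|exact: continuous_cos].
by apply: (@continuous_comp _ _ _ (fun t : R => 2 * pi * t) sin); [exact: c1|exact: continuous_sin].
Qed.

(* The intermediate value theorem for [cross (ell t) x] finds the ray through [x]. *)
Lemma between_rays (s t : R) (x : plane R) : s <= t -> t <= s + 4^-1 ->
  0 < cross (ell s) x -> 0 < cross x (ell t) ->
  exists rx u : R, [/\ 0 < rx, s <= u <= t & x = rx *: ell u].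
Proof.
move=> st ts s0 t0.
have cc : continuous (fun y : R => cross (ell y) x).
  move=> y; apply: (@continuous_comp _ _ _ ell (fun z : plane R => cross z x)).
    exact: continuous_ell.
  exact: continuous_crossl.
have := @IVT _ (fun y => cross (ell y) x) s t 0 st (continuous_subspaceT cc).
rewrite (crossC (ell t)) => /(_ _)[].
  by rewrite ge_min le_max; apply/andP; split; apply/orP; [right|left]; lra.
move=> u; rewrite in_itv /= => /andP[su ut] u0.
have xE : x = dot x (ell u) *: ell u.
  rewrite {1}(unit_decomp x (enorm_ell u)) (_ : dot x (rot90 _) = 0) ?scale0r ?addr0//.
  by rewrite dotC -crossE.
exists (dot x (ell u)), u; split => //; last by rewrite su.
rewrite ltNge; apply/negP => d0.
have : dot x (ell u) * sin (2 * pi * (u - s)) <= 0.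
  by rewrite mulr_le0_ge0// sin_turn_ge0//; apply/andP; split; lra.
rewrite -cross_ell crossC mulrN -crossZl -xE -crossC => h; move: s0.
by rewrite ltNge h.
Qed.

End Turns.

(** * Weak limits at an angle *)

Section TurnIndex.
Implicit Types (K J k : nat) (j l : int).

(** Meant for [|j| <= J < k], where [k + j] is positive and [absz] merely returns it as a natural
    number. *)
Definition shift_turn k j : nat := absz (k%:Z + j).

Lemma shift_turn_gt K J k j : (K + J < k)%N -> (`|j| <= J)%N -> (K < shift_turn k j)%N.
Proof. by rewrite /shift_turn; lia. Qed.

Lemma shift_turnE K J k j : (K + J < k)%N -> (`|j| <= J)%N ->
  (shift_turn k j)%:Z = k%:Z + j.
Proof. by rewrite /shift_turn; lia. Qed.

Lemma shift_turn_inj K J k j l : (K + J < k)%N -> (`|j| <= J)%N -> (`|l| <= J)%N ->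
  shift_turn k j = shift_turn k l -> j = l.
Proof. by rewrite /shift_turn; lia. Qed.

Lemma shift_turnK k k' : shift_turn k (k'%:Z - k%:Z) = k'.
Proof. by rewrite /shift_turn; lia. Qed.

End TurnIndex.

Section Window.
Context {R : realType}.
Variables (G : set (plane R)) (b a : R) (r eta rho : R -> R) (h : R -> plane R).
Variable Z : set R.
Hypothesis HC : chart G b a r eta rho h Z.
Local Notation gam := (coil r b).

Lemma turn_range (s t : R) : - a <= s <= a -> - a <= t <= a -> - 4^-1 <= t - s <= 4^-1.
Proof.
have := chart_le HC; have e8 : (8^-1 : R) + 8^-1 = 4^-1 by lra.
by move=> a8 /andP[s1 s2] /andP[t1 t2]; apply/andP; split; lra.
Qed.

Definition increasing_from (K : nat) : Prop := forall t, - a <= t <= a ->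
  forall k, (K <= k)%N -> r (k%:R + b + t) < r (k.+1%:R + b + t).

Lemma increasing_from_lt K k k' t : increasing_from K -> - a <= t <= a ->
  (K <= k)%N -> (k < k')%N -> r (k%:R + b + t) < r (k'%:R + b + t).
Proof.
move=> HK ta Kk; elim: k' => // k' IH; rewrite ltnS leq_eqVlt => /orP[/eqP <-|kk'].
  exact: HK.
by apply: (lt_trans (IH kk')); apply: HK => //; lia.
Qed.

Lemma radius_gt0 K k t : (1 <= K)%N -> increasing_from K -> - a <= t <= a ->
  (K < k)%N -> 0 < r (k%:R + b + t).
Proof.
move=> K1 HK ta Kk; apply: le_lt_trans (increasing_from_lt HK ta (leqnn K) Kk).
exact: (chart_ge0 HC).
Qed.

(** The cross product of the two rays is the sine of their angle, and an aperture spans at most a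
    quarter turn, where the sine vanishes only at 0. *)
Lemma ray_coil_inj k (c s t : R) : - a <= s <= a -> - a <= t <= a ->
  0 < r (k%:R + b + t) -> c *: ell (b + s) = gam k t -> s = t.
Proof.
move=> sa ta rt E; have := chart_cross b r k t (ell (b + s)).
rewrite -E crossZl cross_self mulr0 cross_ell => /esym/eqP.
rewrite mulf_eq0 gt_eqF//= opprD addrACA subrr add0r => /eqP s0.
apply/eqP; rewrite -subr_eq0; apply/eqP; apply: sin_turn_eq0 s0.
exact: turn_range.
Qed.

(** The angle is recovered by [ray_coil_inj], then the turn from the strictly increasing radii on
    that ray. *)
Lemma coil_inj K k k' (s t : R) : (1 <= K)%N -> increasing_from K ->
  - a <= s <= a -> - a <= t <= a -> (K < k)%N -> (K < k')%N ->
  gam k s = gam k' t -> s = t /\ k = k'.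
Proof.
move=> K1 HK sa ta Kk Kk' E.
have st := ray_coil_inj sa ta (radius_gt0 K1 HK ta Kk') (etrans (esym (coilE r b k s)) E); split => //; subst t.
have rE : r (k%:R + b + s) = r (k'%:R + b + s).
  have := congr1 (fun x => enorm x) E; rewrite !coilE !enormZ !enorm_ell !mulr1.
  by rewrite !ger0_norm// ltW// (radius_gt0 K1 HK).
case: (ltngtP k k') => // kk'; exfalso; move: rE; apply/eqP.
  by rewrite lt_eqF// (increasing_from_lt HK ta (ltnW Kk)).
by rewrite gt_eqF// (increasing_from_lt HK ta (ltnW Kk')).
Qed.

Section Core.
(** Numerical data for one translate. The point [p], on turn [k0] at the angle [th], is moved to the
    origin; the window of angles is [[al, be]], with [dm] and [dp] approximating the headings on its
    two halves. [kap] measures transversality to the ray, [J] counts the turns on either side that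
    can reach the disk, and turns up to [K] have radius at most [B]. In [chart_weak_cvg] all these
    hypotheses are met eventually along the filter. *)
Variables (dm dp : plane R) (M eps S kap e B th al be : R) (J K k0 : nat).
Local Notation R0 := (r (k0%:R + b + th)).
Local Notation eta0 := (eta 0).
Local Notation p := (gam k0 th).
Hypotheses (dm1 : enorm dm = 1) (dp1 : enorm dp = 1).
Hypotheses (M0 : 0 < M) (e0 : 0 < e) (e4 : e <= 4^-1) (eeps : 4 * e <= eps).
Hypotheses (kap0 : 0 < kap) (kap1 : kap <= 1) (ekap : 16 * e <= kap).
Hypotheses (kapm : kap / 2 <= `|cross (ell (b + th)) dm|)
           (kapp : kap / 2 <= `|cross (ell (b + th)) dp|).
Hypothesis K1 : (1 <= K)%N.
Hypothesis HK : forall k d (s t : R), (K <= k)%N -> enorm d = 1 -> - a <= s -> s <= t -> t <= a ->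
    (forall y, s < y < t -> ~ Z y /\ pdist (h y) d <= e) ->
    dot (gam k s) d <= dot (gam k t) d /\
    `|dot (gam k t) (rot90 d) - dot (gam k s) (rot90 d)| <=
      4 * e * (dot (gam k t) d - dot (gam k s) d).
Hypothesis Kinc : increasing_from K.
Hypothesis Ksp : forall k k' t, (K <= k)%N -> (K <= k')%N -> - a <= t <= a ->
  `|r (k'%:R + b + t) - r (k%:R + b + t) - eta t * (k'%:R - k%:R)| <= e.
Hypothesis KB : forall k t, (1 <= k)%N -> (k <= K)%N -> - a <= t <= a ->
  r (k%:R + b + t) <= B.
Hypotheses (KJ : (K + J < k0)%N) (BR0 : B + M < R0).
Hypotheses (ala : - a <= al) (alth : al <= th) (thbe : th <= be) (bea : be <= a).
Hypothesis hal : forall y, al < y < th -> ~ Z y /\ pdist (h y) dm <= e.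
Hypothesis hbe : forall y, th < y < be -> ~ Z y /\ pdist (h y) dp <= e.
Hypotheses (eta_gt0 : 0 < eta0) (eta_lo : eta0 / 2 <= eta th) (eta_hi : eta th <= 2 * eta0).
Hypothesis eta_close : `|eta th - eta0| * J%:R <= eps / 4.
Hypothesis ell_close : J%:R * eta0 * pdist (ell (b + th)) (ell b) <= eps / 4.
Hypothesis JM : 8 * M / kap + 4 <= J%:R * eta0.
Hypotheses (Mbe : M < R0 * sin (2 * pi * (be - th)))
           (Mal : M < R0 * sin (2 * pi * (th - al))).
Hypotheses
  (Sbe : 2 * S + (2 * J%:R * eta0 + 1) <= R0 * sin (2 * pi * (be - th)))
  (Sal : 2 * S + (2 * J%:R * eta0 + 1) <= R0 * sin (2 * pi * (th - al))).

Local Notation kk := (shift_turn k0).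
(** Empty beyond [J], because the pieces of a fan are measurable at every index. *)
Let C (i : int * bool) : set (plane R) := if (`|i.1| <= J)%N then
  translate (- p) (if i.2 then gam (kk i.1) @` `[th, be] else gam (kk i.1) @` `[al, th[)
  else set0.
Let q (i : int * bool) : plane R := gam (kk i.1) th - p.

Let tha : - a <= th <= a.
Proof. by apply/andP; split; [exact: le_trans alth|exact: le_trans bea]. Qed.

Let R0_gt0 : 0 < R0.
Proof. exact: (radius_gt0 K1 Kinc tha (leq_ltn_trans (leq_addr J K) KJ)). Qed.

Let kkK (j : int) : (`|j| <= J)%N -> (K < kk j)%N.
Proof. exact: shift_turn_gt KJ. Qed.

Let kkE (j : int) : (`|j| <= J)%N -> (kk j)%:R = k0%:R + j%:~R :> R.
Proof.
move=> jJ; rewrite -[(kk j)%:R]/((kk j)%:Z%:~R) -[k0%:R]/(k0%:Z%:~R) -intrD.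
by rewrite (shift_turnE KJ jJ).
Qed.

Let radius_kk (j : int) : (`|j| <= J)%N ->
  `|r ((kk j)%:R + b + th) - R0 - eta th * j%:~R| <= e.
Proof.
move=> jJ; have Kk0 : (K <= k0)%N := ltnW (leq_ltn_trans (leq_addr J K) KJ).
have := Ksp Kk0 (ltnW (kkK jJ)) tha.
by rewrite (kkE jJ) (addrAC k0%:R) [k0%:R + _ - _]addrAC subrr add0r.
Qed.

Let jR (j : int) : (`|j| <= J)%N -> `|j%:~R| <= J%:R :> R.
Proof. by move=> jJ; rewrite -intr_norm -[J%:R]/(J%:Z%:~R) ler_int. Qed.

Let radius_kk_lo (j : int) : (`|j| <= J)%N ->
  R0 - (2 * J%:R * eta0 + 1) <= r ((kk j)%:R + b + th).
Proof.
move=> jJ; have := radius_kk jJ; have := jR jJ.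
rewrite !ler_norml => /andP[j1 j2] /andP[r1 r2].
have : eta th * - J%:R <= eta th * j%:~R by rewrite ler_pM2l//; move: eta_lo eta_gt0; lra.
have : eta th * J%:R <= 2 * eta0 * J%:R by rewrite ler_wpM2r.
move: e4; lra.
Qed.

(** [R0 |sin _|] is the distance of [p] from the ray at [t]. The turn shifted by [j] has a radius
    smaller by at most [2 J eta0 + 1], a loss that [Sbe] and [Sal] provide for. *)
Let far (j : int) (t : R) : (`|j| <= J)%N -> - a <= t <= a ->
  2 * S + (2 * J%:R * eta0 + 1) <= R0 * `|sin (2 * pi * (t - th))| ->
  2 * S <= pdist (gam (kk j) t) (gam (kk j) th).
Proof.
move=> jJ ta hS; apply: le_trans (coil_dist_ray b r _ _ _).
rewrite normrM (gtr0_norm (radius_gt0 K1 Kinc tha (kkK jJ))).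
set s := `|_| in hS *.
have s1 : s <= 1 by rewrite ler_norml sin_geN1 sin_le1.
have s0 : 0 <= s by exact: normr_ge0.
have : (R0 - (2 * J%:R * eta0 + 1)) * s <= r ((kk j)%:R + b + th) * s.
  by rewrite ler_wpM2r//; exact: radius_kk_lo.
have : (2 * J%:R * eta0 + 1) * s <= 2 * J%:R * eta0 + 1.
  by rewrite ler_piMr// addr_ge0// !mulr_ge0// ltW.
lra.
Qed.

Let far_right (j : int) : (`|j| <= J)%N ->
  2 * S <= pdist (gam (kk j) be) (gam (kk j) th).
Proof.
move=> jJ; apply: far => //.
- by apply/andP; split => //; move: ala alth thbe; lra.
- by apply: (le_trans Sbe); rewrite ler_pM2l// ler_norm.
Qed.

Let far_left (j : int) : (`|j| <= J)%N ->
  2 * S <= pdist (gam (kk j) th) (gam (kk j) al).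
Proof.
move=> jJ; rewrite pdistC; apply: far => //.
- by apply/andP; split => //; move: bea alth thbe; lra.
- apply: (le_trans Sal); rewrite ler_pM2l// -[al - th]opprB mulrN sinN normrN.
  exact: ler_norm.
Qed.

Lemma window_measurable i : h1measurable (C i).
Proof.
rewrite /C; case: ifPn => [iJ|_]; last exact: h1measurable0.
have k1 : (1 <= kk i.1)%N := leq_trans K1 (ltnW (kkK iJ)).
have /andP[t1 t2] := tha.
apply: h1measurable_translate; case: ifP => _.
  by apply/h1measurable_closed/(arc_closed HC).
exact: (arc_co_measurable HC).
Qed.

Lemma window_elt i x : C i x -> (`|i.1| <= J)%N /\ exists t,
  [/\ al <= t <= be, (if i.2 then th <= t else t < th) & x = - p + gam (kk i.1) t].
Proof.
rewrite /C; case: ifPn => // iJ; split => //; move: H => [y + <-].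
case: ifP => i2 [t /=]; rewrite in_itv /= => /andP[t1 t2] <-; exists t; split => //.
  by rewrite (le_trans alth t1).
by rewrite t1 (le_trans (ltW t2) thbe).
Qed.

Lemma window_trivIset : trivIset [set` fan_index J] C.
Proof.
apply/trivIsetP => i j _ _ ij; apply/seteqP; split => // x [/window_elt[iJ [t [ti i2 xt]]]].
move=> /window_elt[jJ [u [ui j2]]]; rewrite xt => /addrI E.
have sub y : al <= y <= be -> - a <= y <= a.
  by move=> /andP[y1 y2]; rewrite (le_trans ala y1) (le_trans y2 bea).
have [tu kE] := coil_inj K1 Kinc (sub _ ti) (sub _ ui) (kkK iJ) (kkK jJ) E.
move/eqP: ij; apply; move: kE; case: i j iJ jJ i2 j2 {xt E} => [k x1] [l x2] /= kJ lJ i2 j2 kE.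
congr (_, _); first exact: shift_turn_inj KJ kJ lJ kE.
by move: i2 j2; rewrite tu; case: x1; case: x2 => //; [rewrite ltNge => ->|rewrite ltNge => /negP].
Qed.

Lemma window_sub i : C i `<=` translate (- p) G.
Proof.
move=> x /window_elt[iJ [t [/andP[t1 t2] _ ->]]]; exists (gam (kk i.1) t) => //.
apply: (chart_in HC); first exact: leq_trans K1 (ltnW (kkK iJ)).
by rewrite (le_trans ala t1) (le_trans t2 bea).
Qed.

Lemma window_near_ray i : i \in fan_index J ->
  near_ray (q i) (fan_direction dm dp i) eps S (C i).
Proof.
rewrite mem_fan_index => iJ; rewrite /C iJ /q.
have [mC C0 Cs Cb Cl] : near_ray (gam (kk i.1) th) (fan_direction dm dp i) (4 * e) S
  (if i.2 then gam (kk i.1) @` `[th, be] else gam (kk i.1) @` `[al, th[).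
  rewrite /fan_direction; have /andP[t1 t2] := tha; case: ifP => _.
    apply: (near_ray_right HC e4 K1 HK) => //; [exact: ltnW (kkK iJ)|exact: far_right].
  by apply: (near_ray_left HC e4 K1 HK) => //; [exact: ltnW (kkK iJ)|exact: far_left].
apply: near_ray_translate; split => //.
- by move=> x y Cx Cy; apply: (le_trans (Cs x y Cx Cy)); rewrite ler_wpM2r.
- move=> x Cx; apply: (le_trans (Cb x Cx)); rewrite ler_wpM2r// subr_ge0; exact: C0.
Qed.

(** Three errors, each at most [eps / 4]: equispacing on the ray at [th], the change of the spacing
    between [th] and 0, and the rotation of the ray from [b + th] to [b]. *)
Lemma window_base i : i \in fan_index J ->
  pdist (q i) (fan_base_point (eta0 *: ell b) i) <= eps.
Proof.
rewrite mem_fan_index /q /fan_base_point => iJ; rewrite !coilE -scalerBl scalerA.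
set j : R := i.1%:~R.
apply: (le_trans (pdist_triangle ((j * eta0) *: ell (b + th)) _ _)).
have -> : pdist ((r ((kk i.1)%:R + b + th) - R0) *: ell (b + th)) ((j * eta0) *: ell (b + th))
    = `|r ((kk i.1)%:R + b + th) - R0 - j * eta0|.
  by rewrite /pdist -scalerBl enormZ enorm_ell mulr1.
have -> : pdist ((j * eta0) *: ell (b + th)) ((j * eta0) *: ell b) =
    `|j| * eta0 * pdist (ell (b + th)) (ell b).
  by rewrite /pdist -scalerBr enormZ normrM (gtr0_norm eta_gt0).
have h1 := radius_kk iJ; have j1 := jR iJ; rewrite -/j in h1 j1.
have h2 : `|(eta th - eta0) * j| <= eps / 4.
  by apply: le_trans eta_close; rewrite normrM ler_wpM2l.
have h3 : `|j| * eta0 * pdist (ell (b + th)) (ell b) <= eps / 4.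
  apply: le_trans ell_close; rewrite ler_wpM2r ?pdist_ge0//.
  by rewrite ler_wpM2r// ltW.
have h4 : `|r ((kk i.1)%:R + b + th) - R0 - j * eta0| <= e + eps / 4.
  have -> : r ((kk i.1)%:R + b + th) - R0 - j * eta0 =
    (r ((kk i.1)%:R + b + th) - R0 - eta th * j) + (eta th - eta0) * j by ring.
  by apply: (le_trans (ler_normD _ _)); exact: lerD.
move: eeps e0; lra.
Qed.

(* The turn through a point of the window crosses the ray at the angle [th] at a
   bounded distance from [p], because its direction is transversal to the ray. *)
Lemma window_index (k : nat) (d u : plane R) (s c : R) : (K <= k)%N -> enorm d = 1 ->
  kap / 2 <= `|cross (ell (b + th)) d| -> enorm u <= M ->
  u = (r (k%:R + b + th) - R0) *: ell (b + th) + s *: d + c *: rot90 d ->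
  0 <= s -> `|c| <= 4 * e * s ->
  exists2 j : int, (`|j| <= J)%N & k = kk j.
Proof.
move=> Kk d1 kd uM uE s0 cs; set w := cross _ d in kd.
set z := _ - R0 in uE.
have e1 := enorm_ell (b + th).
(* Cross products with the ray and with [d] eliminate one unknown each: the first relation bounds
   [s], the second then bounds the displacement [z] along the ray. *)
have h1 : cross (ell (b + th)) u = s * w + c * dot (ell (b + th)) d.
  rewrite uE /w /cross /dot /=; rewrite /GRing.scale /=; ring.
have h2 : cross u d = z * w - c * dot d d.
  by rewrite uE /w /cross /dot /= /GRing.scale /=; ring.
rewrite dot_unit// mulr1 in h2.
have u1 := cross_le (ell (b + th)) u; rewrite e1 mul1r in u1.
have u2 := cross_le u d; rewrite d1 mulr1 in u2.
have ld := dot_le (ell (b + th)) d; rewrite e1 d1 mulr1 in ld.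
have sw : s * `|w| <= M + 4 * e * s.
  have -> : s * `|w| = `|s * w| by rewrite normrM (ger0_norm s0).
  have -> : s * w = cross (ell (b + th)) u - c * dot (ell (b + th)) d by rewrite h1; ring.
  apply: (le_trans (ler_normB _ _)); apply: lerD; first exact: le_trans uM.
  rewrite normrM; apply: le_trans cs; rewrite ler_piMr//.
have zw : `|z| * `|w| <= M + 4 * e * s.
  rewrite -normrM; have -> : z * w = cross u d + c by rewrite h2; ring.
  by apply: (le_trans (ler_normD _ _)); apply: lerD => //; exact: le_trans uM.
have es : 4 * e * s <= kap / 4 * s by rewrite ler_wpM2r//; move: ekap; lra.
have sk : s * (kap / 2) <= s * `|w| by rewrite ler_wpM2l.
have sM : kap / 4 * s <= M by lra.
have zk : `|z| * (kap / 2) <= 2 * M.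
  have : `|z| * (kap / 2) <= `|z| * `|w| by rewrite ler_wpM2l.
  lra.
have zM : `|z| <= 4 * M / kap by rewrite ler_pdivlMr//; lra.
have Kk0 : (K <= k0)%N := ltnW (leq_ltn_trans (leq_addr J K) KJ).
exists (k%:Z - k0%:Z); last by rewrite shift_turnK.
have := Ksp Kk0 Kk tha; rewrite -/z => hz.
have : eta th * `|k%:R - k0%:R| <= 4 * M / kap + 1.
  have eth : 0 <= eta th by move: eta_lo eta_gt0; lra.
  have -> : eta th * `|k%:R - k0%:R| = `|z - (z - eta th * (k%:R - k0%:R))|.
    by rewrite opprB addrCA subrr addr0 normrM (ger0_norm eth).
  apply: (le_trans (ler_normB _ _)); apply: lerD => //; move: e4 hz; lra.
(* Doubling [4 M / kap + 1] through [eta_lo] stays below the bound [8 M / kap + 4] of [JM]. *)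
have : eta0 / 2 * `|k%:R - k0%:R| <= eta th * `|k%:R - k0%:R| by rewrite ler_wpM2r.
move=> h3 h4; have h5 : `|k%:R - k0%:R| * eta0 <= J%:R * eta0 by move: JM h3 h4; lra.
rewrite ler_pM2r// in h5.
have : (`|k%:Z - k0%:Z|%:~R : R) <= J%:R by rewrite intr_norm intrB.
by rewrite -[J%:R]/(J%:Z%:~R) ler_int.
Qed.

(** A point of the disk, moved back by [p], lies strictly between the rays at [al] and [be], because
    these are farther than [M] from [p]. It thus lies on some turn, a late one since its radius
    exceeds [B], and [window_index] finds that turn among the [J] neighbours. *)
Lemma window_cover : translate (- p) G `&` cdisk M `<=` \bigcup_(i in [set` fan_index J]) C i.
Proof.
move=> x [/translateE]; rewrite opprK => Gy xM; rewrite /cdisk /= in xM.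
set y := x + p in Gy.
have pE : p = R0 *: ell (b + th) by rewrite coilE.
have yp : y - p = x by rewrite /y addrK.
have cross_bound d : enorm d = 1 -> `|cross d x| <= M /\ `|cross x d| <= M.
  move=> d1; split; first by apply: le_trans xM; have := cross_le d x; rewrite d1 mul1r.
  by apply: le_trans xM; have := cross_le x d; rewrite d1 mulr1.
have yE : y = x + p by [].
have ca : 0 < cross (ell (b + al)) y.
  have [+ _] := cross_bound (ell (b + al)) (enorm_ell _); rewrite ler_norml => /andP[c1 _].
  rewrite yE crossC crossDl opprD -!crossC pE (crossC _ (_ *: _)) crossZl -mulrN -crossC cross_ell.
  rewrite opprD addrACA subrr add0r; move: Mal; lra.
have cb : 0 < cross y (ell (b + be)).
  have [_] := cross_bound (ell (b + be)) (enorm_ell _); rewrite ler_norml => /andP[c1 _].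
  rewrite yE crossDl pE crossZl cross_ell.
  rewrite opprD addrACA subrr add0r; move: Mbe; lra.
have aa : - a <= al <= a by move: ala alth thbe bea; lra.
have ba : - a <= be <= a by move: ala alth thbe bea; lra.
have /andP[_ be4] := turn_range aa ba.
have [||rx [u [rx0 /andP[u1 u2] yu]]] := between_rays _ _ ca cb.
- by rewrite lerD2l (le_trans alth thbe).
- by rewrite -addrA lerD2l addrC -lerBlDr.
have [||k [t [k1 ta yk]]] := chart_out HC Gy (ltW rx0) (t := u - b).
- by apply/andP; split; move: ala bea; lra.
- by rewrite addrC subrK.
have rE : r (k%:R + b + t) = rx.
  have := congr1 (fun z => enorm z) yk.
  rewrite yu coilE !enormZ !enorm_ell !mulr1 gtr0_norm// ger0_norm//.
  exact: (chart_ge0 HC).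
have Kk : (K < k)%N.
  rewrite ltnNge; apply/negP => kK; have := KB k1 kK ta; rewrite rE => rB.
  have : enorm y <= B by rewrite yu enormZ enorm_ell mulr1 gtr0_norm.
  have : enorm p = R0 by rewrite pE enormZ enorm_ell mulr1 gtr0_norm.
  have := enormB y x; rewrite yE addrC addKr -yE => h1 h2 h3.
  by move: BR0; lra.
have rt0 : 0 < r (k%:R + b + t) by rewrite rE.
(* [chart_out] only places [t] in the whole aperture; the signs of the two cross products confine it
   to the window. *)
have t1 : al < t.
  rewrite ltNge; apply/negP => tal; move: ca; rewrite ltNge => /negP; apply.
  rewrite yk crossC chart_cross -mulrN -crossC cross_ell opprD addrACA subrr add0r.
  rewrite mulr_ge0_le0// ?sin_turn_le0//; first exact: ltW.
  by have /andP[h1 h2] := turn_range aa ta; apply/andP; split => //; lra.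
have t2 : t < be.
  rewrite ltNge; apply/negP => bet; move: cb; rewrite ltNge => /negP; apply.
  rewrite yk chart_cross cross_ell opprD addrACA subrr add0r.
  rewrite mulr_ge0_le0// ?sin_turn_le0//; first exact: ltW.
  by have /andP[h1 h2] := turn_range ta ba; apply/andP; split => //; lra.
have /andP[th1 th2] := tha.
have xE : x = gam k t - p by rewrite -yk addrK.
have conc (j : int) (o : bool) : (`|j| <= J)%N -> k = kk j ->
    (if o then th <= t else t < th) -> (\bigcup_(i in [set` fan_index J]) C i) x.
  move=> jJ kj ot; exists (j, o); first by rewrite /= mem_fan_index.
  rewrite /C /= jJ; apply/translateE; rewrite opprK -/y yk kj.
  by case: o ot => ot; exists t => //=; rewrite in_itv /= ot ltW.
have baseE : gam k th - p = (r (k%:R + b + th) - R0) *: ell (b + th).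
  by rewrite !coilE -scalerBl.
(* The displacement is the one from [p] to the crossing of turn [k] with the ray at [th], followed
   by a chord expanded in the frame of [d]. *)
have diffE (d : plane R) : enorm d = 1 -> x = (r (k%:R + b + th) - R0) *: ell (b + th) +
    (dot (gam k t) d - dot (gam k th) d) *: d +
    (dot (gam k t) (rot90 d) - dot (gam k th) (rot90 d)) *: rot90 d.
  move=> d1; rewrite -baseE -addrA -!dotBl -unit_decomp// xE.
  by rewrite addrC addrA subrK.
have [tht|tth] := leP th t.
  have [|g1 g2] := HK (ltnW Kk) dp1 th1 tht (ltW (lt_le_trans t2 bea)).
    by move=> y0 /andP[y1 y2]; apply: hbe; rewrite y1 (lt_trans y2).
  have [|j jJ kj] := window_index (ltnW Kk) dp1 kapp xM (diffE _ dp1) _ g2.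
    by rewrite subr_ge0.
  exact: (conc j true jJ kj tht).
(* To the left of [th] the chord is run backwards from the ray, in the direction [- dm]. *)
have dmN : enorm (- dm) = 1 by rewrite enormN.
have kapN : kap / 2 <= `|cross (ell (b + th)) (- dm)|.
  by rewrite crossC crossNl opprK crossC normrN.
have [|g1 g2] := HK (ltnW Kk) dm1 (le_trans ala (ltW t1)) (ltW tth) th2.
  by move=> y0 /andP[y1 y2]; apply: hal; rewrite (lt_trans t1 y1) y2.
have dN u' : dot u' (- dm) = - dot u' dm by rewrite dotC dotNl dotC.
have dN' u' : dot u' (rot90 (- dm)) = - dot u' (rot90 dm) by rewrite /dot /=; ring.
have [||j jJ kj] := window_index (ltnW Kk) dmN kapN xM (diffE _ dmN).
- by rewrite !dN opprK addrC subr_ge0.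
- by rewrite !dN' !dN !opprK addrC (addrC _ (dot (gam k th) dm)).
exact: (conc j false jJ kj tth).
Qed.

Lemma window_fan : h1measurable G ->
  fan (fan_index J) (fan_base_point (eta0 *: ell b)) (fan_direction dm dp) M eps S
    (translate (- p) G).
Proof.
move=> mG; split; first exact: h1measurable_translate.
exists C, q; split.
- exact: window_measurable.
- exact: window_trivIset.
- by move=> i _; exact: window_sub.
- exact: window_cover.
- exact: window_near_ray.
- exact: window_base.
Qed.

End Core.
End Window.

Section ChartLimits.
Context {R : realType} {T : Type}.
Variables (G : set (plane R)) (b a : R) (r eta rho : R -> R) (h : R -> plane R).
Variable Z : set R.
Hypothesis HC : chart G b a r eta rho h Z.
Local Notation gam := (coil r b).
Variables (F : set_system T).
Context {FF : ProperFilter F}.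
Variables (kn : T -> nat) (th : T -> R).
Hypothesis kn_oo : forall K, \forall n \near F, (K <= kn n)%N.
Hypothesis th0 : th n @[n --> F] --> (0 : R).

Let rn n := r ((kn n)%:R + b + th n).

Lemma within_continuous_at0 (f : R -> R) : {within `[- a, a], continuous f} ->
  f (th n) @[n --> F] --> f 0.
Proof.
move=> cf; have a0 := chart_gt0 HC.
have aa : - a < a by lra.
have [cf' _ _] := (continuous_within_itvP f aa).1 cf.
apply: (cvg_comp _ _ th0 (cf' 0 _)).
by rewrite in_itv /= oppr_lt0 a0.
Qed.

Lemma th_range : \forall n \near F, - a < th n < a.
Proof.
have a0 := chart_gt0 HC; have /cvgr_dist_lt/(_ _ a0) := th0.
by apply: filterS => n; rewrite sub0r normrN ltr_norml.
Qed.

Lemma radius_cvg_pinfty (A : R) : \forall n \near F, A <= rn n.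
Proof.
have a0 := chart_gt0 HC.
have a00 : - a <= 0 <= a by apply/andP; split; lra.
have eta0 := chart_spacing_gt0 HC a00.
have ceta := within_continuous_at0 (chart_spacing_cont HC).
have crho := within_continuous_at0 (chart_offset_cont HC).
have [K K1 HK] := chart_equispacing HC ltr01.
pose N := (Num.trunc ((A + 2 - rho 0) / (eta 0 / 2))).+1.
have NA : A + 2 - rho 0 <= eta 0 / 2 * N%:R.
  by rewrite mulrC -ler_pdivrMr ?divr_gt0// ltW// truncnS_gt.
near=> n.
have tn : - a <= th n <= a.
  by have /andP[h1 h2] : - a < th n < a; [near: n; exact: th_range|rewrite !ltW].
have kK : (K <= kn n)%N by near: n; exact: kn_oo.
have kN : (N <= kn n)%N by near: n; exact: kn_oo.
have e1 : eta 0 / 2 < eta (th n).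
  by near: n; move/cvgr_gt: ceta; apply; lra.
have r1 : rho 0 - 1 < rho (th n).
  by near: n; move/cvgr_gt: crho; apply; lra.
have := HK (kn n) (th n) kK tn; rewrite ler_norml => /andP[h1 _].
have : eta 0 / 2 * N%:R <= eta (th n) * (kn n)%:R.
  apply: ler_pM; rewrite ?ler_nat//; last exact: ltW.
  by rewrite divr_ge0// ltW.
rewrite /rn; lra.
Unshelve. all: by end_near. Qed.

(** Seen from the moving point, the arc to its right has direction [d]: headings stay close to [d]
    up to the angle [be n], and the ray there recedes to infinity, its distance from the point being
    the radius times the sine. The window may shrink to nothing if it does so slowly compared with
    the radius. *)
Definition approach_right (d : plane R) : Prop := forall e : R, 0 < e ->
  exists be : T -> R,
    (\forall n \near F, [/\ th n <= be n, be n <= a &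
      forall y, th n < y < be n -> ~ Z y /\ pdist (h y) d <= e]) /\
    (forall A, \forall n \near F, A <= rn n * sin (2 * pi * (be n - th n))).

Definition approach_left (d : plane R) : Prop := forall e : R, 0 < e ->
  exists al : T -> R,
    (\forall n \near F, [/\ - a <= al n, al n <= th n &
      forall y, al n < y < th n -> ~ Z y /\ pdist (h y) d <= e]) /\
    (forall A, \forall n \near F, A <= rn n * sin (2 * pi * (th n - al n))).

(** For a fixed disk and precision the hypotheses of [window_fan] hold eventually: spacing and ray
    converge, the radius tends to infinity, and the windows come from the two approaches. *)
Lemma chart_weak_cvg dm dp : h1measurable G ->
  enorm dm = 1 -> enorm dp = 1 -> 0 < cross (ell b) dm -> 0 < cross (ell b) dp ->
  approach_left dm -> approach_right dp ->
  weak_cvg F (fun n => translate (- gam (kn n) (th n)) G)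
    (edges (eta 0 *: ell b) dm dp).
Proof.
move=> mG dm1 dp1 cm cp Hm Hp; apply: weak_cvg_fan => M M0.
have a0 := chart_gt0 HC.
have a00 : - a <= 0 <= a by apply/andP; split; lra.
have eta0 := chart_spacing_gt0 HC a00.
pose kap := Num.min (cross (ell b) dm) (cross (ell b) dp).
have kap0 : 0 < kap by rewrite lt_min cm cp.
have km : kap <= cross (ell b) dm by rewrite ge_min lexx.
have kp : kap <= cross (ell b) dp by rewrite ge_min lexx orbT.
have kap1 : kap <= 1.
  apply: (le_trans km); apply: (le_trans (ler_norm _)).
  by have := cross_le (ell b) dm; rewrite enorm_ell dm1 mulr1.
(* [J] depends on [M] but not on [eps], since the index set of a fan is fixed before its
   precision. *)
have [J JM] : exists J : nat, 8 * M / kap + 4 <= J%:R * eta 0.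
  exists (Num.trunc ((8 * M / kap + 4) / eta 0)).+1.
  by rewrite -ler_pdivrMr// ltW// truncnS_gt.
have Medge d : kap <= cross (ell b) d -> M <= J%:R * cross (eta 0 *: ell b) d.
  move=> kd; rewrite crossZl mulrA.
  have h1 : (8 * M / kap + 4) * kap <= J%:R * eta 0 * cross (ell b) d.
    apply: ler_pM => //; last exact: ltW.
    by rewrite addr_ge0// divr_ge0 ?mulr_ge0// ltW.
  apply: le_trans h1; rewrite mulrDl divfK ?gt_eqF//; lra.
exists (fan_index J), (fan_base_point (eta 0 *: ell b)), (fan_direction dm dp).
split; first exact: fan_index_uniq.
  by move=> i _; rewrite /fan_direction; case: ifP; rewrite ?enormN.
move=> eps S eps0; split; last first.
  apply: fan_edges => //; [| |exact: Medge|exact: Medge];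
    by rewrite crossZl mulr_gt0.
pose e := Num.min (4^-1) (Num.min (eps / 4) (kap / 16)).
have e0 : 0 < e by rewrite !lt_min invr_gt0 ltr0n /= !divr_gt0.
have e4 : e <= 4^-1 by rewrite ge_min lexx.
have eeps : 4 * e <= eps.
  have : e <= eps / 4 by rewrite !ge_min lexx orbT.
  lra.
have ekap : 16 * e <= kap.
  have : e <= kap / 16 by rewrite !ge_min lexx !orbT.
  lra.
have [Kc Kc1 HKc] := chart_chord HC e0 e4.
have [Ki Ki1 HKi] := chart_increasing HC.
have [Ks Ks1 HKs] := chart_spacing HC e0.
pose K := maxn Kc (maxn Ki Ks).
have cK : (Kc <= K)%N by rewrite leq_maxl.
have iK : (Ki <= K)%N by rewrite /K maxnCA leq_maxl.
have sK : (Ks <= K)%N by rewrite /K (maxnC Ki) maxnCA leq_maxl.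
have K1 : (1 <= K)%N := leq_trans Kc1 cK.
have [B HB] := chart_radius_bounded HC K.+1.
have [be [Hbe Gbe]] := Hp e e0.
have [al [Hal Gal]] := Hm e e0.
have ceta := within_continuous_at0 (chart_spacing_cont HC).
have cell : pdist (ell (b + th n)) (ell b) @[n --> F] --> (0 : R).
  rewrite -(pdistxx (ell b)).
  apply: (@cvg_comp _ _ _ (fun n => ell (b + th n)) (fun x => pdist x (ell b)) _ (nbhs (ell b)));
    last exact: continuous_pdist.
  have : b + th n @[n --> F] --> b.
    by rewrite -[X in _ --> X]addr0; apply: cvgD; [exact: cvg_cst|exact: th0].
  move=> hb; apply: (@cvg_comp _ _ _ (fun n => b + th n) ell _ (nbhs b)) => //.
  exact: continuous_ell.
pose c1 := eps / 4 / (J%:R + 1).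
have J0 : 0 < J%:R + 1 :> R by rewrite ltr_wpDl.
have c10 : 0 < c1 by rewrite !divr_gt0.
pose c2 := eps / 4 / (J%:R * eta 0 + 1).
have J2 : 0 < J%:R * eta 0 + 1 by rewrite ltr_wpDl// mulr_ge0// ltW.
have c20 : 0 < c2 by rewrite !divr_gt0.
near=> n.
have [t1 t2 t3] : [/\ th n <= be n, be n <= a &
      forall y, th n < y < be n -> ~ Z y /\ pdist (h y) dp <= e] by near: n.
have [u1 u2 u3] : [/\ - a <= al n, al n <= th n &
      forall y, al n < y < th n -> ~ Z y /\ pdist (h y) dm <= e] by near: n.
have etac : `|eta (th n) - eta 0| < c1.
  by rewrite distrC; near: n; move/cvgr_dist_lt: ceta; apply.
have eta_lo : eta 0 / 2 < eta (th n) by near: n; move/cvgr_gt: ceta; apply; lra.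
have eta_hi : eta (th n) < 2 * eta 0 by near: n; move/cvgr_lt: ceta; apply; lra.
have ellc : pdist (ell (b + th n)) (ell b) < c2.
  by near: n; move/cvgr_lt: cell; apply.
have ellk : pdist (ell (b + th n)) (ell b) < kap / 2.
  by near: n; move/cvgr_lt: cell; apply; rewrite divr_gt0.
have crossk d : enorm d = 1 -> kap <= cross (ell b) d ->
    kap / 2 <= `|cross (ell (b + th n)) d|.
  move=> d1 kd; apply: le_trans (ler_norm _).
  have := cross_le (ell b - ell (b + th n)) d; rewrite d1 mulr1 -/(pdist _ _) pdistC.
  rewrite crossDl crossNl ler_norml => /andP[_]; move: ellk kd; lra.
apply: (@window_fan _ G b a r eta rho h Z HC dm dp M eps S kap e B (th n) (al n) (be n)
  J K (kn n)) => //.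
- exact: crossk.
- exact: crossk.
- by move=> k d s t Kk; apply: HKc; exact: leq_trans Kk.
- by move=> t ta k Kk; apply: HKi => //; exact: leq_trans Kk.
- by move=> k k' t Kk Kk'; apply: HKs; [exact: leq_trans Kk|exact: leq_trans Kk'].
- by near: n; exact: (kn_oo (K + J).+1).
- apply: (@lt_le_trans _ _ (B + M + 1)); first by rewrite ltrDl.
  by near: n; exact: radius_cvg_pinfty.
- exact: ltW.
- exact: ltW.
- apply: (@le_trans _ _ (c1 * J%:R)); first by rewrite ler_wpM2r// ltW.
  by rewrite /c1 -mulrA ler_piMr ?divr_ge0 ?ltW// mulrC ltr_pdivrMr// mul1r ltrDl.
- apply: (@le_trans _ _ (J%:R * eta 0 * c2)).
    by rewrite ler_wpM2l ?mulr_ge0// ltW.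
  rewrite /c2 [leLHS]mulrC -[leLHS]mulrA ler_piMr ?divr_ge0 ?ltW// mulrC ltr_pdivrMr// mul1r ltrDl//.
- apply: (@lt_le_trans _ _ (M + 1)); first by rewrite ltrDl.
  by near: n; exact: Gbe.
- apply: (@lt_le_trans _ _ (M + 1)); first by rewrite ltrDl.
  by near: n; exact: Gal.
- by near: n; exact: Gbe.
- by near: n; exact: Gal.
Unshelve. all: by end_near. Qed.

End ChartLimits.

(** * Charts and headings at every angle *)

Section AngleCharts.
Context {R : realType}.
Implicit Types (G : set (plane R)) (s : spiral_data R) (b a t x : R) (D : set R).

Lemma sup_cvg0P (A : set R) (f : nat -> R -> R) : sup_cvg0 A f ->
  forall e : R, 0 < e -> exists2 K, (1 <= K)%N &
    forall k t, (K <= k)%N -> A t -> f k t <= e.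
Proof.
move=> /cvg_EFinP H e e0; have [K _ HK] := H e e0.
exists K.+1 => // k t Kk At; have /andP[_] := HK k (ltnW Kk); rewrite add0r => h.
by rewrite -lee_fin; apply: le_trans h; apply: ereal_sup_ubound; exists t.
Qed.

Lemma nbhs_sector a b (k : nat) t : - a < t < a ->
  nbhs (k%:R + b + t) (sector a b k).
Proof.
move=> /andP[t1 t2].
have : nbhs (k%:R + b + t) `]k%:R + b - a, k%:R + b + a[%classic.
  apply: open_nbhs_nbhs; split; first exact: interval_open.
  by rewrite /= in_itv /=; apply/andP; split; lra.
by apply: filterS => x /=; rewrite /sector /= !in_itv /= => /andP[/ltW -> /ltW ->].
Qed.

Lemma nbhs_punctured a b (k : nat) t (Z : set R) : Z `<=` [set 0] -> - a < t < a -> ~ Z t ->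
  nbhs (k%:R + b + t) [set k%:R + b + u | u in `[- a, a]%classic `\` Z].
Proof.
move=> Z0 ta Zt; have : nbhs (k%:R + b + t) (~` [set k%:R + b + z | z in Z]).
  apply: open_nbhs_nbhs; split; last first.
    by move=> [z Zz /addrI zt]; apply: Zt; rewrite -zt.
  apply: closed_openC; have [z0|nz0] := pselect (Z 0).
    rewrite (_ : [set _ | _ in _] = [set k%:R + b + 0]); first exact: closed_eq.
    apply/seteqP; split => [_ [z /Z0 -> <-] //|_ ->].
    by exists 0.
  rewrite (_ : [set _ | _ in _] = set0); first exact: closed0.
  by apply/seteqP; split => // y [z Zz _]; apply: nz0; rewrite -(Z0 z Zz).
have := nbhs_sector b k ta; apply: filterS2 => x; rewrite /sector /= in_itv /= => /andP[x1 x2] nZ.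
exists (x - (k%:R + b)); last by rewrite addrC subrK.
split; first by rewrite /= in_itv /=; apply/andP; split; lra.
by move=> Zx; apply: nZ; exists (x - (k%:R + b)) => //; rewrite addrC subrK.
Qed.

Lemma pderive_polar (r : R -> R) x (l : R) : is_derive x 1 r l ->
  pderive (polar r) x (l *: ell x + (2 * pi * r x) *: rot90 (ell x)).
Proof.
move=> dr; have dlin : is_derive x 1 (fun y : R => 2 * pi * y) (2 * pi).
  have := is_deriveM (is_derive_cst (2 * pi) x 1) (is_derive_id x 1).
  by move/is_derive_eq; apply; rewrite scaler0 addr0 /GRing.scale /= mulr1.
have dc : is_derive x 1 (fun y => cos (2 * pi * y)) (- sin (2 * pi * x) * (2 * pi)).
  exact: (is_derive1_comp (is_derive_cos (2 * pi * x)) dlin).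
have ds : is_derive x 1 (fun y => sin (2 * pi * y)) (cos (2 * pi * x) * (2 * pi)).
  exact: (is_derive1_comp (is_derive_sin (2 * pi * x)) dlin).
split; rewrite /polar /ell /=.
  apply: (is_derive_eq (is_deriveM dr dc)).
  by rewrite /GRing.scale /=; ring.
apply: (is_derive_eq (is_deriveM dr ds)).
by rewrite /GRing.scale /=; ring.
Qed.

Lemma within_continuous_polar (r : R -> R) D :
  {within D, continuous r} -> {within D, continuous (polar r)}.
Proof.
move=> cr x; have ce := continuous_subspaceT (A := D) (@continuous_ell R).
exact: cvgZ (cr x) (ce x).
Qed.

Lemma asymptotics_chart G s b a (Z : set R) : 0 < a <= 8^-1 -> Z `<=` [set 0] ->
  escape_cone G s b a -> asymptotics s b a Z ->
  (forall k, (1 <= k)%N -> {within sector a b k, continuous (polar (Defs.radius s b))}) ->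
  (forall k, (1 <= k)%N -> exists M : R, forall t, - a < t < a -> t != 0 ->
    exists2 u, pderive (polar (Defs.radius s b)) (k%:R + b + t) u & enorm u <= M) ->
  (forall k t, (1 <= k)%N -> - a < t < a -> ~ Z t ->
    exists u, pderive (polar (Defs.radius s b)) (k%:R + b + t) u) ->
  chart G b a (Defs.radius s b) (spacing s b) (offset s b) (heading s b) Z.
Proof.
move=> a0 Z0 [cone_eq r0] [mono _ ceta eta0 crho eqs ch hu _ vel] cpol bnd der; split => //.
- by move=> k t k1 ta; apply: r0 k1 _; apply/sectorE.
- move=> e e0; have [K K1 HK] := sup_cvg0P vel e0; exists K => // k t Kk ta Zt.
  have [u du] := der k t (leq_trans K1 Kk) ta Zt; exists u => //.
  have tin : (`[- a, a]%classic `\` Z) t.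
    by split => //; rewrite /= in_itv /=; move: ta => /andP[/ltW -> /ltW ->].
  have := HK k t Kk tin; rewrite /unit_velocity_in.
  by rewrite (pderive_deriv_in (nbhs_punctured b k Z0 ta Zt) du).
- by have [K [K1 HK]] := mono; exists K.
- by move=> e e0; have [K K1 HK] := sup_cvg0P eqs e0; exists K.
- by move=> t ta Zt; apply: hu; split => //; rewrite /= in_itv.
Qed.

Lemma regular_chart G s b a : 0 < a <= 8^-1 -> regular_angle G s b a set0 ->
  chart G b a (Defs.radius s b) (spacing s b) (offset s b) (heading s b) set0.
Proof.
move=> a0 [ec C2 asy]; apply: asymptotics_chart => //.
- move=> k k1; apply: within_continuous_polar; apply: derivable_in_continuous.
  by have [[]] := C2 k k1.
- move=> k k1; have [[dr _ _] [M HM]] := C2 k k1; exists (M + 2 * pi * M) => t ta t0.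
  have sN := nbhs_sector b k ta; have [h1 h2 _] := HM _ (nbhs_singleton sN).
  have dx := derivable_in_is_derive sN dr.
  exists (deriv_in (sector a b k) (Defs.radius s b) (k%:R + b + t) *: ell (k%:R + b + t) +
     (2 * pi * Defs.radius s b (k%:R + b + t)) *: rot90 (ell (k%:R + b + t))).
    exact: pderive_polar.
  apply: (le_trans (enormD _ _)); rewrite !enormZ enorm_rot90 enorm_ell !mulr1.
  apply: lerD => //; rewrite normrM ger0_norm ?mulr_ge0 ?pi_ge0//.
  by rewrite ler_wpM2l// mulr_ge0 ?pi_ge0.
- move=> k t k1 ta _; have [[dr _ _] _] := C2 k k1.
  have dx := derivable_in_is_derive (nbhs_sector b k ta) dr.
  by eexists; exact: pderive_polar dx.
Qed.

Lemma exceptional_chart G s b a : 0 < a <= 8^-1 -> exceptional_angle G s b a [set 0] ->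
  chart G b a (Defs.radius s b) (spacing s b) (offset s b) (heading s b) [set 0].
Proof.
move=> a0 [ec C2 asy _ _].
have der k : (1 <= k)%N -> exists M : R, forall t, - a < t < a -> t != 0 ->
    exists2 u, pderive (polar (Defs.radius s b)) (k%:R + b + t) u & enorm u <= M.
  move=> k1; have [_ [[d1 _ _] [M1 H1]] [[d2 _ _] [M2 H2]]] := C2 k k1.
  exists (2 * Num.max M1 M2) => t /andP[t1 t2]; rewrite neq_lt => /orP[tn|tp].
    have N2 : nbhs (k%:R + b + t) `[k%:R + b - a, k%:R + b[%classic.
      have : nbhs (k%:R + b + t) `]k%:R + b - a, k%:R + b[%classic.
        apply: open_nbhs_nbhs; split; first exact: interval_open.
        by rewrite /= in_itv /=; apply/andP; split; lra.
      by apply: filterS => x /=; rewrite !in_itv /= => /andP[/ltW -> ->].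
    have [_ h _] := H2 _ (nbhs_singleton N2).
    exists (deriv_in `[k%:R + b - a, k%:R + b[%classic (polar (Defs.radius s b)) (k%:R + b + t)).
      exact: derivable_in_pderive.
    apply: (le_trans (enorm_le_norm _)); rewrite ler_pM2l//.
    by apply: (le_trans h); rewrite le_max lexx orbT.
  have N1 : nbhs (k%:R + b + t) `]k%:R + b, k%:R + b + a]%classic.
    have : nbhs (k%:R + b + t) `]k%:R + b, k%:R + b + a[%classic.
      apply: open_nbhs_nbhs; split; first exact: interval_open.
      by rewrite /= in_itv /=; apply/andP; split; lra.
    by apply: filterS => x /=; rewrite !in_itv /= => /andP[-> /ltW ->].
  have [_ h _] := H1 _ (nbhs_singleton N1).
  exists (deriv_in `]k%:R + b, k%:R + b + a]%classic (polar (Defs.radius s b)) (k%:R + b + t)).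
    exact: derivable_in_pderive.
  apply: (le_trans (enorm_le_norm _)); rewrite ler_pM2l//.
  by apply: (le_trans h); rewrite le_max lexx.
apply: asymptotics_chart => //.
- by move=> k k1; have [] := C2 k k1.
- move=> k t k1 ta /eqP t0; have [M HM] := der k k1.
  by have [u du _] := HM t ta t0; exists u.
Qed.

End AngleCharts.

(** * Comparison of overlapping charts and orientation of headings *)

Section OverlappingCharts.
Context {R : realType}.
Implicit Types (g : R -> plane R) (u v d : plane R).

Lemma crossBr u v d : cross u (v - d) = cross u v - cross u d.
Proof. by rewrite /cross /=; ring. Qed.

Lemma pderive_shift g (c x : R) u : pderive g (c + x) u -> pderive (fun y => g (c + y)) x u.
Proof.
have dc : is_derive x 1 (fun y : R => c + y) 1.
  have := is_deriveD (is_derive_cst c x 1) (is_derive_id x 1).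
  by move/is_derive_eq; apply; rewrite add0r.
move=> [d1 d2]; split.
  by apply: (is_derive_eq (is_derive1_comp (f := fun y => (g y).1) d1 dc)); rewrite mulr1.
by apply: (is_derive_eq (is_derive1_comp (f := fun y => (g y).2) d2 dc)); rewrite mulr1.
Qed.

Lemma pderive_near_unique g g' (x : R) u v : (\forall y \near x, g y = g' y) ->
  pderive g x u -> pderive g' x v -> u = v.
Proof.
move=> gg' /pderive_diff_quot du /pderive_diff_quot dv.
have gx := nbhs_singleton gg'.
have dv' : (y - x)^-1 *: (g y - g x) @[y --> x^'] --> v.
  apply: cvg_trans dv; apply: near_eq_cvg; move: (nbhs_dnbhs gg').
  by apply: filterS => y gy; rewrite gy gx.
exact: (@cvg_unique (plane R : normedModType R) (@norm_hausdorff _ _) _ _ _ _ du dv').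
Qed.

(** Along a polar curve the angle grows: the cross product of [ell x] with the difference quotient
    is [r y] times [sin (2 pi (y - x)) / (y - x)], nonnegative on both sides of [x]. *)
Lemma pderive_cross_ge0 (r : R -> R) (x : R) u : (\forall y \near x, 0 <= r y) ->
  pderive (polar r) x u -> 0 <= cross (ell x) u.
Proof.
move=> r0 /(pderive_dot (rot90 (ell x))) /is_derive_diff_quot du.
rewrite crossE dotC; apply: (cvgr_to_ge du).
have near4 : \forall y \near x^', `|x - y| < 4^-1.
  by apply: nbhs_dnbhs; apply: (@cvgr_dist_lt _ _ _ (nbhs x) _ id x).
apply: filterS2 near4 (nbhs_dnbhs r0) => y; rewrite ltr_norml => /andP[y1 y2] ry.
rewrite /polar !dotZl dot_rot90 mulr0 subr0 dotC -crossE cross_ell /GRing.scale /= mulrCA.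
apply: mulr_ge0 => //; have [xy|yx] := leP x y.
  by rewrite mulr_ge0 ?invr_ge0 ?subr_ge0// sin_turn_ge0//; apply/andP; split; lra.
apply: mulr_le0; first by rewrite invr_le0 subr_le0 ltW.
by apply: sin_turn_le0; apply/andP; split; lra.
Qed.

Section Agreement.
Variables (G : set (plane R)) (b a : R) (r eta rho : R -> R) (h : R -> plane R).
Variable Z : set R.
Hypothesis HC : chart G b a r eta rho h Z.

Lemma near_aperture (t : R) : - a < t < a -> \forall y \near t, - a < y < a.
Proof.
move=> /andP[t1 t2].
have : nbhs t `]- a, a[%classic.
  by apply: open_nbhs_nbhs; split; [exact: interval_open|rewrite /= in_itv /= t1].
by apply: filterS => y; rewrite /= in_itv.
Qed.

Lemma chart_radius_continuous (k : nat) (t : R) : (1 <= k)%N -> - a < t < a ->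
  r (k%:R + b + y) @[y --> t] --> r (k%:R + b + t).
Proof.
move=> k1 ta; have sN := nbhs_sector b k ta.
have cp : polar r y @[y --> k%:R + b + t] --> polar r (k%:R + b + t).
  have /subspace_continuousP/(_ _ (nbhs_singleton sN)) := chart_continuous HC k1.
  rewrite (_ : within _ _ = nbhs (k%:R + b + t))//.
  apply/seteqP; split => A; last by move=> NA; apply: filterS NA.
  by rewrite /within /= => WA; apply: filterS2 sN WA => y Dy; exact.
have cs : k%:R + b + y @[y --> t] --> k%:R + b + t.
  by apply: cvgD; [exact: cvg_cst|exact: cvg_id].
have rE y : - a < y < a -> enorm (polar r (k%:R + b + y)) = r (k%:R + b + y).
  move=> /andP[/ltW y1 /ltW y2]; rewrite enormZ enorm_ell mulr1 ger0_norm//.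
  by apply: (chart_ge0 HC k1); rewrite y1.
rewrite -(rE t ta).
have ce : enorm (polar r (k%:R + b + y)) @[y --> t] --> enorm (polar r (k%:R + b + t)).
  apply: (@cvg_comp _ _ _ (fun y => polar r (k%:R + b + y)) (@enorm R) _
    (nbhs (polar r (k%:R + b + t)))); last exact: continuous_enorm.
  exact: (@cvg_comp _ _ _ (fun y => k%:R + b + y) (polar r) _ _ _ cs cp).
apply: cvg_trans ce; apply: near_eq_cvg.
by have := near_aperture ta; apply: filterS => y /rE.
Qed.

(** Velocities of late turns point counterclockwise, and the heading is their limit. Strictness
    comes from non-collinearity, in [asymptotics_cross]. *)
Lemma chart_cross_ge0 (t : R) : - a < t < a -> ~ Z t -> 0 <= cross (ell (b + t)) (h t).
Proof.
move=> ta Zt; apply/ler_addgt0Pr => e e0.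
have [K K1 HK] := chart_velocity HC e0.
have [u du ue] := HK K t (leqnn K) ta Zt.
have : 0 <= cross (ell (K%:R + b + t)) u.
  apply: (pderive_cross_ge0 _ du).
  have := nbhs_sector b K ta; apply: filterS => y; rewrite /sector /= in_itv /= => /andP[y1 y2].
  rewrite -(subrK (K%:R + b) y) addrC; apply: (chart_ge0 HC K1).
  by apply/andP; split; lra.
rewrite -addrA ellDn => cu.
set w := (enorm u)^-1 *: u in ue.
have cw : 0 <= cross (ell (b + t)) w.
  by rewrite /w crossC crossZl -mulrN -crossC mulr_ge0// invr_ge0 enorm_ge0.
have := cross_le (ell (b + t)) (w - h t); rewrite enorm_ell mul1r -/(pdist _ _).
have -> : cross (ell (b + t)) (w - h t) = cross (ell (b + t)) w - cross (ell (b + t)) (h t).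
  exact: crossBr.
rewrite ler_norml => /andP[_]; lra.
Qed.

End Agreement.

Section TwoCharts.
Variables (G : set (plane R)) (b a : R) (r eta rho : R -> R) (h : R -> plane R).
Variable Z : set R.
Hypothesis HC : chart G b a r eta rho h Z.
Variables (b' a' : R) (r' eta' rho' : R -> R) (h' : R -> plane R) (Z' : set R).
Hypothesis HC' : chart G b' a' r' eta' rho' h' Z'.
Variable c : R.
Hypothesis bb' : forall y, ell (b + y) = ell (b' + (c + y)) :> plane R.

(* Far from the origin the two charts enumerate the same points of a ray in the
   same order, so that by continuity their turns coincide locally. *)
Lemma turns_agree (t B : R) : - a < t < a -> - a' < c + t < a' -> exists B0 : R,
  forall k, (1 <= k)%N -> B0 < r (k%:R + b + t) -> exists k',
    [/\ (1 <= k')%N, B < r' (k'%:R + b' + (c + t)) &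
     \forall y \near t, coil r b k y = coil r' b' k' (c + y)].
Proof.
move=> ta ta'; have [K K1 HK] := chart_increasing HC'.
(* A radius above [B1] forces an index of at least [K + 2], so that the preceding turn is still in
   the monotone range. *)
have [B1 HB1] := chart_radius_bounded HC' K.+2.
have wide (A y : R) : - A < y < A -> - A <= y <= A by move=> /andP[/ltW -> /ltW ->].
have transfer k y : (1 <= k)%N -> - a < y < a -> - a' < c + y < a' ->
    0 < r (k%:R + b + y) -> exists j, [/\ (1 <= j)%N, coil r b k y = coil r' b' j (c + y) &
      r (k%:R + b + y) = r' (j%:R + b' + (c + y))].
  move=> k1 ya ya' rp.
  have Gk := chart_in HC k1 (wide _ _ ya).
  have [j [u [j1 ua E]]] := chart_out HC' Gk (ltW rp) (wide _ _ ya') (etrans (coilE r b k y)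
     (congr1 (fun z => _ *: z) (bb' y))).
  have rE : r (k%:R + b + y) = r' (j%:R + b' + u).
    have := congr1 (fun z => enorm z) E; rewrite !coilE !enormZ !enorm_ell !mulr1.
    rewrite ger0_norm ?ger0_norm//; last exact: ltW.
    exact: (chart_ge0 HC').
  have uy : c + y = u.
    apply: (ray_coil_inj HC' (k := j) (c := r (k%:R + b + y)) (wide _ _ ya') ua).
      by rewrite -rE.
    by rewrite -bb' -coilE.
  by exists j; split => //; [rewrite uy|rewrite uy].
have cs : c + y @[y --> t] --> c + t by apply: cvgD; [exact: cvg_cst|exact: cvg_id].
have cr' j : (1 <= j)%N -> r' (j%:R + b' + (c + y)) @[y --> t] --> r' (j%:R + b' + (c + t)).
  move=> j1; apply: (@cvg_comp _ _ _ (fun y => c + y) (fun y => r' (j%:R + b' + y)) _ _ _ cs).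
  exact: (chart_radius_continuous HC').
exists (Num.max 0 (Num.max B B1)) => k k1; rewrite !gt_max => /and3P[rk0 rkB rkB1].
have [k' [k'1 E rE]] := transfer k t k1 ta ta' rk0.
have big j y : (1 <= j)%N -> - a' < c + y < a' -> B1 < r' (j%:R + b' + (c + y)) ->
    (K.+2 <= j)%N.
  move=> j1 ya rj; rewrite leqNgt; apply/negP => jK.
  by have := HB1 j (c + y) j1 jK (wide _ _ ya); rewrite leNgt rj.
have Kk' : (K.+2 <= k')%N by apply: big k'1 ta' _; rewrite -rE.
exists k'; split => //; first by rewrite -rE.
(* At [t] the point lies strictly between the turns before and after [k'] of the other chart. By
   continuity this persists near [t] and leaves only the turn [k']. *)
have lo : r' (k'.-1%:R + b' + (c + t)) < r (k%:R + b + t).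
  rewrite rE; apply: (increasing_from_lt HK (wide _ _ ta')); first lia.
  by rewrite prednK//; lia.
have hi : r (k%:R + b + t) < r' (k'.+1%:R + b' + (c + t)).
  by rewrite rE; apply: HK; [exact: wide|lia].
have k'p : (1 <= k'.-1)%N by lia.
have k'0 : (0 < k')%N by lia.
have ck := chart_radius_continuous HC k1 ta.
near=> y.
have ya : - a < y < a by near: y; exact: near_aperture ta.
have ya' : - a' < c + y < a'.
  by near: y; have := near_aperture ta' => /cs; exact.
have y0 : 0 < r (k%:R + b + y) by near: y; move/cvgr_gt: ck; apply.
have yB1 : B1 < r (k%:R + b + y) by near: y; move/cvgr_gt: ck; apply.
have [j [j1 Ej rj]] := transfer k y k1 ya ya' y0.
have Kj : (K.+2 <= j)%N by apply: big j1 ya' _; rewrite -rj.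
suff -> : k' = j by [].
have yr := wide _ _ ya'.
case: (ltngtP k' j) => // [kj|jk]; exfalso.
  pose m := (r (k%:R + b + t) + r' (k'.+1%:R + b' + (c + t))) / 2.
  have m1 : r (k%:R + b + y) < m by near: y; move/cvgr_lt: ck; apply; rewrite /m; lra.
  have m2 : m < r' (k'.+1%:R + b' + (c + y)).
    by near: y; move/cvgr_gt: (cr' k'.+1 isT); apply; rewrite /m; lra.
  have : r' (k'.+1%:R + b' + (c + y)) <= r' (j%:R + b' + (c + y)).
    move: kj; rewrite leq_eqVlt => /orP[/eqP <- //|kj].
    apply/ltW/(increasing_from_lt HK yr _ kj).
    exact: leq_trans (ltnW (ltnW Kk')) (leqnSn _).
  by rewrite -rj => h1; move: (lt_le_trans m2 h1); rewrite ltNge (ltW m1).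
pose m := (r (k%:R + b + t) + r' (k'.-1%:R + b' + (c + t))) / 2.
have m1 : m < r (k%:R + b + y) by near: y; move/cvgr_gt: ck; apply; rewrite /m; lra.
have m2 : r' (k'.-1%:R + b' + (c + y)) < m.
  by near: y; move/cvgr_lt: (cr' _ k'p); apply; rewrite /m; lra.
have : r' (j%:R + b' + (c + y)) <= r' (k'.-1%:R + b' + (c + y)).
  have : (j <= k'.-1)%N by rewrite -ltnS prednK.
  rewrite leq_eqVlt => /orP[/eqP <- //|jk'].
  by apply/ltW/(increasing_from_lt HK yr _ jk'); exact: ltnW (ltnW Kj).
by rewrite -rj => h1; move: (le_lt_trans h1 m2); rewrite ltNge (ltW m1).
Unshelve. all: by end_near. Qed.

Lemma chart_radius_unbounded (A t : R) (K : nat) : - a <= t <= a -> exists k : nat,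
  [/\ (1 <= k)%N, (K <= k)%N & A < r (k%:R + b + t)].
Proof.
move=> ta; have [K1 K11 HK1] := chart_equispacing HC ltr01.
have e0 := chart_spacing_gt0 HC ta.
pose N := (Num.trunc ((A + 1 - rho t) / eta t)).+1.
have NA : A + 1 - rho t < eta t * N%:R by rewrite mulrC -ltr_pdivrMr// truncnS_gt.
pose k := maxn N (maxn K K1); exists k; split.
- by rewrite /k leq_max.
- by rewrite /k !leq_max leqnn orbT.
- have := HK1 k t _ ta; rewrite /k !leq_max leqnn !orbT -/k => /(_ isT).
  rewrite ler_norml => /andP[h1 _].
  have : eta t * N%:R <= eta t * k%:R by rewrite ler_pM2l// ler_nat leq_maxl.
  lra.
Qed.

(** Locally both charts parametrise the same turn up to a shift of the angle, so derivatives
    coincide and both headings are limits of the same unit velocities. *)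
Lemma charts_agree (t : R) : - a < t < a -> - a' < c + t < a' -> ~ Z t -> ~ Z' (c + t) ->
  h t = h' (c + t).
Proof.
move=> ta ta' Zt Zt'; apply/eqP; rewrite -subr_eq0; apply/eqP/enorm_eq0/eqP.
rewrite eq_le enorm_ge0 andbT; apply/ler_addgt0Pr => e e0; rewrite add0r -/(pdist _ _).
have e2 : 0 < e / 2 by rewrite divr_gt0.
have [K K1 HK] := chart_velocity HC e2.
have [K' K1' HK'] := chart_velocity HC' e2.
have [B HB] := chart_radius_bounded HC' K'.
have [B0 HB0] := turns_agree B ta ta'.
have tw : - a <= t <= a by move: ta => /andP[/ltW -> /ltW ->].
have tw' : - a' <= c + t <= a' by move: ta' => /andP[/ltW -> /ltW ->].
have [k [k1 Kk rk]] := chart_radius_unbounded B0 K tw.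
have [k' [k'1 Bk' E]] := HB0 k k1 rk.
have Kk' : (K' <= k')%N.
  rewrite leqNgt; apply/negP => kK; have := HB k' (c + t) k'1 kK tw'.
  by rewrite leNgt Bk'.
have [u du hu] := HK k t Kk ta Zt; have [v dv hv] := HK' k' (c + t) Kk' ta' Zt'.
have uv : u = v.
  apply: (pderive_near_unique E); first exact: (pderive_shift (g := polar r) du).
  apply: (pderive_shift (g := coil r' b' k')).
  exact: (pderive_shift (g := polar r') dv).
rewrite -uv pdistC in hv; rewrite pdistC in hu.
apply: (le_trans (pdist_triangle ((enorm u)^-1 *: u) _ _)).
rewrite (splitr e); apply: lerD; [exact: hu|by rewrite pdistC].
Qed.

End TwoCharts.
End OverlappingCharts.

(** * Distances on the circle and apertures *)

Section CircleDistance.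
Context {R : realType}.
Implicit Types (E : set R) (b c d t : R).

Lemma circleE t : circle t <-> 0 <= t < 1.
Proof. by rewrite /circle /= in_itv. Qed.

Lemma circle_dist_gt0 b t : circle b -> circle t -> b != t -> 0 < circle_dist b t.
Proof.
move=> /circleE /andP[b0 b1] /circleE /andP[t0 t1] bt.
by rewrite /circle_dist lt_min normr_gt0 subr_eq0 bt subr_gt0 ltr_norml; lra.
Qed.

Lemma circle_dist_ge0 b t : circle b -> circle t -> 0 <= circle_dist b t.
Proof.
move=> cb ct; have [->|bt] := eqVneq b t; last by rewrite ltW// circle_dist_gt0.
by rewrite /circle_dist subrr normr0 subr0 le_min lexx ler01.
Qed.

Lemma half_aperture_fin E b : (forall t, E t -> 0 <= circle_dist b t) ->
  (half_aperture E b)%:E = mine (ereal_inf [set (circle_dist b t)%:E | t in E]) (8^-1)%:E.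
Proof.
move=> E0; rewrite /half_aperture fineK//; apply/fin_real/andP; split.
  rewrite lt_min ltNyr andbT; apply: (@lt_le_trans _ _ 0%E) => //.
  by apply: le_ereal_inf_tmp => _ [t Et <-]; rewrite lee_fin E0.
by rewrite gt_min ltry orbT.
Qed.

Lemma half_aperture_ge E b d : d <= 8^-1 -> (forall t, E t -> 0 <= circle_dist b t) ->
  (forall t, E t -> d <= circle_dist b t) -> d <= half_aperture E b.
Proof.
move=> d8 E0 Ed; rewrite -lee_fin half_aperture_fin// le_min lee_fin d8 andbT.
by apply: le_ereal_inf_tmp => _ [t Et <-]; rewrite lee_fin Ed.
Qed.

Lemma half_aperture_le E b : (forall t, E t -> 0 <= circle_dist b t) ->
  half_aperture E b <= 8^-1.
Proof. by move=> E0; rewrite -lee_fin half_aperture_fin// ge_min lexx orbT. Qed.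

Lemma half_aperture_le_dist E b t : (forall t, E t -> 0 <= circle_dist b t) -> E t ->
  half_aperture E b <= circle_dist b t.
Proof.
move=> E0 Et; rewrite -lee_fin half_aperture_fin// ge_min; apply/orP; left.
by apply: ereal_inf_lbound; exists t.
Qed.

Lemma finite_positive_min E (f : R -> R) : finite_set E -> (forall t, E t -> 0 < f t) ->
  exists2 d : R, 0 < d & forall t, E t -> d <= f t.
Proof.
move=> /finite_seqP[l ->]; elim: l => [|y l IH] H; first by exists 1.
have [|d d0 Hd] := IH; first by move=> t /= tl; apply: H; rewrite /= inE tl orbT.
exists (Num.min d (f y)) => [|t /=]; first by rewrite lt_min d0 H//= inE eqxx.
rewrite inE => /orP[/eqP ->|/Hd h]; first by rewrite ge_min lexx orbT.
by rewrite ge_min h.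
Qed.

Lemma half_aperture_gt0 E b : finite_set E -> E `<=` circle -> circle b -> ~ E b ->
  0 < half_aperture E b <= 8^-1.
Proof.
move=> fE Ec cb Eb; have E0 t : E t -> 0 <= circle_dist b t.
  by move=> /Ec; exact: circle_dist_ge0.
rewrite half_aperture_le// andbT.
have [|d d0 Hd] := @finite_positive_min E (circle_dist b) fE.
  move=> t Et; apply: circle_dist_gt0 => //; first exact: Ec.
  by apply: contra_notN Eb => /eqP ->.
apply: (@lt_le_trans _ _ (Num.min d 8^-1)).
  by rewrite lt_min d0 invr_gt0 ltr0n.
apply: half_aperture_ge => //; first by rewrite ge_min lexx orbT.
by move=> t Et; rewrite ge_min Hd.
Qed.

(** [b'] represents [b + c] in [[0, 1)], and an angle [y] measured from [b] is [y - c] measured from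
    [b']. The cases are [b + c] below, in and above that interval. *)
Lemma circle_shift b c : circle b -> `|c| <= 8^-1 -> exists b',
  [/\ circle b', forall y, ell (b + y) = ell (b' + (- c + y)) :> plane R,
      circle_dist b' b = `|c| &
      forall t, circle t -> circle_dist b t - `|c| <= circle_dist b' t].
Proof.
move=> /circleE /andP[b0 b1] c8; have := c8; rewrite ler_norml => /andP[c1 c2].
have dist b' t : `|b - t| - `|c| <= `|b' - t| -> `|b' - t| <= `|b - t| + `|c| ->
    circle_dist b t - `|c| <= circle_dist b' t.
  rewrite /circle_dist => h1 h2; rewrite le_min lerBlDr ge_min -lerBlDr h1 /=.
  by rewrite lerBlDr ge_min; apply/orP; right; lra.
have tri t : `|b - t| - `|c| <= `|b + c - t| /\ `|b + c - t| <= `|b - t| + `|c|.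
  split.
    rewrite lerBlDr; apply: (le_trans _ (ler_normB _ _)).
    by rewrite (_ : b + c - t - c = b - t)//; ring.
  apply: (le_trans _ (ler_normD _ _)).
  by rewrite (_ : b - t + c = b + c - t)//; ring.
have cdbc : `|c| <= 1 - `|c| by lra.
have [bc|bc] := ltP (b + c) 0.
  exists (b + c + 1); split.
  - by apply/circleE/andP; split; lra.
  - by move=> y; rewrite -ellD1; congr ell; ring.
  - rewrite /circle_dist (_ : b + c + 1 - b = 1 + c); last by ring.
    rewrite (ger0_norm (_ : 0 <= 1 + c)); last lra.
    by rewrite ltr0_norm; last lra; rewrite min_r; lra.
  - move=> t /circleE/andP[t0 t1]; rewrite /circle_dist (ltr0_norm (_ : c < 0)); last lra.
    rewrite le_min !lerBlDr !ge_min; apply/andP.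
    by case: (ger0P (b - t)) => bt; case: (ger0P (b + c + 1 - t)) => bt';
      split; apply/orP; (by left; lra) || (by right; lra).
have [bc1|bc1] := ltP (b + c) 1.
  exists (b + c); split.
  - by apply/circleE/andP; split; lra.
  - by move=> y; congr ell; ring.
  - by rewrite /circle_dist (_ : b + c - b = c) ?min_l//; ring.
  - by move=> t _; have [h1 h2] := tri t; exact: dist.
exists (b + c - 1); split.
- by apply/circleE/andP; split; lra.
- by move=> y; rewrite -(ellD1 (_ + (_ + _))); congr ell; ring.
- rewrite /circle_dist (_ : b + c - 1 - b = c - 1); last by ring.
  rewrite (ler0_norm (_ : c - 1 <= 0)); last lra.
  by rewrite gtr0_norm; last lra; rewrite min_r; lra.
- move=> t /circleE/andP[t0 t1]; rewrite /circle_dist (gtr0_norm (_ : 0 < c)); last lra.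
  rewrite le_min !lerBlDr !ge_min; apply/andP.
  by case: (ger0P (b - t)) => bt; case: (ger0P (b + c - 1 - t)) => bt';
    split; apply/orP; (by left; lra) || (by right; lra).
Qed.

End CircleDistance.

Section SpiralCharts.
Context {R : realType}.
Variables (G : set (plane R)) (I : set R) (s : spiral_data R).
Hypothesis HG : spiraling G I s.
Implicit Types (b t : R) (d : plane R).

Lemma regular_aperture b : circle b -> ~ I b -> 0 < half_aperture I b <= 8^-1.
Proof.
move=> cb Ib; apply: half_aperture_gt0 => //; first exact: exceptional_finite HG.
exact: exceptional_circle HG.
Qed.

Lemma exceptional_aperture b : I b -> 0 < half_aperture (I `\ b) b <= 8^-1.
Proof.
move=> Ib; apply: half_aperture_gt0.
- by apply: sub_finite_set (exceptional_finite HG) => t [].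
- by move=> t [/(exceptional_circle HG)].
- exact: (exceptional_circle HG) Ib.
- by move=> [_]; apply.
Qed.

Lemma asymptotics_cross b a (Z : set R) c : asymptotics s b a Z ->
  - a <= c <= a -> ~ Z c -> cross (ell (b + c)) (heading s b c) != 0.
Proof.
move=> asy ca Zc; have ain : (`[- a, a]%classic `\` Z) c by split => //; rewrite /= in_itv.
apply/eqP => c0; apply: (heading_noncollinear asy ain).
exists (dot (heading s b c) (ell (b + c))).
rewrite {1}(unit_decomp (heading s b c) (enorm_ell (b + c))).
by rewrite [X in _ + X *: _](_ : _ = 0) ?scale0r ?addr0// dotC -crossE.
Qed.

Lemma cvg_cross (F : set_system R) (FF : Filter F) (f g : R -> plane R) (u d : plane R) :
  f t @[t --> F] --> u -> g t @[t --> F] --> d ->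
  cross (f t) (g t) @[t --> F] --> cross u d.
Proof.
have fst_cvg (k : R -> plane R) (w : plane R) : k t @[t --> F] --> w -> (k t).1 @[t --> F] --> w.1.
  move=> kw; apply: (@cvg_comp _ _ _ k fst _ (nbhs w) _ kw).
  exact: (@cvg_fst R R (nbhs w.1) (nbhs w.2) _).
have snd_cvg (k : R -> plane R) (w : plane R) : k t @[t --> F] --> w -> (k t).2 @[t --> F] --> w.2.
  move=> kw; apply: (@cvg_comp _ _ _ k snd _ (nbhs w) _ kw).
  exact: (@cvg_snd R R (nbhs w.1) (nbhs w.2) _).
move=> fu gd.
by apply: cvgB; apply: cvgM; (exact: fst_cvg) || (exact: snd_cvg).
Qed.

Lemma plane_cvg_unique (F : set_system R) (FF : ProperFilter F) (f : R -> plane R) d d' :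
  f t @[t --> F] --> d -> f t @[t --> F] --> d' -> d = d'.
Proof.
exact: (@cvg_unique (plane R : normedModType R) (@norm_hausdorff _ _) (f @ F) _ d d').
Qed.

(* The closed sectors of regular angles next to an exceptional one reach it, so
   non-collinearity survives in the one-sided limits of the headings there. *)
Lemma exceptional_heading b (F : set_system R) (FF : ProperFilter F) c d : I b ->
  `|c| = half_aperture (I `\ b) b / 2 ->
  t @[t --> F] --> (0 : R) -> (\forall t \near F, `|t - c| < `|c|) ->
  heading s b t @[t --> F] --> d -> enorm d = 1 /\ 0 < cross (ell b) d.
Proof.
move=> Ib cE F0 Fc hd; have a0 := exceptional_aperture Ib.
set a := half_aperture _ _ in cE a0; have /andP[ap a8] := a0.
have cb : circle b := exceptional_circle HG Ib.
have c8 : `|c| <= 8^-1 by rewrite cE; lra.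
have c0 : 0 < `|c| by rewrite cE; lra.
(* [b'] lies half an aperture from [b], on the side of [c]. It is regular with an aperture of at
   least [|c|], so its closed sector contains the ray at [b], at the offset [- c]. *)
have [b' [cb' bb' db dt]] := circle_shift cb c8.
have I0 t : I t -> 0 <= circle_dist b' t.
  by move=> /(exceptional_circle HG); exact: (circle_dist_ge0 cb').
have capert : `|c| <= half_aperture I b'.
  apply: half_aperture_ge => // t It; have [->|tb] := eqVneq t b; first by rewrite db.
  have := dt t (exceptional_circle HG It); apply: le_trans.
  have : a <= circle_dist b t.
    apply: half_aperture_le_dist; last by split => //; exact/eqP.
    by move=> y [/(exceptional_circle HG) cy _]; exact: circle_dist_ge0.
  by rewrite cE; lra.
have Ib' : ~ I b'.
  move=> Ib'; have : half_aperture I b' <= circle_dist b' b'.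
    exact: half_aperture_le_dist.
  rewrite /circle_dist subrr normr0 le_min => /andP[h1 _]; lra.
have /(regular_chart (regular_aperture cb' Ib')) HC' := spiral_regular HG cb' Ib'.
have [_ _ asy'] := spiral_regular HG cb' Ib'.
have /(exceptional_chart a0) HC := spiral_exceptional HG Ib.
set a' := half_aperture I b' in HC' asy' capert.
have ca' : - a' <= - c <= a' by rewrite -ler_norml normrN.
(* The condition on [F] keeps [t] on the side of [c], away from 0 and inside both open sectors. *)
have hh' : \forall t \near F, heading s b t = heading s b' (- c + t).
  near=> t; have tc : `|t - c| < `|c| by near: t.
  have ta : - a < t < a.
    by rewrite -ltr_norml; near: t; move/cvgr_dist_lt: F0 => /(_ _ ap);
      apply: filterS => y; rewrite sub0r normrN.
  apply: (charts_agree HC HC' bb') => //; last first.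
    by move=> /= t0; move: tc; rewrite t0 sub0r normrN ltxx.
  by rewrite -ltr_norml addrC; apply: (lt_le_trans tc).
have cin : (`[- a', a']%classic `\` set0) (- c) by split => //=; rewrite in_itv.
have hd' : heading s b' (- c + t) @[t --> F] --> heading s b' (- c).
  have /subspace_continuousP/(_ _ cin) cc := chart_heading_cont HC'.
  apply: (@cvg_comp _ _ _ (fun t => - c + t) (heading s b') _ _ _ _ cc).
  have Fc' : - c + t @[t --> F] --> - c.
    by rewrite -[X in _ --> X]addr0; apply: cvgD => //; exact: cvg_cst.
  move=> A; rewrite /within /= => /Fc' /=; rewrite /nbhs /= => FA.
  apply: filterS2 FA Fc => t At tc; apply: At; split => //=; rewrite in_itv /=.
  by rewrite -ler_norml addrC ltW// (lt_le_trans tc).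
have -> : d = heading s b' (- c).
  apply: (plane_cvg_unique FF hd); apply: cvg_trans hd'; apply: near_eq_cvg.
  by apply: filterS hh' => t ->.
split; first exact: (chart_heading_unit HC').
have ellb : ell b = ell (b' - c) :> plane R by have := bb' 0; rewrite !addr0.
(* Nonzero because the heading of [b'] at [- c] is non-collinear with this ray, nonnegative as a
   limit of the signs from [chart_cross_ge0]. *)
rewrite ellb lt_neqAle eq_sym (asymptotics_cross asy' ca' _)//= -ellb.
have ellF : ell (b + t) @[t --> F] --> (ell b : plane R).
  have bF : b + t @[t --> F] --> b.
    by rewrite -[X in _ --> X]addr0; apply: cvgD => //; exact: cvg_cst.
  by apply: (@cvg_comp _ _ _ (fun t => b + t) (@ell R) _ (nbhs b)) => //; exact: continuous_ell.
apply: (cvgr_to_ge (cvg_cross FF ellF hd')); near=> t.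
have tc : `|t - c| < `|c| by near: t.
have ta : - a < t < a.
  by rewrite -ltr_norml; near: t; move/cvgr_dist_lt: F0 => /(_ _ ap);
    apply: filterS => y; rewrite sub0r normrN.
have <- : heading s b t = heading s b' (- c + t) by near: t.
apply: (chart_cross_ge0 HC ta) => /= t0.
by move: tc; rewrite t0 sub0r normrN ltxx.
Unshelve. all: by end_near. Qed.

(** Puncturing the window lets regular and exceptional angles share one form of chart. *)
Lemma chart_weaken b a (r eta rho : R -> R) (h : R -> plane R) :
  chart G b a r eta rho h set0 -> chart G b a r eta rho h [set 0].
Proof.
case=> ? _ ? ? ? ? vel ? ? ? ? ? hc hu; split => //.
- by move=> e e0; have [K K1 HK] := vel e e0; exists K => // k t Kk ta _; exact: HK.
- by rewrite setD0 in hc; apply: continuous_subspaceW hc => t [].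
- by move=> t ta _; apply: hu.
Qed.

(** The common interface to all angles of the circle. At a regular angle both one-sided limits are
    the heading at 0; at an exceptional one they are controlled by [exceptional_heading], applied
    half an aperture to the left and to the right. *)
Lemma spiral_chart b : circle b -> exists2 a,
  chart G b a (Defs.radius s b) (spacing s b) (offset s b) (heading s b) [set 0] &
  [/\ heading s b t @[t --> 0^'-] --> heading_left s b /\
      heading s b t @[t --> 0^'+] --> heading_right s b,
      enorm (heading_left s b) = 1 /\ 0 < cross (ell b) (heading_left s b),
      enorm (heading_right s b) = 1 /\ 0 < cross (ell b) (heading_right s b) &
      ~ I b -> heading_left s b = heading_right s b].
Proof.
move=> cb; have [Ib|Ib] := pselect (I b).
  have a0 := exceptional_aperture Ib; exists (half_aperture (I `\ b) b).
    exact: exceptional_chart a0 (spiral_exceptional HG Ib).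
  have [_ _ _ hl hr] := spiral_exceptional HG Ib.
  set a := half_aperture _ _ in a0; have /andP[ap _] := a0.
  have a2 : 0 < a / 2 by rewrite divr_gt0.
  split => //.
    apply: (@exceptional_heading b 0^'- _ (- (a / 2)) _ Ib _ _ _ hl).
    - by rewrite normrN gtr0_norm.
    - exact: cvg_at_left_filter cvg_id.
    - rewrite normrN (gtr0_norm a2); near=> t.
      have t0 : t < 0 by near: t; exact: nbhs_left_lt.
      have t1 : - (a / 2) < t by near: t; apply: nbhs_left_gt; rewrite oppr_lt0.
      by rewrite ltr_norml; apply/andP; split; lra.
  apply: (@exceptional_heading b 0^'+ _ (a / 2) _ Ib _ _ _ hr).
  - by rewrite gtr0_norm.
  - exact: cvg_at_right_filter cvg_id.
  - rewrite (gtr0_norm a2); near=> t.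
    have t0 : 0 < t by near: t; exact: nbhs_right_gt.
    have t1 : t < a / 2 by near: t; exact: nbhs_right_lt.
    by rewrite ltr_norml; apply/andP; split; lra.
have a0 := regular_aperture cb Ib; have /andP[ap _] := a0.
have HC := regular_chart a0 (spiral_regular HG cb Ib).
have [_ _ asy] := spiral_regular HG cb Ib.
set a := half_aperture I b in a0 ap HC asy.
exists a; first exact: chart_weaken.
have c0 : heading s b t @[t --> 0] --> heading s b 0.
  have aa : - a < a by lra.
  have := chart_heading_cont HC; rewrite setD0 => /(continuous_within_itvP _ aa)[+ _ _].
  by apply; rewrite in_itv /= oppr_lt0 ap.
have hl : heading s b t @[t --> 0^'-] --> heading s b 0 := cvg_at_left_filter c0.
have hr : heading s b t @[t --> 0^'+] --> heading s b 0 := cvg_at_right_filter c0.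
have limE (F : set_system R) (FF : ProperFilter F) : heading s b t @[t --> F] --> heading s b 0 ->
    [lim heading s b t @[t --> F] in (plane R : normedModType R)] = heading s b 0.
  exact: (@cvg_lim (plane R : normedModType R) (@norm_hausdorff _ _)).
have -> : heading_left s b = heading s b 0 by exact: limE.
have -> : heading_right s b = heading s b 0 by exact: limE.
have a00 : - a <= 0 <= a by rewrite oppr_le0 ltW.
have : enorm (heading s b 0) = 1 /\ 0 < cross (ell b) (heading s b 0); last by split.
split; first exact: (chart_heading_unit HC).
have := asymptotics_cross asy a00; rewrite addr0 => c1.
rewrite lt_neqAle eq_sym c1//= -{1}(addr0 b).
by apply: (chart_cross_ge0 HC) => //; rewrite oppr_lt0 ap.
Unshelve. all: by end_near. Qed.

End SpiralCharts.

(** * Closedness and local finiteness *)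

Section ChartPieces.
Context {R : realType}.
Variables (G : set (plane R)) (b a : R) (r eta rho : R -> R) (h : R -> plane R).
Variable Z : set R.
Hypothesis HC : chart G b a r eta rho h Z.

Lemma chart_radius_ge (M : R) : exists2 K, (1 <= K)%N &
  forall k t, (K <= k)%N -> - a <= t <= a -> M <= r (k%:R + b + t).
Proof.
have a0 := chart_gt0 HC; have aa : - a <= a by lra.
have [c] := EVT_min aa (chart_spacing_cont HC); rewrite in_itv /= => ca etac.
have [c' _ rhoc] := EVT_min aa (chart_offset_cont HC).
have ec0 := chart_spacing_gt0 HC ca.
have [K K1 HK] := chart_equispacing HC ltr01.
pose N := (Num.trunc ((M + 1 - rho c') / eta c)).+1.
have NA : M + 1 - rho c' <= eta c * N%:R.
  by rewrite mulrC -ler_pdivrMr// ltW// truncnS_gt.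
exists (maxn K N); first by rewrite leq_max K1.
move=> k t; rewrite geq_max => /andP[Kk Nk] ta.
have tin : t \in `[- a, a]%R by rewrite in_itv.
have := HK k t Kk ta; rewrite ler_norml => /andP[+ _]; have := rhoc t tin.
have : eta c * N%:R <= eta t * k%:R.
  by apply: ler_pM; rewrite ?ler_nat ?etac// ltW.
lra.
Qed.

(** A derivative bound makes the arc Lipschitz: [|M| z] plus or minus a component of the curve is
    monotone. Since a corner may sit at the angle 0, the arc must not have it in its interior. *)
Lemma arc_finite (k : nat) (s t : R) : (1 <= k)%N -> - a <= s -> s <= t -> t <= a ->
  (forall y, s < y < t -> y != 0) -> (hausdorff1 (coil r b k @` `[s, t]) < +oo)%E.
Proof.
move=> k1 sa st ta st0; have [M HM] := chart_bounded HC k1.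
have M0 : 0 <= `|M| by [].
apply: (@le_lt_trans _ _ (2 * `|M| * (t - s))%:E); last by rewrite ltry.
have lip d (x y : R) : enorm d = 1 -> s <= x -> x <= y -> y <= t ->
    `|dot (coil r b k x - coil r b k y) d| <= `|M| * `|x - y|.
  move=> d1 sx xy yt; rewrite dotBl.
  have bnd z : k%:R + b + x < z < k%:R + b + y -> exists2 u, pderive (polar r) z u & `|dot u d| <= `|M|.
    move=> /andP[z1 z2]; have zst : s < z - (k%:R + b) < t by apply/andP; split; lra.
    have za : - a < z - (k%:R + b) < a by apply/andP; split; lra.
    have [u] := HM _ za (st0 _ zst); rewrite addrC subrK => du uM; exists u => //.
    by apply: (le_trans (dot_unit_le u d1)); rewrite (le_trans uM)// ler_norm.
  have cpol := chart_continuous_dot HC (d := d) k1 (le_trans sa sx) (le_trans yt ta).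
  have mono (c : R) : `|c| = 1 ->
      c * dot (polar r (k%:R + b + x)) d + `|M| * (k%:R + b + x) <=
      c * dot (polar r (k%:R + b + y)) d + `|M| * (k%:R + b + y).
    move=> c1; apply: (@ge0_derive_le _ (fun z => c * dot (polar r z) d + `|M| * z)).
    - by rewrite lerD2l.
    - move=> z; have cid : {within `[k%:R + b + x, k%:R + b + y], continuous (fun z : R => z)}.
        by apply: continuous_subspaceT => v; exact: cvg_id.
      exact: cvgD (cvgM (cvg_cst c) (cpol z)) (cvgM (cvg_cst `|M|) (cid z)).
    - move=> z /bnd[u du ud]; exists (c * dot u d + `|M|).
        have := is_deriveD (is_deriveZ c (pderive_dot d du)) (is_deriveZ `|M| (is_derive_id z 1)).
        by move/is_derive_eq; apply; rewrite /GRing.scale /= mulr1.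
      have : `|c * dot u d| <= `|M| by rewrite normrM c1 mul1r.
      by rewrite ler_norml => /andP[]; lra.
  have := mono 1; have := mono (-1); rewrite normrN normr1 => /(_ erefl) h1 /(_ erefl) h2.
  have xy0 : x - y <= 0 by lra.
  rewrite (ler0_norm xy0) /coil ler_norml; apply/andP; split; lra.
apply: hausdorff1_le_image => //.
suff H x y : s <= x -> x <= y -> y <= t ->
    pdist (coil r b k x) (coil r b k y) <= 2 * `|M| * `|x - y|.
  move=> x y; rewrite /= !in_itv /= => /andP[x1 x2] /andP[y1 y2].
  by have [xy|/ltW yx] := leP x y; [exact: H|rewrite pdistC distrC; exact: H].
move=> sx xy yt; have e1 := enorm_ell (0 : R).
apply: (le_trans (enorm_le_dot _ e1)).
have := lip _ x y e1 sx xy yt.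
have := lip (rot90 (ell 0)) x y _ sx xy yt; rewrite enorm_rot90 => /(_ e1).
lra.
Qed.

(** Only finitely many turns meet the disk; each is cut at the angle 0 so that [arc_finite] applies
    to both halves. *)
Lemma chart_piece (M : R) : exists U, [/\ closed U, U `<=` G, (hausdorff1 U < +oo)%E &
  G `&` cone a b `&` cdisk M `<=` U].
Proof.
have [K K1 HK] := chart_radius_ge (M + 1).
have a0 := chart_gt0 HC.
have [U [cU UG fU KU]] : exists U, [/\ closed U, U `<=` G, (hausdorff1 U < +oo)%E &
    forall k, (1 <= k)%N -> (k < K)%N -> coil r b k @` `[- a, a] `<=` U].
  elim: K {K1 HK} => [|K [U [cU UG fU KU]]].
    by exists set0; split => //; [exact: closed0|rewrite hausdorff1_set0].
  have [K1|K1] := leqP 1 K; last first.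
    by exists U; split => // k k1 kK; apply: KU => //; lia.
  pose V1 := coil r b K @` `[- a, 0]; pose V2 := coil r b K @` `[0, a].
  exists (U `|` (V1 `|` V2)); split.
  - apply: closedU => //; apply: closedU; apply: (arc_closed HC) => //; lra.
  - move=> x [/UG//|[|]] [t /= + <-]; rewrite in_itv /= => /andP[t1 t2];
      apply: (chart_in HC) => //; apply/andP; split; lra.
  - apply: (@le_lt_trans _ _ (hausdorff1 U + (hausdorff1 V1 + hausdorff1 V2))%E).
      by apply: (le_trans (outer_measureU2 _ _ _)); rewrite leeD2l// outer_measureU2.
    rewrite !lte_add_pinfty//; apply: arc_finite => //; try lra.
      by move=> y /andP[_ y0]; rewrite lt_eqF.
    by move=> y /andP[y0 _]; rewrite gt_eqF.
  - move=> k k1; rewrite ltnS leq_eqVlt => /orP[/eqP ->|kK]; last first.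
      by move=> x xk; left; exact: KU xk.
    move=> _ [t /= + <-]; rewrite in_itv /= => /andP[t1 t2]; right.
    have [t0|t0] := leP t 0; [left|right]; exists t => //=; rewrite in_itv /=.
      by rewrite t1.
    by rewrite (ltW t0).
exists U; split => // x [[Gx [rx [t [rx0 tb xE]]]] xM].
have ta : - a <= t - b <= a by move: tb => /andP[? ?]; apply/andP; split; lra.
have [|k [v [k1 va E]]] := chart_out HC Gx rx0 ta.
  by rewrite xE; congr (_ *: ell _); ring.
apply: (KU k k1); last by exists v => //=; rewrite in_itv.
rewrite ltnNge; apply/negP => /HK/(_ va); move: xM; rewrite /cdisk /= E coilE enormZ enorm_ell mulr1.
rewrite ger0_norm ?(chart_ge0 HC)//; lra.
Qed.

End ChartPieces.

Section PolarCoordinates.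
Context {R : realType}.

Lemma polar_coordinates (x : plane R) : exists t, 0 <= t <= 1 /\ x = enorm x *: ell t.
Proof.
have [x0|x0] := eqVneq (enorm x) 0.
  by exists 0; rewrite lexx ler01 x0 scale0r (enorm_eq0 x0).
have [u uE] : exists u, u = (enorm x)^-1 *: x by eexists.
have u1 : enorm u = 1 by rewrite uE enormZ normfV ger0_norm ?enorm_ge0// mulVf.
have xE : x = enorm x *: u by rewrite uE scalerA divff// scale1r.
have [t t01 ut] : exists2 t : R, 0 <= t <= 1 & u = ell t; last by exists t; rewrite -ut; split.
have p0 : 0 < 2 * pi :> R by rewrite mulr_gt0 ?pi_gt0.
have u11 : -1 <= u.1 <= 1 by rewrite -ler_norml -u1 enorm_ge_fst.
have := acos_def u11 => -[/andP[a0 ap] ca].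
have sa : sin (acos u.1) = `|u.2|.
  rewrite sin_acos// -(sqrtr_sqr u.2); congr Num.sqrt.
  have := dot_unit u1; rewrite /dot -!expr2; lra.
have [u2|u2] := leP 0 u.2.
  exists (acos u.1 / (2 * pi)).
    rewrite divr_ge0 ?(ltW p0)//= ler_pdivrMr// mul1r; lra.
  rewrite /ell mulrCA divff ?gt_eqF// mulr1 sa ca ger0_norm//.
  by case: (u).
exists (1 - acos u.1 / (2 * pi)).
  have : 0 <= acos u.1 / (2 * pi) <= 1.
    rewrite divr_ge0 ?(ltW p0)//= ler_pdivrMr// mul1r; lra.
  lra.
rewrite addrC ellD1 /ell mulrN mulrCA divff ?gt_eqF// mulr1 cosN sinN sa ca ltr0_norm// opprK.
by case: (u).
Qed.

End PolarCoordinates.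

Section SpiralClosed.
Context {R : realType}.
Variables (G : set (plane R)) (I : set R) (s : spiral_data R).
Hypothesis HG : spiraling G I s.

Lemma circle_representative (t : R) : 0 <= t <= 1 ->
  exists2 b, circle b & forall y, ell (b + y) = ell (t + y) :> plane R.
Proof.
move=> /andP[t0]; rewrite le_eqVlt => /orP[/eqP ->|t1].
  exists 0; first by apply/circleE; rewrite lexx ltr01.
  by move=> y; rewrite add0r addrC ellD1.
by exists t => //; apply/circleE; rewrite t0.
Qed.

(** The property is stable under finite unions of the sets [B] of angles, and so passes from small
    balls to all of [[0, 1]] by compactness. *)
Let piece (M : R) (B : set R) := exists U : set (plane R), [/\ closed U, U `<=` G, (hausdorff1 U < +oo)%E &
  forall x t, G x -> enorm x <= M -> x = enorm x *: ell t -> B t -> U x].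

Lemma spiral_local_piece (M t : R) : 0 <= t <= 1 -> exists2 d, 0 < d & piece M (ball t d).
Proof.
move=> /circle_representative[b cb bt]; have [a HC _] := spiral_chart HG cb.
exists a; first exact: chart_gt0 HC.
have [U [cU UG fU HU]] := chart_piece HC M.
exists U; split => // x y Gx xM xE; rewrite /ball /= distrC ltr_distl => /andP[y1 y2].
apply: HU; split => //; split => //; exists (enorm x), (b + (y - t)); split.
- exact: enorm_ge0.
- by apply/andP; split; lra.
- by rewrite bt addrC subrK.
Qed.

Lemma spiral_piece (M : R) : exists U, [/\ closed U, U `<=` G, (hausdorff1 U < +oo)%E &
  G `&` cdisk M `<=` U].
Proof.
pose P (t d : R) : Prop := 0 <= t <= 1 -> 0 < d /\ piece M (ball t d).
have [dl Hdl] : {dl : R -> R & forall t, P t (dl t)}.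
  apply: (@choice _ _ P) => t; rewrite /P.
  have [t01|] := pselect (0 <= t <= 1); last by exists 0.
  by have [d d0 pd] := spiral_local_piece M t01; exists d.
have := @segment_compact R 0 1; rewrite compact_cover.
move=> /(_ R `[0, 1]%classic (fun t => ball t (dl t))); case.
- by move=> t _; exact: ball_open.
- move=> t /= t01; exists t => //; apply: ballxx.
  by apply: (Hdl t _).1; move: t01; rewrite in_itv.
move=> D D01 cov; have /finite_seqP[l lE] := finite_fset D.
have l01 : {subset l <= `[0, 1]%classic}.
  by move=> y yl; apply: D01; have : [set` l] y by []; rewrite -lE.
rewrite lE in cov; have : piece M (cover [set` l] (fun t => ball t (dl t))).
  rewrite (_ : cover _ _ = [set y | exists2 t, t \in l & ball t (dl t) y]); last first.
    by apply/seteqP; split => y /=; [move=> [t Dt ty]; exists t|move=> [t Dt ty]; exists t].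
  elim: l l01 {lE cov} => [_|y l IH ys].
    exists set0; split => //; [exact: closed0|by rewrite hausdorff1_set0|].
    by move=> x t _ _ _ [].
  have [z zl|U [cU UG fU HU]] := IH; first by apply: ys; rewrite inE zl orbT.
  have /Hdl[_ [V [cV VG fV HV]]] : 0 <= y <= 1.
    by have := ys y; rewrite !inE eqxx /= in_itv => /(_ isT).
  exists (V `|` U); split.
  - exact: closedU.
  - by move=> x [/VG|/UG].
  - by apply: (le_lt_trans (outer_measureU2 _ _ _)); rewrite lte_add_pinfty.
  - move=> x t Gx xM xE [z]; rewrite inE => /orP[/eqP ->|zl] zt; first by left; exact: HV xE zt.
    by right; apply: HU xE _ => //; exists z.
move=> [U [cU UG fU HU]]; exists U; split => // x [Gx xM].
have [t [t01 xE]] := polar_coordinates x.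
by apply: (HU x t) => //; apply: cov; rewrite /= in_itv.
Qed.

(** Near [x] the spiral coincides with the closed set [U] belonging to a larger disk. *)
Lemma spiral_closed : closed G.
Proof.
move=> x xG; have [U [cU UG _ HU]] := spiral_piece (enorm x + 1); apply: UG.
rewrite (closure_id U).1//; apply: (closure_subset HU) => B Bx.
have : nbhs x (B `&` cdisk (enorm x + 1)).
  apply: filterI => //; near=> y; rewrite /cdisk /= ltW//; near: y.
  by apply: (cvgr_lt (enorm x) (@continuous_enorm R x)); rewrite ltrDl.
by move=> /xG[y [Gy [By yM]]]; exists y.
Unshelve. all: by end_near. Qed.

Lemma spiral_locally_finite : locally_finite G.
Proof.
move=> M; have [U [_ _ fU HU]] := spiral_piece M.
exact: le_lt_trans (le_hausdorff1 HU) fU.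
Qed.

End SpiralClosed.

(** * The family of weak limits *)

Section Approach.
Context {R : realType} {T : Type}.
Variables (G : set (plane R)) (b a : R) (r eta rho : R -> R) (h : R -> plane R).
Hypothesis HC : chart G b a r eta rho h [set 0].
Variables (dm dp : plane R).
Hypotheses (hm : h t @[t --> 0^'-] --> dm) (hp : h t @[t --> 0^'+] --> dp).
Hypotheses (dm1 : enorm dm = 1) (dp1 : enorm dp = 1).
Hypotheses (cm : 0 < cross (ell b) dm) (cp : 0 < cross (ell b) dp).
Hypothesis mG : h1measurable G.
Variables (F : set_system T).
Context {FF : ProperFilter F}.
Variables (kn : T -> nat) (th : T -> R).
Hypothesis kn_oo : forall K, \forall n \near F, (K <= kn n)%N.
Hypothesis th0 : th n @[n --> F] --> (0 : R).

Local Notation rn := (fun n => r ((kn n)%:R + b + th n)).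
Local Notation approach_right := (approach_right b a r h [set 0] F kn th).
Local Notation approach_left := (approach_left b a r h [set 0] F kn th).

Lemma heading_near (A : set_system R) (FA : Filter A) d (e : R) : 0 < e -> h t @[t --> A] --> d ->
  \forall t \near A, pdist (h t) d <= e.
Proof.
move=> e0 hd; have e2 : 0 < e / 2 by rewrite divr_gt0.
move/cvgr_dist_le: hd => /(_ _ e2); apply: filterS => t; rewrite distrC => ht.
apply: (le_trans (pdist_le_norm _ _)); lra.
Qed.

Lemma right_window (e : R) : 0 < e -> exists2 d, 0 < d <= a &
  forall y, 0 < y < d -> pdist (h y) dp <= e.
Proof.
move=> e0; have := heading_near _ e0 hp; move=> -[d /= d0 Hd].
have a0 := chart_gt0 HC; exists (Num.min d a); first by rewrite lt_min d0 a0 ge_min lexx orbT.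
move=> y /andP[y0]; rewrite lt_min => /andP[yd _]; apply: Hd => //.
by rewrite /ball /= sub0r normrN gtr0_norm.
Qed.

Lemma left_window (e : R) : 0 < e -> exists2 d, 0 < d <= a &
  forall y, - d < y < 0 -> pdist (h y) dm <= e.
Proof.
move=> e0; have := heading_near _ e0 hm; move=> -[d /= d0 Hd].
have a0 := chart_gt0 HC; exists (Num.min d a); first by rewrite lt_min d0 a0 ge_min lexx orbT.
move=> y /andP[+ y0]; rewrite ltrNl lt_min => /andP[yd _]; apply: Hd => //.
by rewrite /ball /= sub0r normrN ltr0_norm.
Qed.

Lemma far_sine (c : T -> R) (l : R) : 0 < l <= 4^-1 -> c n @[n --> F] --> l ->
  forall A, \forall n \near F, A <= rn n * sin (2 * pi * c n).
Proof.
move=> l4 cl A; have s0 := sin_turn_gt0 l4.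
have cs : sin (2 * pi * c n) @[n --> F] --> sin (2 * pi * l).
  apply: (@cvg_comp _ _ _ (fun n => 2 * pi * c n) sin _ (nbhs (2 * pi * l))); last exact: continuous_sin.
  by apply: cvgM => //; exact: cvg_cst.
near=> n; have sn : sin (2 * pi * l) / 2 < sin (2 * pi * c n).
  by near: n; move/cvgr_gt: cs; apply; lra.
have rA : `|A| / (sin (2 * pi * l) / 2) <= rn n.
  by near: n; exact: (radius_cvg_pinfty HC kn_oo th0).
apply: (le_trans (ler_norm A)).
rewrite ler_pdivrMr in rA; last by rewrite divr_gt0.
apply: (le_trans rA); apply: ler_wpM2l; last exact: ltW.
by near: n; exact: (radius_cvg_pinfty HC kn_oo th0).
Unshelve. all: by end_near. Qed.

Lemma approach_right_const : (\forall n \near F, 0 <= th n) -> approach_right dp.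
Proof.
move=> t0 e e0; have [d /andP[d0 da] Hd] := right_window e0.
have a8 := chart_le HC; exists (fun=> d); split; last first.
  apply: (@far_sine _ d); first by rewrite d0 /=; lra.
  by rewrite -[X in _ --> X]subr0; apply: cvgB => //; exact: cvg_cst.
near=> n; have tn : 0 <= th n by near: n.
split => //.
  by apply/ltW; near: n; move/cvgr_lt: th0; apply.
move=> y /andP[y1 y2]; split; last by apply: Hd; rewrite (le_lt_trans tn).
by move=> /= y0; move: y1; rewrite y0 ltNge tn.
Unshelve. all: by end_near. Qed.

Lemma approach_left_const : (\forall n \near F, th n <= 0) -> approach_left dm.
Proof.
move=> t0 e e0; have [d /andP[d0 da] Hd] := left_window e0.
have a8 := chart_le HC; exists (fun=> - d); split; last first.
  apply: (@far_sine _ d); first by rewrite d0 /=; lra.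
  rewrite -[X in _ --> X]add0r -[X in _ --> _ + X]opprK; apply: cvgB => //; exact: cvg_cst.
near=> n; have tn : th n <= 0 by near: n.
split => //; first by rewrite lerN2.
  by apply/ltW; near: n; move/cvgr_gt: th0; apply; rewrite oppr_lt0.
move=> y /andP[y1 y2]; split; last by apply: Hd; rewrite y1 (lt_le_trans y2).
by move=> /= y0; move: y2; rewrite y0 ltNge tn.
Unshelve. all: by end_near. Qed.

(** When the point recedes from the ray at [b] on its right side, the arc between the ray and the
    point has headings close to the right limit [dp]; its window is [[0, th n]]. Together with
    [approach_right_const], both arcs have direction [dp], which is how full lines arise. *)
Lemma approach_left_zero :
  (forall A, \forall n \near F, A <= rn n * sin (2 * pi * th n)) ->
  (\forall n \near F, 0 <= th n) /\ approach_left dp.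
Proof.
move=> far_n; have tn0 : \forall n \near F, 0 <= th n.
  near=> n; rewrite leNgt; apply/negP => tn.
  have ta : - a < th n < a by near: n; exact: (th_range HC th0).
  have a8 := chart_le HC.
  have : 1 <= rn n * sin (2 * pi * th n) by near: n.
  apply/negP; rewrite -ltNge (@le_lt_trans _ _ 0)// mulr_ge0_le0//.
    by near: n; exact: (radius_cvg_pinfty HC kn_oo th0).
  by apply: sin_turn_le0; apply/andP; split; lra.
split=> // e e0; have [d /andP[d0 da] Hd] := right_window e0.
have a0 := chart_gt0 HC; exists (fun=> 0); split; last first.
  by move=> A; apply: filterS (far_n A) => n; rewrite subr0.
near=> n; split; [lra|by near: n|].
have tn : th n < d by near: n; move/cvgr_lt: th0; apply.
move=> y /andP[y1 y2]; split; last by apply: Hd; rewrite y1 (lt_trans y2).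
by move=> /= y0; move: y1; rewrite y0 ltxx.
Unshelve. all: by end_near. Qed.

Lemma approach_right_zero :
  (forall A, \forall n \near F, A <= - (rn n * sin (2 * pi * th n))) ->
  (\forall n \near F, th n <= 0) /\ approach_right dm.
Proof.
move=> far_n; have tn0 : \forall n \near F, th n <= 0.
  near=> n; rewrite leNgt; apply/negP => tn.
  have ta : - a < th n < a by near: n; exact: (th_range HC th0).
  have a8 := chart_le HC.
  have : 1 <= - (rn n * sin (2 * pi * th n)) by near: n.
  apply/negP; rewrite -ltNge (@le_lt_trans _ _ 0)// oppr_le0 mulr_ge0//.
    by near: n; exact: (radius_cvg_pinfty HC kn_oo th0).
  by apply: sin_turn_ge0; apply/andP; split; lra.
split=> // e e0; have [d /andP[d0 da] Hd] := left_window e0.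
have a0 := chart_gt0 HC; exists (fun=> 0); split; last first.
  by move=> A; apply: filterS (far_n A) => n; rewrite sub0r mulrN sinN mulrN.
near=> n; split; [by near: n|lra|].
have tn : - d < th n by near: n; move/cvgr_gt: th0; apply; rewrite oppr_lt0.
move=> y /andP[y1 y2]; split; last by apply: Hd; rewrite y2 (lt_trans tn).
by move=> /= y0; move: y2; rewrite y0 ltxx.
Unshelve. all: by end_near. Qed.

Let limit d d' := weak_cvg F (fun n => translate (- coil r b (kn n) (th n)) G)
  (edges (eta 0 *: ell b) d d').

Lemma chart_limit_right :
  (forall A, \forall n \near F, A <= rn n * sin (2 * pi * th n)) -> limit dp dp.
Proof.
move=> /approach_left_zero[tn ap]; apply: (chart_weak_cvg HC kn_oo th0) => //.
exact: approach_right_const.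
Qed.

Lemma chart_limit_left :
  (forall A, \forall n \near F, A <= - (rn n * sin (2 * pi * th n))) -> limit dm dm.
Proof.
move=> /approach_right_zero[tn ap]; apply: (chart_weak_cvg HC kn_oo th0) => //.
exact: approach_left_const.
Qed.

Lemma chart_limit_on_ray : (\forall n \near F, th n = 0) -> limit dm dp.
Proof.
move=> tn; apply: (chart_weak_cvg HC kn_oo th0) => //.
  by apply: approach_left_const; apply: filterS tn => n ->.
by apply: approach_right_const; apply: filterS tn => n ->.
Qed.

End Approach.

Section LinesAndEdges.
Context {R : realType}.
Implicit Types (s : spiral_data R) (b t : R) (d e v y : plane R).

Lemma parallel_edgesE s b :
  parallel_edges s b = edges (spacing s b 0 *: ell b) (heading_left s b) (heading_right s b).
Proof.
rewrite /parallel_edges /edges; congr (_ `|` _); apply/seteqP;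
  by split => x [k [t [t0 ->]]]; exists k, t; rewrite scalerA mulrC.
Qed.

Lemma sin_acos_dot e d : enorm e = 1 -> enorm d = 1 -> sin (acos (dot e d)) = `|cross e d|.
Proof.
move=> e1 d1; have ed : -1 <= dot e d <= 1 by rewrite -ler_norml -(mulr1 1) -{1}e1 -d1 dot_le.
rewrite sin_acos// -sqrtr_sqr; congr Num.sqrt.
by have := dot_sqr e d; rewrite !dot_unit// mulr1 => <-; ring.
Qed.

Lemma edges_lineP v d (x : plane R) : edges v d d x <-> exists (k : int) (t : R), x = k%:~R *: v + t *: d.
Proof.
split=> [[[k [t [_ ->]]]|[k [t [_ ->]]]]|[k [t ->]]].
- by exists k, (- t); rewrite scaleNr.
- by exists k, t.
- have [t0|/ltW t0] := leP 0 t; first by right; exists k, t.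
  by left; exists k, (- t); rewrite scaleNr opprK oppr_ge0.
Qed.

(** The component of [e] along [rot90 d] is [- cross e d], so the line through [k l e] has the
    offset [- k l cross e d]; the sign is absorbed by exchanging [k] and [- k]. *)
Lemma parallel_linesE (l : R) e d : enorm e = 1 -> enorm d = 1 -> 0 <= cross e d ->
  parallel_lines d (multiples (l * sin (acos (dot e d)))) = edges (l *: e) d d.
Proof.
move=> e1 d1 c0; rewrite sin_acos_dot// ger0_norm//.
have eE : e = dot e d *: d - cross e d *: rot90 d.
  by rewrite crossEr -scaleNr opprK -unit_decomp.
have lineE (k : int) t : k%:~R *: (l *: e) + t *: d =
    (k%:~R * l * dot e d + t) *: d + (l * cross e d * (- k)%:~R) *: rot90 d.
  rewrite {1}eE !scalerBr !scalerA scalerDl addrAC; congr (_ + _).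
  by rewrite -scaleNr mulrNz; congr (_ *: _); ring.
apply/seteqP; split => x.
  move=> [t [_ [[k _ <-] ->]]]; apply/edges_lineP; exists (- k), (t - (- k)%:~R * l * dot e d).
  by rewrite lineE opprK (addrC _ (t - _)) subrK.
move=> /edges_lineP[k [t ->]]; rewrite lineE.
by eexists; exists (l * cross e d * (- k)%:~R); split; [exists (- k)|].
Qed.

(** A translation along [d] preserves the lines, so only the component of [y] along [rot90 d]
    matters; this is the parameter [tau] of [line_limits]. *)
Lemma translate_lines v d y : enorm d = 1 ->
  translate y (edges v d d) = translate (dot y (rot90 d) *: rot90 d) (edges v d d).
Proof.
move=> d1; have slide c : translate (c *: d) (edges v d d) = edges v d d.
  apply/seteqP; split => x.
    move=> /translateE/edges_lineP[k [t E]]; apply/edges_lineP; exists k, (t + c).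
    by rewrite scalerDl addrA -E; exact: (esym (subrK _ _)).
  move=> /edges_lineP[k [t E]]; apply/translateE/edges_lineP; exists k, (t - c).
  by rewrite scalerBl addrA -E.
by rewrite {1}(unit_decomp y d1) addrC -translateD slide.
Qed.

Lemma closed_translate y (A : set (plane R)) : closed A -> closed (translate y A).
Proof.
move=> cA; rewrite (_ : translate y A = (fun x => x - y) @^-1` A).
  apply: closed_comp cA => x _.
  by apply: (@cvgB _ (plane R : normedModType R) _ _ _ id (fun=> y)); [exact: cvg_id|exact: cvg_cst].
by apply/seteqP; split => x; rewrite translateE.
Qed.

Lemma locally_finite_translate y (A : set (plane R)) :
  locally_finite A -> locally_finite (translate y A).
Proof.
move=> fA M; rewrite -(hausdorff1_translate (- y)).
apply: le_lt_trans (fA (M + enorm y)); apply: le_hausdorff1 => x.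
move=> /translateE[]; rewrite translateE opprK addrK => Ax xM; split => //.
by have := enormB (x + y) y; rewrite addrK /cdisk /=; move: xM; rewrite /cdisk /=; lra.
Qed.

End LinesAndEdges.

Section Ultrafilters.
Context {R : realType} {T : Type}.
Variables (F : set_system T).
Context {FU : UltraFilter F}.

Lemma fmap_ultra (U : Type) (f : T -> U) : UltraFilter (f @ F).
Proof.
split=> [|H FH sFH]; first exact: fmap_proper_filter.
apply/seteqP; split => // A HA; have [//|FnA] := in_ultra_setVsetC (f @^-1` A) FU.
have HnA : H (~` A) by exact: sFH.
by have /filter_ex[x []] : H (A `&` ~` A) by exact: filterI.
Qed.

Lemma compact_ultra_cvg (U : topologicalType) (f : T -> U) (A : set U) : compact A ->
  (\forall n \near F, A (f n)) -> exists2 x, A x & f n @[n --> F] --> x.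
Proof.
rewrite compact_ultra => cA FA; have [x [Ax fx]] := cA _ (fmap_ultra f) FA.
by exists x.
Qed.

Lemma ultra_bounded_cvg (f : T -> plane R) (M : R) :
  (\forall n \near F, enorm (f n) <= M) -> exists y, pdist (f n) y @[n --> F] --> 0.
Proof.
move=> fM; have [y _ fy] := compact_ultra_cvg (@compact_cdisk R M) fM.
exists y; rewrite -(pdistxx y).
apply: (@cvg_comp _ _ _ f (fun x => pdist x y) _ (nbhs y)) => //.
exact: continuous_pdist.
Qed.

Lemma ultra_bounded (q : T -> R) : (exists M, \forall n \near F, q n <= M) \/
  forall M, \forall n \near F, M <= q n.
Proof.
have [|nb] := pselect (exists M, \forall n \near F, q n <= M); first by left.
right=> M; have [h|] := in_ultra_setVsetC [set n | q n <= M] FU.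
  by exfalso; apply: nb; exists M.
by apply: filterS => n /= /negP; rewrite -ltNge => /ltW.
Qed.

(** Oscillation is impossible along an ultrafilter, which decides each bound one way or the
    other. *)
Lemma ultra_trichotomy (q : T -> R) : [\/ exists M, \forall n \near F, `|q n| <= M,
  forall M, \forall n \near F, M <= q n | forall M, \forall n \near F, M <= - q n].
Proof.
have [[M1 h1]|] := ultra_bounded q; last by constructor 2.
have [[M2 h2]|] := ultra_bounded (fun n => - q n); last by constructor 3.
constructor 1; exists (Num.max M1 M2); apply: filterS2 h1 h2 => n q1 q2.
by rewrite ler_norml lerNl !le_max q1 q2 orbT.
Qed.

End Ultrafilters.

Section NearestTurn.
Context {R : realType}.
Variables (G : set (plane R)) (b a : R) (r eta rho : R -> R) (h : R -> plane R).
Variable Z : set R.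
Hypothesis HC : chart G b a r eta rho h Z.

(** Turns are nearly equidistant on each ray, with spacing and offset bounded over the window, so
    every radius is within a uniform distance of some turn. *)
Lemma nearest_turn : exists C : R, forall t R0, - a <= t <= a -> 0 <= R0 ->
  exists2 k, (1 <= k)%N & `|r (k%:R + b + t) - R0| <= C.
Proof.
have a0 := chart_gt0 HC; have aa : - a <= a by lra.
have [c _ etac] := EVT_max aa (chart_spacing_cont HC).
have [c1 _ rho1] := EVT_max aa (chart_offset_cont HC).
have [c2 _ rho2] := EVT_min aa (chart_offset_cont HC).
have [K K1 HK] := chart_equispacing HC ltr01.
exists (eta c * K.+1%:R + `|rho c1| + `|rho c2| + 1) => t R0 ta R00.
have tin : t \in `[- a, a]%R by rewrite in_itv.
have e0 := chart_spacing_gt0 HC ta.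
pose m := Num.trunc (R0 / eta t).
have /andP[m1 m2] : m%:R * eta t <= R0 < m.+1%:R * eta t.
  have q0 : 0 <= R0 / eta t by rewrite divr_ge0// ltW.
  by have := trunc_itv q0; rewrite -/m ler_pdivlMr// ltr_pdivrMr.
(* Adding [K] brings the index into the range of the equispacing estimate, at a cost of at most [K]
   maximal spacings. *)
exists (m + K)%N; first by rewrite (leq_trans K1)// leq_addl.
have := HK (m + K)%N t (leq_addl _ _) ta; rewrite natrD => hk.
have : eta t * K%:R <= eta c * K%:R by rewrite ler_wpM2r// etac.
have := etac t tin; have := rho1 t tin; have := rho2 t tin.
have := ler_norm (rho c1); have := ler_norm (- rho c2); rewrite normrN.
have : 0 <= eta t * K%:R by rewrite mulr_ge0// ltW.
have : 0 <= `|rho c1| by []. have : 0 <= `|rho c2| by [].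
move: hk m2; rewrite -!natr1 !ler_norml => /andP[hk1 hk2] m2 *.
by apply/andP; split; lra.
Qed.

Lemma turns_pinfty {T : Type} (F : set_system T) (FF : ProperFilter F) (kn : T -> nat) (th : T -> R) :
  (forall n, 1 <= kn n)%N -> (\forall n \near F, - a <= th n <= a) ->
  (forall A, \forall n \near F, A < r ((kn n)%:R + b + th n)) ->
  forall K, \forall n \near F, (K <= kn n)%N.
Proof.
move=> k1 tha rA K; have [B HB] := chart_radius_bounded HC K.
near=> n; rewrite leqNgt; apply/negP => kK.
have : B < r ((kn n)%:R + b + th n) by near: n.
by rewrite ltNge HB//; near: n.
Unshelve. all: by end_near. Qed.

(** The angle comes first, and the turn is then taken so late that the point is at least [n] away
    from the ray at [b]. Angles can thus tend to 0 while the ray recedes. *)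
Lemma far_turns (th : nat -> R) : (\forall n \near \oo, 0 < `|th n| <= a) ->
  exists kn : nat -> nat, (forall n, n <= kn n)%N /\
    forall A, \forall n \near \oo, A <= r ((kn n)%:R + b + th n) * sin (2 * pi * `|th n|).
Proof.
move=> tha.
pose P (n k : nat) := (n <= k)%N /\ (0 < `|th n| <= a ->
  n%:R <= r (k%:R + b + th n) * sin (2 * pi * `|th n|)).
have [kn Hkn] : {kn : nat -> nat & forall n, P n (kn n)}.
  apply: (@choice _ _ P) => n.
  have [ta|] := pselect (0 < `|th n| <= a); last by exists n; split.
  have a8 := chart_le HC.
  have s0 : 0 < sin (2 * pi * `|th n|).
    by apply: sin_turn_gt0; move: ta => /andP[-> ?] /=; lra.
  have [K K1 HK] := chart_radius_ge HC (n%:R / sin (2 * pi * `|th n|)).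
  exists (maxn n K); split; first by rewrite leq_maxl.
  move=> _; rewrite -ler_pdivrMr//; apply: HK; first by rewrite leq_maxr.
  by rewrite -ler_norml; case/andP: ta.
exists kn; split => [n|A]; first by case: (Hkn n).
near=> n; have [_ hn] := Hkn n; apply: le_trans (hn _); last by near: n.
have : (Num.trunc `|A|).+1%:R <= n%:R :> R by rewrite ler_nat; near: n; exact: nbhs_infty_ge.
by apply: le_trans; apply: (le_trans (ler_norm A)); exact/ltW/truncnS_gt.
Unshelve. all: by end_near. Qed.

(** Within an eighth of a turn the cosine is nonnegative, whence [1 - cos] is at most [|sin|].
    Distance to the ray thus controls distance to the point of equal radius on the ray. *)
Lemma ell_deviation (t : R) : - 8^-1 <= t <= 8^-1 ->
  pdist (ell (b + t)) (ell b) <= 2 * `|sin (2 * pi * t)|.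
Proof.
move=> t8; have e1 := enorm_ell b; apply: (le_trans (enorm_le_dot _ e1)).
rewrite !dotBl (dot_unit e1) dot_rot90 subr0 (dotC _ (rot90 _)) -crossE cross_ell.
rewrite dotC dot_ell (_ : b + t - b = t); last by ring.
have c1 : cos (2 * pi * t) <= 1 by exact: cos_le1.
have c0 : 0 <= cos (2 * pi * t).
  apply: cos_ge0_pihalf; have p0 := pi_gt0 R; move: t8 => /andP[t1 t2].
  have : pi * t <= pi * 8^-1 by rewrite ler_pM2l.
  have : pi * - 8^-1 <= pi * t by rewrite ler_pM2l.
  by move=> h1 h2; apply/andP; split; lra.
have : `|cos (2 * pi * t) - 1| <= `|sin (2 * pi * t)|; last by lra.
rewrite -ler_sqr ?nnegrE// !real_normK ?num_real//.
have := cos2Dsin2 (2 * pi * t); nra.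
Qed.

End NearestTurn.

Lemma ray_offset (R : realType) (x y : R) (u w : plane R) :
  - (x *: u) + y *: w = (y - x) *: w - x *: (u - w).
Proof.
by apply/pair_equal_spec; rewrite /= /GRing.scale /=; split; ring.
Qed.

Section WeakLimits.
Context {R : realType}.
Variables (G : set (plane R)) (I : set R) (s : spiral_data R).
Hypothesis HG : spiraling G I s.

Let mG : h1measurable G := h1measurable_trajectory (spiral_trajectory HG).

Lemma weak_limits_translate (p : nat -> plane R) E z : trajectory_set E -> locally_finite E ->
  weak_cvg \oo (fun n => translate (- p n) G) E -> weak_limits G (translate z E).
Proof.
move=> tE fE cvE; split; first exact: trajectory_set_translate.
exists (fun n => z - p n) => phi cphi p0 kphi.
have tphi : test_function phi by split.
have zz : pdist z z @[n --> \oo] --> (0 : R) by rewrite pdistxx; exact: cvg_cst.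
have mn n : h1measurable (translate (- p n) G) by exact: h1measurable_translate.
have := weak_cvg_translate (y := fun=> z) eventually_filter mn (h1measurable_trajectory tE) fE zz cvE tphi.
by apply: cvg_trans; apply: near_eq_cvg; apply: nearW => n; rewrite translateD.
Qed.

Lemma translates_weak_limits z : weak_limits G (translate z G).
Proof.
apply: (@weak_limits_translate (fun=> 0)).
- exact: spiral_trajectory HG.
- exact: spiral_locally_finite HG.
- by move=> phi _; rewrite oppr0 translate0; exact: cvg_cst.
Qed.

Section AtAngle.
Variables (b a : R).
Hypothesis HC : chart G b a (Defs.radius s b) (spacing s b) (offset s b) (heading s b) [set 0].
Let r := Defs.radius s b.
Let dl := heading_left s b.
Let dr := heading_right s b.
Let v := spacing s b 0 *: ell b.
Hypotheses (hl : heading s b t @[t --> 0^'-] --> dl) (hr : heading s b t @[t --> 0^'+] --> dr).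
Hypotheses (dl1 : enorm dl = 1) (dr1 : enorm dr = 1).
Hypotheses (cl : 0 < cross (ell b) dl) (cr : 0 < cross (ell b) dr).

Let v0 d : 0 < cross (ell b) d -> 0 < cross v d.
Proof.
move=> cd; rewrite crossZl mulr_gt0// (chart_spacing_gt0 HC)//.
by have a0 := chart_gt0 HC; apply/andP; split; lra.
Qed.

Lemma edges_weak_limit z : weak_limits G (translate z (edges v dl dr)).
Proof.
apply: (@weak_limits_translate (fun n => coil r b n 0)).
- exact: trajectory_set_edges.
- by apply: edges_locally_finite => //; exact: v0.
- apply: (chart_limit_on_ray HC hl hr dl1 dr1 cl cr mG (th := fun=> 0)).
  + by move=> K; exact: nbhs_infty_ge.
  + exact: cvg_cst.
  + by apply: nearW => n; exact: erefl.
Qed.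

Let small_harmonic : \forall n \near \oo, 0 < `|harmonic n : R| <= a.
Proof.
near=> n; rewrite gtr0_norm ?harmonic_gt0//=; apply/ltW; near: n.
by apply: (cvgr_lt (0 : R) cvg_harmonic); exact: chart_gt0 HC.
Unshelve. all: by end_near. Qed.

Lemma lines_right_weak_limit z : weak_limits G (translate z (edges v dr dr)).
Proof.
have [kn [nk far_kn]] := far_turns HC small_harmonic.
apply: (@weak_limits_translate (fun n => coil r b (kn n) (harmonic n))).
- exact: trajectory_set_edges.
- by apply: edges_locally_finite => //; exact: v0.
- apply: (chart_limit_right HC hr dr1 cr mG (th := harmonic)).
  + by move=> K; near=> n; apply: leq_trans (nk n); near: n; exact: nbhs_infty_ge.
  + exact: cvg_harmonic.
  + by move=> A; apply: filterS (far_kn A) => n; rewrite gtr0_norm// harmonic_gt0.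
Unshelve. all: by end_near. Qed.

Lemma lines_left_weak_limit z : weak_limits G (translate z (edges v dl dl)).
Proof.
have : \forall n \near \oo, 0 < `|- harmonic n : R| <= a.
  by apply: filterS small_harmonic => n; rewrite normrN.
move=> /(far_turns HC)[kn [nk far_kn]].
apply: (@weak_limits_translate (fun n => coil r b (kn n) (- harmonic n))).
- exact: trajectory_set_edges.
- by apply: edges_locally_finite => //; exact: v0.
- apply: (chart_limit_left HC hl dl1 cl mG (th := fun n => - harmonic n)).
  + by move=> K; near=> n; apply: leq_trans (nk n); near: n; exact: nbhs_infty_ge.
  + by rewrite -[X in _ --> X]oppr0; apply: cvgN; exact: cvg_harmonic.
  + move=> A; apply: filterS (far_kn A) => n; rewrite normrN gtr0_norm ?harmonic_gt0//.
    by rewrite mulrN sinN mulrN opprK.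
Unshelve. all: by end_near. Qed.

Lemma closed_limit_edges d d' : 0 < cross (ell b) d -> 0 < cross (ell b) d' -> closed (edges v d d').
Proof. by move=> cd cd'; apply: closed_edges; exact: v0. Qed.

Lemma locally_finite_limit_edges d d' : enorm d = 1 -> enorm d' = 1 ->
  0 < cross (ell b) d -> 0 < cross (ell b) d' -> locally_finite (edges v d d').
Proof. by move=> d1 d1' cd cd'; apply: edges_locally_finite => //; exact: v0. Qed.

End AtAngle.

Section UltraLimit.
Variables (G' : set (plane R)) (F : set_system nat).
Context {FU : UltraFilter F}.
Variable z : nat -> plane R.
Hypothesis mG' : h1measurable G'.
Hypothesis cvG' : weak_cvg F (fun n => translate (z n) G) G'.

(** [z n + G] is [- p n + G] translated by [z n + p n], and these bounded vectors converge along an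
    ultrafilter; [weak_cvg_unique] then identifies [G']. *)
Lemma ultra_limit_translate (p : nat -> plane R) (E : set (plane R)) (C : R) : closed E -> locally_finite E ->
  (\forall n \near F, enorm (z n + p n) <= C) ->
  weak_cvg F (fun n => translate (- p n) G) E -> exists y, H1_equal G' (translate y E).
Proof.
move=> cE fE zpC cvE; have [y zpy] := ultra_bounded_cvg zpC; exists y.
apply: (weak_cvg_unique _ mG' (@closed_translate R y E cE) (@locally_finite_translate R y E fE) cvG').
have mn n : h1measurable (translate (- p n) G) by exact: h1measurable_translate.
have := weak_cvg_translate _ mn (h1measurable_closed cE) fE zpy cvE.
move=> cv phi /cv; apply: cvg_trans; apply: near_eq_cvg; apply: nearW => n.
by rewrite translateD addrK.
Qed.

Lemma ultra_limit_bounded (C : R) : (\forall n \near F, enorm (z n) <= C) ->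
  exists y, H1_equal G' (translate y G).
Proof.
move=> zC; apply: (@ultra_limit_translate (fun=> 0) G C).
- exact: spiral_closed HG.
- exact: spiral_locally_finite HG.
- by apply: filterS zC => n; rewrite addr0.
- by move=> phi _; rewrite oppr0 translate0; exact: cvg_cst.
Qed.

(* Following [- z n] in polar coordinates, its angle converges to some [b]; the
   limit is decided by its distance to the ray at [b], which may stay bounded or
   tend to infinity on either side. *)
Lemma ultra_limit_unbounded : (forall C, \forall n \near F, C <= enorm (z n)) ->
  exists2 G'', (line_limits s `|` edge_limits I s) G'' & H1_equal G' G''.
Proof.
move=> z_oo; have [t Ht] : {t : nat -> R & forall n, 0 <= t n <= 1 /\ - z n = enorm (z n) *: ell (t n)}.
  apply: (@choice _ _ (fun n tn => 0 <= tn <= 1 /\ - z n = enorm (z n) *: ell tn)) => n.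
  by have [tn [t01 E]] := polar_coordinates (- z n); exists tn; rewrite enormN in E.
have [too t01 tt] : exists2 x : R, `[0, 1]%classic x & t n @[n --> F] --> x.
  apply: (compact_ultra_cvg (@segment_compact R 0 1)); apply: nearW => n.
  by rewrite /= in_itv /=; case: (Ht n).
have {t01} : 0 <= too <= 1 by move: t01; rewrite /= in_itv.
(* The limit angle may be 1, whose representative on the circle is 0. *)
move=> /circle_representative[b cb bt].
have [a HC [[hl hr] [dl1 cl] [dr1 cr] dlr]] := spiral_chart HG cb.
set r := Defs.radius s b in HC.
pose th n := t n - too.
have th0 : th n @[n --> F] --> (0 : R).
  by rewrite -(subrr too); apply: cvgB => //; exact: cvg_cst.
have zE n : z n = - (enorm (z n) *: ell (b + th n)).
  by rewrite bt /th addrC subrK -(Ht n).2 opprK.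
have tha : \forall n \near F, - a <= th n <= a.
  by apply: filterS (th_range HC th0) => n /andP[/ltW -> /ltW ->].
have a0 := chart_gt0 HC; have a00 : - a <= 0 <= a by apply/andP; split; lra.
have [C HN] := nearest_turn HC.
(* Turns whose radius follows [enorm (z n)] up to [C]; their indices tend to infinity with the
   radius. *)
have turns (c : nat -> R) : (\forall n \near F, - a <= c n <= a) -> exists kn : nat -> nat,
    (forall K, \forall n \near F, (K <= kn n)%N) /\
    \forall n \near F, `|r ((kn n)%:R + b + c n) - enorm (z n)| <= C.
  move=> ca; pose P (n k : nat) := (1 <= k)%N /\ (- a <= c n <= a ->
    `|r (k%:R + b + c n) - enorm (z n)| <= C).
  have [kn Hkn] : {kn : nat -> nat & forall n, P n (kn n)}.
    apply: (@choice _ _ P) => n.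
    have [cn|] := pselect (- a <= c n <= a); last by exists 1%N; split.
    have [k k1 hk] := HN (c n) (enorm (z n)) cn (enorm_ge0 _).
    by exists k; split.
  have close : \forall n \near F, `|r ((kn n)%:R + b + c n) - enorm (z n)| <= C.
    by apply: filterS ca => n /(Hkn n).2.
  exists kn; split => //; apply: (turns_pinfty HC _ _ ca) => [n|A]; first by case: (Hkn n).
  apply: filterS2 close (z_oo (A + C + 1)) => n; rewrite ler_norml => /andP[h1 _]; lra.
have line z0 d : enorm d = 1 -> 0 < cross (ell b) d ->
    d = heading_right s b \/ d = heading_left s b ->
    (line_limits s `|` edge_limits I s) (translate z0 (edges (spacing s b 0 *: ell b) d d)).
  move=> d1 cd dE; left; exists b, (dot z0 (rot90 d)), d; split => //.
  by rewrite translate_lines// parallel_linesE ?enorm_ell// ltW.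
(* Passing from [enorm (z n)] to the radius of the nearest turn changes the distance to the ray by
   at most [C], so that an infinite limit is preserved. *)
have deviation n y x : `|x - enorm (z n)| <= C ->
    `|x * sin (2 * pi * y) - enorm (z n) * sin (2 * pi * y)| <= C.
  rewrite -mulrBl normrM => hC; apply: le_trans hC; rewrite ler_piMr//.
  by rewrite ler_norml sin_geN1 sin_le1.
have [[M qM]|q_oo|q_oo] := ultra_trichotomy (fun n => enorm (z n) * sin (2 * pi * th n)).
(* At bounded distance from the ray at [b], the base points are taken on that ray; by
   [ell_deviation] they stay within [C + 2 M] of [- z n]. *)
- have [|kn [kn_oo close]] := turns (fun=> 0); first exact: nearW.
  have [|y Hy] := @ultra_limit_translate (fun n => coil r b (kn n) 0)
      (edges (spacing s b 0 *: ell b) (heading_left s b) (heading_right s b))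
      (C + 2 * M) (closed_limit_edges HC cl cr) (locally_finite_limit_edges HC dl1 dr1 cl cr) _
      (chart_limit_on_ray HC hl hr dl1 dr1 cl cr mG kn_oo (cvg_cst _) (nearW _ (fun=> erefl))).
    near=> n; have hM : `|enorm (z n) * sin (2 * pi * th n)| <= M by near: n.
    have hC : `|r ((kn n)%:R + b + 0) - enorm (z n)| <= C by near: n.
    have ta : - a <= th n <= a by near: n.
    have a8 := chart_le HC.
    have dev : pdist (ell (b + th n)) (ell b) <= 2 * `|sin (2 * pi * th n)|.
      by apply: ell_deviation; move: ta => /andP[h1 h2]; apply/andP; split; lra.
    rewrite coilE (addr0 b) (_ : _ + _ = (r ((kn n)%:R + b + 0) - enorm (z n)) *: ell b -
        enorm (z n) *: (ell (b + th n) - ell b)); last first.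
      by rewrite {1}zE; exact: ray_offset.
    apply: (le_trans (enormB _ _)); rewrite !enormZ enorm_ell mulr1; apply: lerD => //.
    rewrite ger0_norm ?enorm_ge0// -/(pdist _ _); move: hM; rewrite normrM ger0_norm ?enorm_ge0//.
    have : enorm (z n) * pdist (ell (b + th n)) (ell b) <= enorm (z n) * (2 * `|sin (2 * pi * th n)|).
      by rewrite ler_wpM2l// enorm_ge0.
    lra.
  (* At a regular angle the two one-sided headings coincide, and the edges are full lines. *)
  have [Ib|Ib] := pselect (I b).
    exists (translate y (parallel_edges s b)); last by rewrite parallel_edgesE.
    by right; exists b, y.
  eexists; last exact: Hy; rewrite (dlr Ib); apply: line => //; by left.
- have [kn [kn_oo close]] := turns th tha.
  have far A : \forall n \near F, A <= r ((kn n)%:R + b + th n) * sin (2 * pi * th n).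
    apply: filterS2 close (q_oo (A + C)) => n /(deviation n (th n)).
    rewrite ler_norml => /andP[h1 h2] hq; lra.
  have [|y Hy] := @ultra_limit_translate (fun n => coil r b (kn n) (th n))
      (edges (spacing s b 0 *: ell b) (heading_right s b) (heading_right s b))
      C (closed_limit_edges HC cr cr) (locally_finite_limit_edges HC dr1 dr1 cr cr) _
      (chart_limit_right HC hr dr1 cr mG kn_oo th0 far).
    apply: filterS close => n hC; rewrite coilE {1}zE addrC -scalerBl.
    by rewrite enormZ enorm_ell mulr1.
  by eexists; last exact: Hy; apply: line => //; left.
- have [kn [kn_oo close]] := turns th tha.
  have far A : \forall n \near F, A <= - (r ((kn n)%:R + b + th n) * sin (2 * pi * th n)).
    apply: filterS2 close (q_oo (A + C)) => n /(deviation n (th n)).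
    rewrite ler_norml => /andP[h1 h2] hq; lra.
  have [|y Hy] := @ultra_limit_translate (fun n => coil r b (kn n) (th n))
      (edges (spacing s b 0 *: ell b) (heading_left s b) (heading_left s b))
      C (closed_limit_edges HC cl cl) (locally_finite_limit_edges HC dl1 dl1 cl cl) _
      (chart_limit_left HC hl dl1 cl mG kn_oo th0 far).
    apply: filterS close => n hC; rewrite coilE {1}zE addrC -scalerBl.
    by rewrite enormZ enorm_ell mulr1.
  by eexists; last exact: Hy; apply: line => //; right.
Unshelve. all: by end_near. Qed.

End UltraLimit.
End WeakLimits.

Theorem theorem17 (R : realType) (G : set (plane R)) (I : set R)
    (s : spiral_data R) (HG : spiraling G I s) :
  translates G `|` line_limits s `|` edge_limits I s `<=` weak_limits G
  /\ forall G', weak_limits G G' ->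
       exists2 G'', (translates G `|` line_limits s `|` edge_limits I s) G'' &
                    H1_equal G' G''.
Proof.
split=> [A [[[z _ <-]|[b [tau [d [cb dE ->]]]]]|[b [z [Ib ->]]]]|G' [tG' [z cvz]]].
- exact: (translates_weak_limits HG).
- have [a HC [[hl hr] [dl1 cl] [dr1 cr] _]] := spiral_chart HG cb.
  case: dE => ->.
    rewrite parallel_linesE ?enorm_ell// ?ltW//.
    exact: (lines_right_weak_limit HG HC hr dr1 cr).
  rewrite parallel_linesE ?enorm_ell// ?ltW//.
  exact: (lines_left_weak_limit HG HC hl dl1 cl).
- have [a HC [[hl hr] [dl1 cl] [dr1 cr] _]] := spiral_chart HG (exceptional_circle HG Ib).
  by rewrite parallel_edgesE; exact: (edges_weak_limit HG HC hl hr dl1 dr1 cl cr).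
(* An ultrafilter finer than the sequence filter keeps the weak limit, and along it the translations
   are either bounded or tend to infinity. *)
- have [F [FU ooF]] := ultraFilterLemma (@eventually_filter).
  have cvG' : weak_cvg F (fun n => translate (z n) G) G'.
    by move=> phi [cphi p0 kphi] B /(cvz phi cphi p0 kphi); exact: ooF.
  have mG' := h1measurable_trajectory tG'.
  have [[C zC]|z_oo] := ultra_bounded (fun n => enorm (z n)).
    have [y Hy] := ultra_limit_bounded HG mG' cvG' zC.
    by exists (translate y G) => //; left; left; exists y.
  have [G'' HG'' eqG''] := ultra_limit_unbounded HG mG' cvG' z_oo.
  by exists G'' => //; case: HG'' => [hh|hh]; [left; right|right].
Qed.
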